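(* Let $A_0,A_1,A_2$ be analytic functions in $\mathbb{D}$, and let $f$ be a non-trivial (i.e. $f\not\equiv 0$) analytic solution in $\mathbb{D}$ of the differential equation $$f'''+A_2f''+A_1f'+A_0f=0 .$$ (i) If $$\sup_{z\in\mathbb{D}}|A_j(z)|(1-|z|^2)^{3-j}<\infty,\qquad j=0,1,2,$$ then the sequence of two-fold zeros of $f$ is a finite union of separated sequences. (ii) If $$\sup_{a\in\mathbb{D}}\int_{\mathbb{D}}|A_j(z)|(1-|z|^2)^{1-j}\big(1-|\varphi_a(z)|^2\big)\,dm(z)<\infty,\qquad j=0,1,2,$$ then the sequence of two-fold zeros of $f$ is a finite union of uniformly separated sequences.
   Context: $\mathbb{D}=\{z\in\mathbb{C}:|z|<1\}$. $m$ is the Lebesgue area measure normalized so that $m(\mathbb{D})=1$. For $a,z\in\mathbb{D}$, $\varphi_a(z)=(a-z)/(1-\overline{a}z)$. A two-fold zero is a zero of multiplicity exactly two (zeros of non-trivial solutions of the equation have multiplicity at most two); the sequence of two-fold zeros lists each such point once, and it may be empty or finite. A sequence $\{z_n\}\subset\mathbb{D}$ (finite or infinite) is separated (in the hyperbolic metric) if there is a constant $\delta>0$ such that $|z_n-z_k|/|1-\overline{z}_nz_k|>\delta$ for all $n\neq k$. It is uniformly separated if $\inf_k\prod_{n\neq k}\left|\frac{z_n-z_k}{1-\overline{z}_nz_k}\right|>0$. *)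

(* Defs.v *)
(* The complex numbers are R[i] for R : realType. *)
From HB Require Import structures.
From mathcomp Require Import all_boot all_order all_algebra.
From mathcomp Require Import complex.
From mathcomp Require Import all_classical all_reals all_analysis.

Set Implicit Arguments.
Unset Strict Implicit.
Unset Printing Implicit Defensive.

Import Order.TTheory GRing.Theory Num.Theory numFieldNormedType.Exports.
Import ComplexField.Normc.

Local Open Scope classical_set_scope.
Local Open Scope ring_scope.
Local Open Scope complex_scope.

(* [normc z : R] is the modulus |z| as an element of R; `|z| would be an
   element of R[i]. *)
Definition disc (R : realType) : set R[i] := [set z | normc z < 1].

(* R[i]^o is R[i] as a normed space over itself, so [derivable _ z 1] is
   complex differentiability at z. *)
Definition analytic_disc (R : realType) (f : R[i] -> R[i]) : Prop :=
  forall z : R[i], disc z -> derivable (f : R[i]^o -> R[i]^o) z 1.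

(* The n-th complex derivative.  Functions are total on R[i], but only their
   values in the open unit disc matter for derivatives at points of the disc. *)
Definition cderiv (R : realType) (n : nat) (f : R[i] -> R[i]) : R[i] -> R[i] :=
  @derive1n R[i] R[i]^o n f.

Definition zero_of_mult (R : realType) (n : nat) (f : R[i] -> R[i])
    (z : R[i]) : Prop :=
  (forall k : nat, (k < n)%N -> cderiv k f z = 0) /\ cderiv n f z <> 0.

Definition twofold_zeros (R : realType) (f : R[i] -> R[i]) : set R[i] :=
  [set z | disc z /\ zero_of_mult 2 f z].

Definition phi (R : realType) (a z : R[i]) : R[i] := (a - z) / (1 - a^* * z).

Definition pdist (R : realType) (z w : R[i]) : R :=
  normc (z - w) / normc (1 - z^* * w).

(* Integration over the unit disc against dm = dx dy / pi. *)
Definition disc_integral (R : realType) (F : R[i] -> R) : \bar R :=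
  ((pi^-1)%:E *
   \int[(@lebesgue_measure R \x @lebesgue_measure R)%E]_(p in
        [set p : R * R | disc (p.1 +i* p.2)])
     (F (p.1 +i* p.2))%:E)%E.

Definition weighted_bounded (R : realType) (k : nat) (A : R[i] -> R[i]) : Prop :=
  (ereal_sup [set (normc (A z) * (1 - normc z ^+ 2) ^+ k)%:E
             | z in @disc R] < +oo)%E.

Definition weighted_carleson (R : realType) (k : int) (A : R[i] -> R[i]) : Prop :=
  (ereal_sup [set disc_integral (fun z => (normc (A z) *
                    (1 - normc z ^+ 2) ^ k * (1 - normc (phi a z) ^+ 2))%R)
             | a in @disc R] < +oo)%E.

(* A finite or infinite sequence of complex numbers is given by u : nat -> R[i]
   restricted to a set I of indices, which may be any subset of nat; a finite
   (possibly empty) I gives a finite sequence.  The two separation properties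
   below force u to be injective on I. *)
Definition separated_seq (R : realType) (I : set nat) (u : nat -> R[i]) : Prop :=
  exists delta : R, 0 < delta /\
    forall n k : nat, I n -> I k -> n <> k -> delta < pdist (u n) (u k).

(* The infinite product is the limit of its partial products, which are
   nonincreasing in [0, 1] when u maps I into the disc.  The infimum is taken
   in \bar R, so that it is +oo for the empty sequence. *)
Definition uniformly_separated_seq (R : realType) (I : set nat)
    (u : nat -> R[i]) : Prop :=
  (0%:E < ereal_inf [set (limn (fun N : nat =>
             \prod_(0 <= n < N | (n \in I) && (n != k)) pdist (u n) (u k)))%:E
           | k in I])%E.

(* Z, viewed as a sequence listing each of its points once, is the union of
   finitely many sequences having the property P. *)
Definition finite_union_of (R : realType) (P : set nat -> (nat -> R[i]) -> Prop)
    (Z : set R[i]) : Prop :=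
  exists (m : nat) (I : 'I_m -> set nat) (u : 'I_m -> nat -> R[i]),
    (forall j, P (I j) (u j)) /\ Z = \bigcup_j (u j @` I j).

(* Main.v *)
Require Import Defs.
From HB Require Import structures.
From mathcomp Require Import all_boot all_order all_algebra.
From mathcomp Require Import complex.
From mathcomp Require Import all_classical all_reals all_analysis.
From mathcomp Require Import measurable_realfun.
From mathcomp Require Import ring lra.
Set Implicit Arguments. Unset Strict Implicit. Unset Printing Implicit Defensive.
Import Order.TTheory GRing.Theory Num.Theory numFieldNormedType.Exports.
Import ComplexField.Normc.
Local Open Scope classical_set_scope.
Local Open Scope ring_scope.
Local Open Scope complex_scope.
Local Notation re := (@complex.Re _).
Local Notation im := (@complex.Im _).

(** Let [Lam w = |A0 w| u^3 + |A1 w| u^2 + |A2 w| u] with [u = 1 - |w|^2]; this is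
    the natural invariant size of the coefficients.  Both parts of the theorem rest
    on one fact: a segment, in any Moebius chart, from a two-fold zero of [f] to
    another zero has length bounded below by an absolute constant with respect to
    [Lam] times the hyperbolic metric.  To see it, pull [f] back by Bol's
    substitution [G z = q z ^ 2 * f (psi z)], where [q] is the denominator of the
    Moebius map [psi]; its third derivative is [det^3 * f''' (psi z) / q z ^ 4], so
    the equation bounds [G'''] by [Lam] and the lower derivatives of [G].  If [G] has
    a double zero at [z0] and another zero at [b], the Taylor polynomials of [G],
    [G'], [G''] expanded at a point moving from [z0] to [b] and evaluated at [b] have
    derivatives involving [G'''] only.  If [Lam] is small along the way they hardly
    change; but the one of [G] starts with [G'' z0 * (b - z0)^2 / 2], which is not
    zero, and ends with [G b = 0] ([segment_disconjugacy], [moebius_disconjugacy]).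

    Under the hypothesis of (i), [Lam] is bounded, so that no other zero is
    hyperbolically close to a two-fold zero: the sequence of two-fold zeros is itself
    separated ([twofold_zeros_separated]).

    Under the hypothesis of (ii), the submean property of holomorphic functions on
    squares ([submean]) turns the integrals into sums over sample points: for
    points [w] whose neighbourhoods overlap boundedly, the sum of
    [Lam w * (1 - |phi a w|^2)] is bounded uniformly in [a] ([carleson_sample]).  A
    single point shows that [Lam] is bounded ([Lam_bounded]), so the two-fold zeros
    are separated.  A separated sequence is uniformly separated as soon as the sum of
    [1 - |phi a b|^2] over its points [b] is bounded uniformly in [a]
    ([uniformly_separated]).

    To bound this sum, map the disc to the upper half-plane so that [a] becomes
    [i].  The weight [1 - |phi a b|^2] becomes the Poisson kernel of the
    half-plane, comparable to the angle under which the shadow of the dyadic box of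
    [b] on the real line is seen from [i].  Over a point of the real line, consider
    the column of the dyadic boxes above it.  By the basic fact, applied within a
    cone with vertex at that point, the values of [Lam] in the layers between two
    occupied boxes of the column sum up to at least a constant
    ([dyadic_disconjugacy]).  Hence the number of occupied boxes in the column is at
    most a constant plus a multiple of the sum of [Lam] along the column
    ([layer_count]).  Integrating over the real line with respect to the angle seen
    from [i] ([column_sum]) bounds the sum over the two-fold zeros by a constant plus
    a sum of [Lam w * (1 - |phi a w|^2)] over one sample point [w] for each box, and
    these sample points overlap boundedly ([overlap_count], [chart_sum]).  The
    boxes cover the points of height at most one; the remaining points are brought
    there by an inversion, which gives a second chart ([hmap_onto_low]).

    The function theory needed on the way is derived from Goursat's theorem on
    rectangles: Cauchy's formula, in which a lower bound for the integral of the
    kernel is enough, and the differentiability of derivatives. *)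

(** * Moduli and complex derivatives *)

Section modulus.
Variable R : realType.
Local Notation C := R[i].
Implicit Types (x y z w : C) (t : R).

Lemma normc_ge0 x : 0 <= normc x.
Proof. by case: x => a b; rewrite /= sqrtr_ge0. Qed.

Lemma normc_sqr x : normc x ^+ 2 = re x ^+ 2 + im x ^+ 2.
Proof. by case: x => a b /=; rewrite sqr_sqrtr// addr_ge0// sqr_ge0. Qed.

Lemma normc_triangle x y : normc (x + y) <= normc x + normc y.
Proof. exact: le_normcD. Qed.

Lemma normcNE x : normc (- x) = normc x.
Proof. exact: normcN. Qed.

Lemma normcB x y : normc (x - y) = normc (y - x).
Proof. by rewrite -normcNE opprB. Qed.

Lemma normc_triangleB x y : normc (x - y) <= normc x + normc y.
Proof. by rewrite -(normcNE y) normc_triangle. Qed.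

Lemma ler_normcB x y : normc x - normc y <= normc (x - y).
Proof. by rewrite lerBlDr; have := normc_triangle (x - y) y; rewrite subrK. Qed.

Lemma normc_gt0 x : (0 < normc x) = (x != 0).
Proof.
rewrite lt_neqAle normc_ge0 andbT eq_sym; congr negb.
by apply/eqP/eqP => [/eq0_normc //|->]; rewrite normc0.
Qed.

Lemma normcME x y : normc (x * y) = normc x * normc y.
Proof. exact: normcM. Qed.

Lemma normcVE x : normc x^-1 = (normc x)^-1.
Proof. exact: normcV. Qed.

Lemma normc_div x y : normc (x / y) = normc x / normc y.
Proof. by rewrite normcME normcVE. Qed.

Lemma normcX x n : normc (x ^+ n) = normc x ^+ n.
Proof. by elim: n => [|n IH]; rewrite ?expr0 ?normc1// !exprS normcME IH. Qed.

Lemma normcR t : normc (t%:C) = `|t|.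
Proof. by rewrite /= expr0n /= addr0 sqrtr_sqr. Qed.

Lemma normc_nat n : normc (n%:R : C) = n%:R.
Proof.
have -> : (n%:R : C) = (n%:R : R)%:C by rewrite (rmorph_nat (real_complex R)).
by rewrite normcR ger0_norm.
Qed.

Lemma normcJE x : normc (x^*) = normc x.
Proof. by case: x => a b; rewrite /= sqrrN. Qed.

Lemma normci : normc ('i : C) = 1.
Proof. by rewrite /= expr0n /= add0r expr1n sqrtr1. Qed.

Lemma normc_Re x : `|re x| <= normc x.
Proof.
rewrite -(@ler_pXn2r _ 2) ?nnegrE ?normc_ge0// normc_sqr real_normK ?num_real//.
by rewrite lerDl sqr_ge0.
Qed.

Lemma normc_Im x : `|im x| <= normc x.
Proof.
rewrite -(@ler_pXn2r _ 2) ?nnegrE ?normc_ge0// normc_sqr real_normK ?num_real//.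
by rewrite lerDr sqr_ge0.
Qed.

Lemma normc_le1 x : normc x <= `|re x| + `|im x|.
Proof.
rewrite -(@ler_pXn2r _ 2) ?nnegrE ?normc_ge0 ?addr_ge0// normc_sqr.
rewrite sqrrD !real_normK ?num_real// lerD2r lerDl.
by rewrite mulrn_wge0// mulr_ge0.
Qed.

Lemma cRB (s t : R) : ((s - t)%:C : C) = s%:C - t%:C.
Proof. by apply/eqP; rewrite eq_complex /= subrr !eqxx. Qed.

Lemma normE x : `|x| = (normc x)%:C.
Proof. by case: x. Qed.

Lemma posC_real (e : C) : 0 < e -> exists2 t, 0 < t & e = t%:C.
Proof.
by case: e => a b; rewrite ltcE /= => /andP[/eqP -> a0]; exists a.
Qed.

End modulus.

Section derivative.
Variable R : realType.
Local Notation C := R[i].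
Implicit Types (f g : C -> C) (z w d e : C).

(** The moduli are elements of [R], so that the error terms of compositions,
    quotients and parametrized integrals can be estimated by real arithmetic. *)
Definition cdiff f z d := forall eps : R, 0 < eps ->
  exists2 del : R, 0 < del & forall w, normc (w - z) < del ->
    normc (f w - f z - d * (w - z)) <= eps * normc (w - z).

Lemma cdiffP f z d :
  cdiff f z d <-> is_derive (z : C^o) (1 : C^o) (f : C^o -> C^o) d.
Proof.
split=> [fd|[fd dE]].
- suff H : h^-1 *: (((f : C^o -> C^o) \o shift (z : C^o)) (h *: (1 : C^o)) - f z)
      @[h --> (0 : C^o)^'] --> (d : C^o).
    split; first by apply/cvg_ex; exists d.
    by apply/cvg_lim => //; exact: norm_hausdorff.
  apply/cvgrPdist_le => /= eps /posC_real[t t0 ->{eps}].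
  have [del del0 H] := fd _ t0.
  exists del%:C => /=; first by rewrite ltcR.
  move=> h /=; rewrite sub0r normrN normE ltcR => hdel h0.
  rewrite normE lecR.
  have -> : h%:A = h :> C by rewrite /GRing.scale /= mulr1.
  have h0' : 0 < normc h by rewrite normc_gt0.
  have := H (h + z); rewrite addrK => /(_ hdel).
  rewrite -ler_pdivrMr//; apply: le_trans.
  rewrite -normc_div normcB le_eqVlt; apply/orP; left; apply/eqP; congr normc.
  by rewrite /GRing.scale /=; field.
- move=> eps eps0.
  move: (fd); rewrite /derivable => /cvgrPdist_le /(_ eps%:C).
  rewrite ltcR => /(_ eps0) -[del /= /posC_real[t t0 ->{del}] H].
  exists t => // w wt.
  have [->|wz] := eqVneq w z; first by rewrite !subrr mulr0 subrr normc0 mulr0.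
  have wz0 : w - z != 0 by rewrite subr_eq0.
  have := H (w - z) => /=.
  rewrite sub0r normrN normE ltcR => /(_ wt wz0).
  have -> : (w - z)%:A = w - z :> C by rewrite /GRing.scale /= mulr1.
  rewrite subrK -/(derive (f : C^o -> C^o) z 1) dE.
  rewrite normE lecR => {}H.
  rewrite -ler_pdivrMr ?normc_gt0//; apply: le_trans H.
  rewrite -normc_div normcB le_eqVlt; apply/orP; left; apply/eqP; congr normc.
  by rewrite /GRing.scale /=; field.
Qed.

Lemma cdiff_cst (c : C) z : cdiff (fun=> c) z 0.
Proof.
by move=> e e0; exists 1 => // w _; rewrite subrr mul0r subrr normc0 mulr_ge0 ?normc_ge0// ltW.
Qed.

Lemma cdiff_id z : cdiff id z 1.
Proof.
by move=> e e0; exists 1 => // w _; rewrite mul1r subrr normc0 mulr_ge0 ?normc_ge0// ltW.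
Qed.

Lemma cdiff_eq f z d d' : cdiff f z d -> d = d' -> cdiff f z d'.
Proof. by move=> h <-. Qed.

Lemma cdiffD f g z d e : cdiff f z d -> cdiff g z e ->
  cdiff (fun w => f w + g w) z (d + e).
Proof. by move=> /cdiffP hf /cdiffP hg; apply/cdiffP; exact: is_deriveD. Qed.

Lemma cdiffN f z d : cdiff f z d -> cdiff (fun w => - f w) z (- d).
Proof. by move=> /cdiffP hf; apply/cdiffP; exact: is_deriveN. Qed.

Lemma cdiffB f g z d e : cdiff f z d -> cdiff g z e ->
  cdiff (fun w => f w - g w) z (d - e).
Proof. by move=> hf hg; apply: cdiffD => //; exact: cdiffN. Qed.

Lemma cdiffM f g z d e : cdiff f z d -> cdiff g z e ->
  cdiff (fun w => f w * g w) z (f z * e + d * g z).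
Proof.
move=> /cdiffP hf /cdiffP hg; apply/cdiffP.
by have := is_deriveM (R := C) hf hg; rewrite /GRing.scale /= [g z * d]mulrC.
Qed.

Lemma cdiffZ f z d (c : C) : cdiff f z d -> cdiff (fun w => c * f w) z (c * d).
Proof.
by move=> hf; apply: (cdiff_eq (cdiffM (cdiff_cst c z) hf)); rewrite mul0r addr0.
Qed.

Lemma cdiffV f z d : f z != 0 -> cdiff f z d ->
  cdiff (fun w => (f w)^-1) z (- d / f z ^+ 2).
Proof.
move=> fz0 /cdiffP hf; apply/cdiffP.
have h1 := @derivableV _ _ _ _ _ fz0 (@ex_derive _ _ _ _ _ _ _ hf).
split => //.
rewrite (@deriveV _ _ _ _ _ fz0 (@ex_derive _ _ _ _ _ _ _ hf)).
rewrite (@derive_val _ _ _ _ _ _ _ hf) /GRing.scale /= mulNr mulNr; congr (- _).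
by rewrite mulrC.
Qed.

Lemma cdiff_lip f z d : cdiff f z d -> exists2 del : R, 0 < del &
  forall w, normc (w - z) < del ->
    normc (f w - f z) <= (normc d + 1) * normc (w - z).
Proof.
move=> /(_ 1 ltr01)[del d0 H]; exists del => // w /H; rewrite mul1r => h.
have -> : f w - f z = (f w - f z - d * (w - z)) + d * (w - z) by ring.
by rewrite (le_trans (normc_triangle _ _))// normcME mulrDl mul1r addrC lerD2l.
Qed.

Lemma cdiff_cont f z d : cdiff f z d -> forall eps : R, 0 < eps ->
  exists2 del : R, 0 < del & forall w, normc (w - z) < del ->
    normc (f w - f z) < eps.
Proof.
move=> /cdiff_lip[del d0 H] eps e0.
have K0 : 0 < normc d + 1 by rewrite ltr_wpDl ?normc_ge0.
exists (Num.min del (eps / (normc d + 1))).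
  by rewrite lt_min d0 divr_gt0.
move=> w; rewrite lt_min => /andP[/H h1 h2]; apply: le_lt_trans h1 _.
by rewrite mulrC -ltr_pdivlMr.
Qed.

Lemma cdiff_comp f g z d e : cdiff g z e -> cdiff f (g z) d ->
  cdiff (fun w => f (g w)) z (d * e).
Proof.
move=> hg hf eps eps0.
have [dl dl0 Hl] := cdiff_lip hg.
have K0 : 0 < normc e + 1 by rewrite ltr_wpDl ?normc_ge0.
have L0 : 0 < normc d + 1 by rewrite ltr_wpDl ?normc_ge0.
have [d1 d10 H1] := hf (eps / 2 / (normc e + 1)) ltac:(by rewrite !divr_gt0).
have [d2 d20 H2] := hg (eps / 2 / (normc d + 1)) ltac:(by rewrite !divr_gt0).
have [d3 d30 H3] := cdiff_cont hg d10.
exists (Num.min dl (Num.min d2 d3)); first by rewrite !lt_min dl0 d20.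
move=> w; rewrite !lt_min => /and3P[/Hl hl /H2 h2 /H3/H1 h1].
have -> : f (g w) - f (g z) - d * e * (w - z) =
  (f (g w) - f (g z) - d * (g w - g z)) + d * (g w - g z - e * (w - z)) by ring.
rewrite (le_trans (normc_triangle _ _))// (splitr eps) mulrDl lerD//.
  rewrite (le_trans h1)//.
  rewrite -mulrA ler_pM2l ?divr_gt0// mulrC ler_pdivrMr//.
  by rewrite mulrC.
rewrite normcME (le_trans (ler_wpM2l (normc_ge0 _) h2))//.
rewrite mulrA ler_wpM2r ?normc_ge0// mulrA ler_pdivrMr// mulrC.
by rewrite ler_wpM2l ?lerDl// ltW// divr_gt0.
Qed.

Lemma cdiff_local f g z d (r : R) : 0 < r ->
  (forall w, normc (w - z) < r -> f w = g w) -> cdiff f z d -> cdiff g z d.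
Proof.
move=> r0 fg hf eps e0; have [del d0 H] := hf _ e0.
exists (Num.min del r); first by rewrite lt_min d0.
move=> w; rewrite lt_min => /andP[w1 w2]; rewrite -!fg//; first exact: H.
by rewrite subrr normc0.
Qed.

Lemma cdiff_derive1 f z d : cdiff f z d -> cderiv 1 f z = d.
Proof.
move=> /cdiffP hf; rewrite /cderiv derive1n1 derive1E.
exact: (@derive_val _ _ _ _ _ _ _ hf).
Qed.

Lemma derivable_cdiff f z : derivable (f : C^o -> C^o) z 1 ->
  cdiff f z (cderiv 1 f z).
Proof.
by move=> hf; apply/cdiffP; split; [exact: hf|exact/esym/derive1E].
Qed.

Lemma cdiff_derivable f z d : cdiff f z d -> derivable (f : C^o -> C^o) z 1.
Proof. by move=> /cdiffP[]. Qed.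

Lemma cderivS n f : cderiv n.+1 f = cderiv 1 (cderiv n f).
Proof. by []. Qed.

End derivative.

(** * Integrals along intervals *)

Section integral.
Variable R : realType.
Local Notation C := R[i].
Implicit Types (a b c t x y : R) (k l : R -> R) (z w : C).

Definition rint a b k : R :=
  (\int[@lebesgue_measure R]_(t in `[a, b]) k t)%R.

Definition rcont a b k := {within `[a, b], continuous k}.

Lemma rcont_itg a b k : rcont a b k ->
  (@lebesgue_measure R).-integrable `[a, b] (EFin \o k).
Proof.
by move=> h; apply: continuous_compact_integrable => //; exact: segment_compact.
Qed.

Lemma rcont_sub a b c d k : a <= c -> d <= b -> rcont a b k -> rcont c d k.
Proof.
move=> ac db; apply: continuous_subspaceW => t /=; rewrite !in_itv /= => /andP[h1 h2].
by rewrite (le_trans ac h1) (le_trans h2 db).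
Qed.

Lemma rcontD a b k l : rcont a b k -> rcont a b l -> rcont a b (fun t => k t + l t).
Proof. by move=> hk hl x; apply: cvgD; [exact: hk|exact: hl]. Qed.

Lemma rcontM a b k l : rcont a b k -> rcont a b l -> rcont a b (fun t => k t * l t).
Proof. by move=> hk hl x; apply: cvgM; [exact: hk|exact: hl]. Qed.

Lemma rcontN a b k : rcont a b k -> rcont a b (fun t => - k t).
Proof. by move=> hk x; apply: cvgN; exact: hk. Qed.

Lemma rcont_cst a b c : rcont a b (fun=> c).
Proof. by move=> x; exact: cvg_cst. Qed.

Lemma rcont_norm a b k : rcont a b k -> rcont a b (fun t => `|k t|).
Proof. by move=> hk x; apply: cvg_norm; exact: hk. Qed.

Lemma eq_rcont a b k l : (forall t, a <= t <= b -> k t = l t) ->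
  rcont a b k -> rcont a b l.
Proof.
move=> kl; apply: subspace_eq_continuous => t /[!inE] /=.
by rewrite in_itv /=; exact: kl.
Qed.

Lemma eq_rint a b k l : (forall t, a <= t <= b -> k t = l t) ->
  rint a b k = rint a b l.
Proof.
move=> kl; apply: eq_Rintegral => t; rewrite inE /= in_itv /=; exact: kl.
Qed.

Lemma rintD a b k l : rcont a b k -> rcont a b l ->
  rint a b (fun t => k t + l t) = rint a b k + rint a b l.
Proof. by move=> hk hl; apply: RintegralD => //; exact: rcont_itg. Qed.

Lemma rintB a b k l : rcont a b k -> rcont a b l ->
  rint a b (fun t => k t - l t) = rint a b k - rint a b l.
Proof. by move=> hk hl; apply: RintegralB => //; exact: rcont_itg. Qed.

Lemma rintZ a b k c : rcont a b k -> rint a b (fun t => c * k t) = c * rint a b k.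
Proof. by move=> hk; apply: RintegralZl => //; exact: rcont_itg. Qed.

Lemma rint_cst a b c : a <= b -> rint a b (fun=> c) = c * (b - a).
Proof.
move=> ab; rewrite /rint Rintegral_cst//= lebesgue_measure_itv /= lte_fin.
have [|h] := ltP a b; first by rewrite -EFinB.
by rewrite (le_anti (introT andP (conj ab h))) subrr.
Qed.

Lemma le_rint a b k l : rcont a b k -> rcont a b l ->
  (forall t, a <= t <= b -> k t <= l t) -> rint a b k <= rint a b l.
Proof.
by move=> hk hl kl; apply: le_Rintegral => //; exact: rcont_itg.
Qed.

Lemma norm_rint a b k : rcont a b k -> `|rint a b k| <= rint a b (fun t => `|k t|).
Proof. by move=> hk; apply: le_normr_Rintegral => //; exact: rcont_itg. Qed.

Lemma rint_split a b c k : a <= b -> b <= c -> rcont a c k ->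
  rint a c k = rint a b k + rint b c k.
Proof.
move=> ab bc hk.
have := @Rintegral_itvB R k (BLeft a) (BRight c) b (rcont_itg hk).
rewrite !bnd_simp => /(_ ab bc) /(canRL (subrK _)).
rewrite Rintegral_itv_obnd_cbnd /rint; first by rewrite addrC.
apply: (@integrableS _ _ R (@lebesgue_measure R) `[a, c] `]b, c]) => //; last exact: rcont_itg.
by move=> t /=; rewrite !in_itv /= => /andP[h1 ->]; rewrite (le_trans ab (ltW h1)).
Qed.

Definition ccont a b (k : R -> C) :=
  rcont a b (fun t => re (k t)) /\ rcont a b (fun t => im (k t)).

Definition cint a b (k : R -> C) : C :=
  rint a b (fun t => re (k t)) +i* rint a b (fun t => im (k t)).

Implicit Types g h : R -> C.

Lemma ccontM a b g h : ccont a b g -> ccont a b h -> ccont a b (fun t => g t * h t).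
Proof.
move=> [g1 g2] [h1 h2]; split.
  apply: eq_rcont (rcontD (rcontM g1 h1) (rcontN (rcontM g2 h2))) => t _.
  by case: (g t) => ? ?; case: (h t).
apply: eq_rcont (rcontD (rcontM g1 h2) (rcontM g2 h1)) => t _.
by case: (g t) => ? ?; case: (h t).
Qed.

Lemma ccont_cst a b w : ccont a b (fun=> w).
Proof. by split; exact: rcont_cst. Qed.

Lemma ccontZ a b g w : ccont a b g -> ccont a b (fun t => w * g t).
Proof. exact/ccontM/ccont_cst. Qed.

Lemma eq_cint a b g h : (forall t, a <= t <= b -> g t = h t) -> cint a b g = cint a b h.
Proof. by move=> gh; congr (_ +i* _); apply: eq_rint => t /gh ->. Qed.

Lemma cintD a b g h : ccont a b g -> ccont a b h ->
  cint a b (fun t => g t + h t) = cint a b g + cint a b h.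
Proof.
move=> [g1 g2] [h1 h2]; rewrite /cint; apply/eqP; rewrite eq_complex /=; apply/andP; split.
  rewrite -rintD//; apply/eqP/eq_rint => t _; by case: (g t) => ? ?; case: (h t).
rewrite -rintD//; apply/eqP/eq_rint => t _; by case: (g t) => ? ?; case: (h t).
Qed.

Lemma cintZ a b g w : ccont a b g -> cint a b (fun t => w * g t) = w * cint a b g.
Proof.
move=> [g1 g2]; case: w => u v; rewrite /cint; apply/eqP; rewrite eq_complex /=.
have hZ (c : R) (l : R -> R) : rcont a b l -> rcont a b (fun t => c * l t).
  by move=> hl; apply: rcontM => //; exact: rcont_cst.
apply/andP; split.
  rewrite -!rintZ// -rintB; [|exact: hZ|exact: hZ].
  by apply/eqP/eq_rint => t _; case: (g t).
rewrite -!rintZ// -rintD; [|exact: hZ|exact: hZ].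
by apply/eqP/eq_rint => t _; case: (g t).
Qed.

Lemma cint_cst a b w : a <= b -> cint a b (fun=> w) = w * (b - a)%:C.
Proof.
move=> ab; rewrite /cint !rint_cst//; case: w => u v /=.
by apply/eqP; rewrite eq_complex /= !mulr0 subr0 add0r !eqxx.
Qed.

Lemma cint_split a b c g : a <= b -> b <= c -> ccont a c g ->
  cint a c g = cint a b g + cint b c g.
Proof.
move=> ab bc [g1 g2]; rewrite /cint (rint_split ab bc g1) (rint_split ab bc g2).
by [].
Qed.

Lemma rcont_normc a b g : ccont a b g -> rcont a b (fun t => normc (g t)).
Proof.
move=> [g1 g2].
suff H : rcont a b (fun t => Num.sqrt (re (g t) ^+ 2 + im (g t) ^+ 2)).
  by apply: eq_rcont H => t _; case: (g t).
have H1 := rcontD (rcontM g1 g1) (rcontM g2 g2).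
move=> t; pose s := re (g t) * re (g t) + im (g t) * im (g t).
have H2 : Num.sqrt u @[u --> s] --> Num.sqrt s := @sqrt_continuous R s.
exact: (cvg_comp _ _ (H1 t) H2).
Qed.

(** The factor 2 comes from treating real and imaginary part separately; no
    sharp constants are needed anywhere. *)
Lemma normc_cint a b g : ccont a b g ->
  normc (cint a b g) <= 2 * rint a b (fun t => normc (g t)).
Proof.
move=> gc; have [g1 g2] := gc; have g3 := rcont_normc gc.
rewrite mulr2n mulrDl mul1r (le_trans (normc_le1 _))//= lerD//.
  apply: (le_trans (norm_rint g1)); apply: le_rint => //; first exact: rcont_norm.
  by move=> t _; exact: normc_Re.
apply: (le_trans (norm_rint g2)); apply: le_rint => //; first exact: rcont_norm.
by move=> t _; exact: normc_Im.
Qed.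

Lemma normc_cint_le a b g (M : R) : a <= b -> ccont a b g ->
  (forall t, a <= t <= b -> normc (g t) <= M) ->
  normc (cint a b g) <= 2 * (M * (b - a)).
Proof.
move=> ab gc gM; rewrite (le_trans (normc_cint gc))// ler_pM2l//.
rewrite -rint_cst//; apply: le_rint => //; [exact: rcont_normc|exact: rcont_cst].
Qed.

End integral.

(** * Goursat's theorem on rectangles *)

Section bisection.
Variable R : realType.
Implicit Types (a b c d p q : R).

Lemma nested_point (a b : nat -> R) :
  (forall n, a n <= a n.+1) -> (forall n, b n.+1 <= b n) ->
  (forall n, a n <= b n) -> exists p, forall n, a n <= p <= b n.
Proof.
move=> ai bd ab.
have ai' : {homo a : n m / (n <= m)%N >-> n <= m} by apply: homo_leq => //; exact: le_trans.
have bd' : {homo b : n m / (n <= m)%N >-> m <= n}.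
  by apply: (@homo_leq _ b (fun x y => y <= x)) => // x y z h1 h2; exact: le_trans h2 h1.
have abnm n m : a n <= b m.
  rewrite (le_trans (ai' _ _ (leq_maxl n m)))// (le_trans (ab _))//.
  exact/bd'/leq_maxr.
exists (sup (range a)) => n; apply/andP; split.
  by apply: ub_le_sup; [exists (b 0%N) => _ [m _ <-]|exists n].
by apply: ge_sup; [exists (a 0%N); exists 0%N|move=> _ [m _ <-]].
Qed.

(** Quartering a counterexample again and again would produce a nested sequence
    of counterexamples that shrinks to a point [(p, q)]. *)
Lemma rect_bisection (P : R -> R -> R -> R -> Prop) x1 x2 y1 y2 :
  x1 <= x2 -> y1 <= y2 ->
  (forall a b c d, x1 <= a -> a <= b -> b <= x2 -> y1 <= c -> c <= d -> d <= y2 ->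
     P a ((a + b) / 2) c ((c + d) / 2) -> P ((a + b) / 2) b c ((c + d) / 2) ->
     P a ((a + b) / 2) ((c + d) / 2) d -> P ((a + b) / 2) b ((c + d) / 2) d ->
     P a b c d) ->
  (forall p q, x1 <= p <= x2 -> y1 <= q <= y2 -> exists2 del, 0 < del &
     forall a b c d t, x1 <= a -> b <= x2 -> y1 <= c -> d <= y2 ->
       a <= p <= b -> c <= q <= d -> 0 < t < del ->
       b - a = (x2 - x1) * t -> d - c = (y2 - y1) * t -> P a b c d) ->
  P x1 x2 y1 y2.
Proof.
move=> x12 y12 Pq Pl; apply: contrapT => nP.
pose st := (R * R * (R * R))%type.
pose PP (s : st) := P s.1.1 s.1.2 s.2.1 s.2.2.
pose mx (s : st) := (s.1.1 + s.1.2) / 2.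
pose my (s : st) := (s.2.1 + s.2.2) / 2.
pose q1 (s : st) : st := ((s.1.1, mx s), (s.2.1, my s)).
pose q2 (s : st) : st := ((mx s, s.1.2), (s.2.1, my s)).
pose q3 (s : st) : st := ((s.1.1, mx s), (my s, s.2.2)).
pose q4 (s : st) : st := ((mx s, s.1.2), (my s, s.2.2)).
pose nx s := if `[< PP (q1 s) >] then if `[< PP (q2 s) >] then
  if `[< PP (q3 s) >] then q4 s else q3 s else q2 s else q1 s.
pose s n := iter n nx ((x1, x2), (y1, y2)).
have half_l (a b : R) : a <= b -> a <= (a + b) / 2 by move=> ?; lra.
have half_r (a b : R) : a <= b -> (a + b) / 2 <= b by move=> ?; lra.
have nxP (r : st) : r.1.1 <= r.1.2 -> r.2.1 <= r.2.2 ->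
  [/\ r.1.1 <= (nx r).1.1, (nx r).1.1 <= (nx r).1.2, (nx r).1.2 <= r.1.2 &
    (nx r).1.2 - (nx r).1.1 = (r.1.2 - r.1.1) / 2] /\
  [/\ r.2.1 <= (nx r).2.1, (nx r).2.1 <= (nx r).2.2, (nx r).2.2 <= r.2.2 &
    (nx r).2.2 - (nx r).2.1 = (r.2.2 - r.2.1) / 2].
  case: r => [[a b] [c d]] /= ab cd; rewrite /nx /q1 /q2 /q3 /q4 /mx /my /=.
  by case: ifP => _; [case: ifP => _; [case: ifP => _|]|] => /=;
    do 2 (split; try by [exact: half_l|exact: half_r|lra]).
have inv n : [/\ x1 <= (s n).1.1, (s n).1.1 <= (s n).1.2, (s n).1.2 <= x2 &
    (s n).1.2 - (s n).1.1 = (x2 - x1) * 2^-1 ^+ n] /\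
  [/\ y1 <= (s n).2.1, (s n).2.1 <= (s n).2.2, (s n).2.2 <= y2 &
    (s n).2.2 - (s n).2.1 = (y2 - y1) * 2^-1 ^+ n].
  elim: n => [|n [[h1 h2 h3 h4] [k1 k2 k3 k4]]].
    by rewrite expr0 !mulr1.
  have [[u1 u2 u3 u4] [v1 v2 v3 v4]] := nxP (s n) h2 k2.
  rewrite /s iterS -/(s n) u4 v4 h4 k4 exprS; split; split => //.
  - exact: le_trans u1.
  - exact: le_trans h3.
  - by ring.
  - exact: le_trans v1.
  - exact: le_trans k3.
  - by ring.
have nPs n : ~ PP (s n).
  elim: n => [//|n IH]; rewrite /s iterS -/(s n) /nx.
  have [[h1 h2 h3 h4] [k1 k2 k3 k4]] := inv n.
  case: ifP => [/asboolP p1|/asboolP//]; case: ifP => [/asboolP p2|/asboolP//].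
  case: ifP => [/asboolP p3|/asboolP//] p4; apply: IH.
  exact: Pq.
have [p hp] : exists p, forall n, (s n).1.1 <= p <= (s n).1.2.
  apply: nested_point => n.
  - by have [[h1 h2 h3 h4] [k1 k2 k3 k4]] := inv n; have [[]] := nxP (s n) h2 k2.
  - by have [[h1 h2 h3 h4] [k1 k2 k3 k4]] := inv n; have [[]] := nxP (s n) h2 k2.
  - by have [[]] := inv n.
have [q hq] : exists q, forall n, (s n).2.1 <= q <= (s n).2.2.
  apply: nested_point => n.
  - by have [[h1 h2 h3 h4] [k1 k2 k3 k4]] := inv n; have [_ []] := nxP (s n) h2 k2.
  - by have [[h1 h2 h3 h4] [k1 k2 k3 k4]] := inv n; have [_ []] := nxP (s n) h2 k2.
  - by have [_ []] := inv n.
have [del d0 H] := Pl p q (hp 0%N) (hq 0%N).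
have [n hn] : exists n, (2^-1 : R) ^+ n < del.
  have : (fun n => (2^-1 : R) ^+ n) @ \oo --> (0 : R).
    by apply: cvg_expr; rewrite ger0_norm ?invr_ge0// invf_lt1// ltr1n.
  move=> /cvgrPdist_lt /(_ del d0) [N _ /(_ N (leqnn _))] /=.
  by rewrite sub0r normrN ger0_norm ?exprn_ge0 ?invr_ge0// => ?; exists N.
have [[h1 h2 h3 h4] [k1 k2 k3 k4]] := inv n.
apply: (nPs n); apply: (H _ _ _ _ (2^-1 ^+ n)) => //.
by rewrite hn andbT exprn_gt0// invr_gt0.
Qed.

End bisection.

Section goursat.
Variable R : realType.
Local Notation C := R[i].
Implicit Types (f g : C -> C) (z w e : C) (a b c d x y t : R).

Definition hol f z := exists e, cdiff f z e.

Definition contC f z := forall eps : R, 0 < eps ->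
  exists2 del : R, 0 < del & forall w, normc (w - z) < del -> normc (f w - f z) < eps.

Lemma hol_contC f z : hol f z -> contC f z.
Proof. by move=> [d] /cdiff_cont. Qed.

Lemma ccont_path a b (ga : R -> C) (L : R) f : 0 < L ->
  (forall s t, normc (ga s - ga t) <= L * `|s - t|) ->
  (forall t, a <= t <= b -> contC f (ga t)) -> ccont a b (f \o ga).
Proof.
move=> L0 gaL fc.
have H t : a <= t <= b -> forall eps : R, 0 < eps -> \forall s \near t,
    normc (f (ga s) - f (ga t)) < eps.
  move=> /fc hc eps /hc[del d0 H]; exists (del / L) => /=; first by rewrite divr_gt0.
  move=> s /=; rewrite ltr_pdivlMr// distrC mulrC => hs.
  by apply: H; apply: le_lt_trans hs; exact: gaL.
split; apply: continuous_in_subspaceT => t /[!inE] /= /[!in_itv] /= /H {}H;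
  apply/cvgrPdist_lt => eps /H; apply: filterS => s; apply: le_lt_trans;
  rewrite distrC /=.
- by have := normc_Re (f (ga s) - f (ga t)); case: (f (ga s)) (f (ga t)) => ? ? [].
- by have := normc_Im (f (ga s) - f (ga t)); case: (f (ga s)) (f (ga t)) => ? ? [].
Qed.

Lemma normc_hor x x' y : normc ((x +i* y) - (x' +i* y)) = `|x - x'|.
Proof. by rewrite /= subrr expr0n /= addr0 sqrtr_sqr. Qed.

Lemma normc_ver x y y' : normc ((x +i* y) - (x +i* y')) = `|y - y'|.
Proof. by rewrite /= subrr expr0n /= add0r sqrtr_sqr. Qed.

Lemma ccont_hor f a b y : (forall x, a <= x <= b -> contC f (x +i* y)) ->
  ccont a b (fun x => f (x +i* y)).
Proof.
move=> h; apply: (@ccont_path a b (fun x => x +i* y) 1) => // s t.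
by rewrite normc_hor mul1r.
Qed.

Lemma ccont_ver f a b x : (forall y, a <= y <= b -> contC f (x +i* y)) ->
  ccont a b (fun y => f (x +i* y)).
Proof.
move=> h; apply: (@ccont_path a b (fun y => x +i* y) 1) => // s t.
by rewrite normc_ver mul1r.
Qed.

Variant rect_bd a b c d : C -> Prop :=
| RectB x of a <= x <= b : rect_bd a b c d (x +i* c)
| RectT x of a <= x <= b : rect_bd a b c d (x +i* d)
| RectL y of c <= y <= d : rect_bd a b c d (a +i* y)
| RectR y of c <= y <= d : rect_bd a b c d (b +i* y).

(** The contour integral over the boundary of a rectangle, counterclockwise. *)
Definition oint f a b c d : C :=
  cint a b (fun x => f (x +i* c)) - cint a b (fun x => f (x +i* d))
  + 'i * (cint c d (fun y => f (b +i* y)) - cint c d (fun y => f (a +i* y))).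

Lemma oint_ext f g a b c d : (forall z, rect_bd a b c d z -> f z = g z) ->
  oint f a b c d = oint g a b c d.
Proof.
move=> fg; rewrite /oint; congr (_ - _ + _ * (_ - _)); apply: eq_cint => t ht;
  apply: fg; by constructor.
Qed.

Definition contB f a b c d := forall z, rect_bd a b c d z -> contC f z.

Lemma contB_edges f a b c d : contB f a b c d ->
  [/\ ccont a b (fun x => f (x +i* c)), ccont a b (fun x => f (x +i* d)),
      ccont c d (fun y => f (b +i* y)) & ccont c d (fun y => f (a +i* y))].
Proof.
by move=> h; split; [apply: ccont_hor|apply: ccont_hor|apply: ccont_ver|
  apply: ccont_ver] => t ht; apply: h; constructor.
Qed.

Lemma ointD f g a b c d : contB f a b c d -> contB g a b c d ->
  oint (fun z => f z + g z) a b c d = oint f a b c d + oint g a b c d.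
Proof.
move=> /contB_edges[f1 f2 f3 f4] /contB_edges[g1 g2 g3 g4].
by rewrite /oint !cintD//; ring.
Qed.

Lemma ointZ f a b c d w : contB f a b c d ->
  oint (fun z => w * f z) a b c d = w * oint f a b c d.
Proof. by move=> /contB_edges[f1 f2 f3 f4]; rewrite /oint !cintZ//; ring. Qed.

Lemma oint_bound f a b c d (M : R) : a <= b -> c <= d -> contB f a b c d ->
  (forall z, rect_bd a b c d z -> normc (f z) <= M) ->
  normc (oint f a b c d) <= 4 * M * ((b - a) + (d - c)).
Proof.
move=> ab cd /contB_edges[f1 f2 f3 f4] fM.
have e1 : normc (cint a b (fun x => f (x +i* c))) <= 2 * (M * (b - a)).
  by apply: normc_cint_le => // t ht; apply: fM; constructor.
have e2 : normc (cint a b (fun x => f (x +i* d))) <= 2 * (M * (b - a)).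
  by apply: normc_cint_le => // t ht; apply: fM; constructor.
have e3 : normc (cint c d (fun x => f (b +i* x))) <= 2 * (M * (d - c)).
  by apply: normc_cint_le => // t ht; apply: fM; constructor.
have e4 : normc (cint c d (fun x => f (a +i* x))) <= 2 * (M * (d - c)).
  by apply: normc_cint_le => // t ht; apply: fM; constructor.
apply: (le_trans (normc_triangle _ _)); rewrite normcME normci mul1r.
apply: (le_trans (lerD (normc_triangleB _ _) (normc_triangleB _ _))).
lra.
Qed.

Lemma contC_cst w z : contC (fun=> w) z.
Proof. by apply: hol_contC; exists 0; exact: cdiff_cst. Qed.

Lemma contC_id z : contC id z.
Proof. by apply: hol_contC; exists 1; exact: cdiff_id. Qed.

Lemma oint_cst w a b c d : a <= b -> c <= d -> oint (fun=> w) a b c d = 0.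
Proof. by move=> ab cd; rewrite /oint !cint_cst// !subrr mulr0 addr0. Qed.

Lemma oint_id a b c d : a <= b -> c <= d -> oint id a b c d = 0.
Proof.
move=> ab cd; rewrite /oint.
have idc s t : ccont s t (fun x : R => x +i* (0 : R)).
  by apply: (@ccont_hor id) => x _; exact: contC_id.
have e (y : R) : cint a b (fun x => id (x +i* y)) =
    cint a b (fun x => x +i* (0 : R)) + ('i * y%:C) * (b - a)%:C.
  rewrite -cint_cst// -cintD//; last exact: ccont_cst.
  by apply: eq_cint => t _; apply/eqP; rewrite eq_complex /=; apply/andP; split; apply/eqP; ring.
have e' (x : R) : cint c d (fun y => id (x +i* y)) =
    'i * cint c d (fun y => y +i* (0 : R)) + x%:C * (d - c)%:C.
  rewrite -cint_cst// -cintZ// -cintD//; [|exact: ccontZ|exact: ccont_cst].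
  by apply: eq_cint => t _; apply/eqP; rewrite eq_complex /=; apply/andP; split; apply/eqP; ring.
rewrite (e c) (e d) (e' a) (e' b).
move: (cint a b _) (cint c d _) => X Y.
rewrite !cRB; ring.
Qed.

Definition holR f a b c d := forall x y, a <= x <= b -> c <= y <= d -> hol f (x +i* y).

Lemma holR_sub f a b c d a' b' c' d' : a <= a' -> b' <= b -> c <= c' -> d' <= d ->
  holR f a b c d -> holR f a' b' c' d'.
Proof.
move=> h1 h2 h3 h4 h x y /andP[u1 u2] /andP[v1 v2]; apply: h.
  by rewrite (le_trans h1) ?(le_trans u2).
by rewrite (le_trans h3) ?(le_trans v2).
Qed.

Lemma holR_contB f a b c d : a <= b -> c <= d -> holR f a b c d -> contB f a b c d.
Proof.
by move=> ab cd h z [] t ht; apply/hol_contC/h; rewrite ?lexx ?ab ?cd//.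
Qed.

Lemma oint_split_x f a m b c d : a <= m -> m <= b ->
  contB f a b c d ->
  oint f a b c d = oint f a m c d + oint f m b c d.
Proof.
move=> am mb /contB_edges[f1 f2 f3 f4]; rewrite /oint.
by rewrite (cint_split am mb f1) (cint_split am mb f2); ring.
Qed.

Lemma oint_split_y f a b c m d : c <= m -> m <= d ->
  contB f a b c d ->
  oint f a b c d = oint f a b c m + oint f a b m d.
Proof.
move=> cm md /contB_edges[f1 f2 f3 f4]; rewrite /oint.
by rewrite (cint_split cm md f3) (cint_split cm md f4); ring.
Qed.

(** Goursat: near a point the integrand is affine up to a relatively small
    error, and affine functions integrate to zero. *)
Lemma goursat f x1 x2 y1 y2 : x1 <= x2 -> y1 <= y2 -> holR f x1 x2 y1 y2 ->
  oint f x1 x2 y1 y2 = 0.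
Proof.
move=> x12 y12 hf.
suff H (eps : R) : 0 < eps ->
    normc (oint f x1 x2 y1 y2) <= eps * ((x2 - x1) + (y2 - y1)) ^+ 2.
  apply: eq0_normc; apply/eqP; rewrite eq_le normc_ge0 andbT.
  apply/ler_addgt0Pr => e e0; rewrite add0r; pose D := ((x2 - x1) + (y2 - y1)) ^+ 2.
  have D0 : 0 <= D by exact: sqr_ge0.
  apply: le_trans (H (e / (D + 1)) _) _; first by rewrite divr_gt0// ltr_wpDl.
  rewrite -/D -mulrA ger_pMr// mulrC ler_pdivrMr ?mul1r ?ltr_wpDl//.
  by rewrite lerDl.
move=> eps0.
pose P a b c d := normc (oint f a b c d) <= eps * ((b - a) + (d - c)) ^+ 2.
apply: (@rect_bisection R (fun a b c d => (exists t, (b - a) = (x2 - x1) * t /\ d - c = (y2 - y1) * t) -> P a b c d)) => //.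
- move=> a b c d xa ab bx yc cd dy p1 p2 p3 p4 [t [t1 t2]].
  have am : a <= (a + b) / 2 by lra.
  have mb : (a + b) / 2 <= b by lra.
  have cn : c <= (c + d) / 2 by lra.
  have nd : (c + d) / 2 <= d by lra.
  have hfs : holR f a b c d by exact: holR_sub hf.
  have w1 : (a + b) / 2 - a = (x2 - x1) * (t / 2) by rewrite mulrA -t1; lra.
  have w2 : b - (a + b) / 2 = (x2 - x1) * (t / 2) by rewrite mulrA -t1; lra.
  have w3 : (c + d) / 2 - c = (y2 - y1) * (t / 2) by rewrite mulrA -t2; lra.
  have w4 : d - (c + d) / 2 = (y2 - y1) * (t / 2) by rewrite mulrA -t2; lra.
  have {}p1 := p1 (ex_intro _ _ (conj w1 w3)).
  have {}p2 := p2 (ex_intro _ _ (conj w2 w3)).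
  have {}p3 := p3 (ex_intro _ _ (conj w1 w4)).
  have {}p4 := p4 (ex_intro _ _ (conj w2 w4)).
  rewrite /P (oint_split_x am mb); last exact: holR_contB.
  rewrite (oint_split_y cn nd); last by apply: holR_contB => //; apply: holR_sub hfs.
  rewrite [X in _ + X](oint_split_y cn nd); last by apply: holR_contB => //; apply: holR_sub hfs.
  have E s : s = (b - a) / 2 + (d - c) / 2 -> eps * s ^+ 2 = eps * ((b - a) + (d - c)) ^+ 2 / 4.
    by move=> ->; field.
  have E1 := E ((a + b) / 2 - a + ((c + d) / 2 - c)) ltac:(lra).
  have E2 := E (b - (a + b) / 2 + ((c + d) / 2 - c)) ltac:(lra).
  have E3 := E ((a + b) / 2 - a + (d - (c + d) / 2)) ltac:(lra).
  have E4 := E (b - (a + b) / 2 + (d - (c + d) / 2)) ltac:(lra).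
  move: p1 p2 p3 p4; rewrite /P E1 E2 E3 E4 => p1 p2 p3 p4.
  apply: (le_trans (normc_triangle _ _)).
  apply: (le_trans (lerD (normc_triangle _ _) (normc_triangle _ _))).
  clear -p1 p2 p3 p4; lra.
- move=> p q hp hq.
  have [e he] := hf p q hp hq.
  have [del d0 H] := he (eps / 4) ltac:(by rewrite divr_gt0).
  pose L := (x2 - x1) + (y2 - y1) + 1.
  have L0 : 0 < L by rewrite /L; lra.
  exists (del / L); first by rewrite divr_gt0.
  move=> a b c d t xa bx yc dy hap hcq /andP[t0 td] w1 w2 _.
  have ab : a <= b by case/andP: hap => /le_trans h /h.
  have cd : c <= d by case/andP: hcq => /le_trans h /h.
  have hfs : holR f a b c d by exact: holR_sub hf.
  have hs : (b - a) + (d - c) < del.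
    rewrite w1 w2 -mulrDl; move: td; rewrite ltr_pdivlMr// => td.
    apply: le_lt_trans td; rewrite mulrC ler_wpM2l ?(ltW t0)// /L; lra.
  pose z0 := p +i* q.
  have hbd z : rect_bd a b c d z -> normc (z - z0) <= (b - a) + (d - c).
    have K x y : a <= x <= b -> c <= y <= d -> normc ((x +i* y) - z0) <= (b - a) + (d - c).
      move=> /andP[? ?] /andP[? ?]; case/andP: hap => ? ?; case/andP: hcq => ? ?.
      apply: (le_trans (normc_le1 _)) => /=.
      by apply: lerD; rewrite ler_norml; apply/andP; split; lra.
    by case=> s hs'; apply: K; rewrite ?lexx ?ab ?cd.
  have lc z : hol (fun w => f z0 + e * (w - z0)) z.
    eexists; apply: cdiffD; first exact: cdiff_cst.
    by apply: cdiffZ; apply: cdiffB; [exact: cdiff_id|exact: cdiff_cst].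
  have rc z : hol f z -> hol (fun w => f w - f z0 - e * (w - z0)) z.
    move=> [d1 h1]; eexists; apply: cdiffB; first by apply: cdiffB h1 (cdiff_cst _ _).
    by apply: cdiffZ; apply: cdiffB; [exact: cdiff_id|exact: cdiff_cst].
  have fE : oint f a b c d = oint (fun w => f w - f z0 - e * (w - z0)) a b c d.
    have fc := holR_contB ab cd hfs.
    rewrite -[RHS]addr0 -(mulr0 e) -(oint_id ab cd) -ointZ; last first.
      by move=> z _; exact: contC_id.
    rewrite -[RHS]addr0 -(oint_cst (f z0 - e * z0) ab cd).
    have A1 : contB (fun w => f w - f z0 - e * (w - z0)) a b c d.
      by apply: holR_contB => // x y hx hy; apply: rc; exact: hfs.
    have A2 : contB (fun w => e * id w) a b c d.
      by move=> z _; apply: hol_contC; eexists; apply: cdiffZ; exact: cdiff_id.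
    have A3 : contB (fun=> f z0 - e * z0) a b c d by move=> z _; exact: contC_cst.
    have A4 : contB (fun w => (f w - f z0 - e * (w - z0)) + e * id w) a b c d.
      move=> z hz; apply: hol_contC.
      suff [d1 hd1] : hol (fun w => f w - f z0 - e * (w - z0)) z.
        by eexists; apply: cdiffD hd1 _; apply: cdiffZ; exact: cdiff_id.
      by apply: rc; case: hz => s hs'; apply: hfs; rewrite ?lexx ?ab ?cd.
    rewrite -(ointD A1 A2) -(ointD A4 A3).
    by apply: oint_ext => z _; ring.
  have := @oint_bound (fun w => f w - f z0 - e * (w - z0)) a b c d (eps / 4 * ((b - a) + (d - c))) ab cd.
  rewrite /P fE; have -> : 4 * (eps / 4 * (b - a + (d - c))) * (b - a + (d - c)) =
     eps * (b - a + (d - c)) ^+ 2 by field.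
  apply.
    by apply: holR_contB => // x y hx hy; apply: rc; exact: hfs.
  move=> z hz; have hz' := hbd z hz.
  apply: (le_trans (H z (le_lt_trans hz' hs))).
  by rewrite ler_wpM2l// divr_ge0// ltW.
- by exists 1; rewrite !mulr1.
Qed.

End goursat.

(** * Cauchy's formula *)

Section cauchy.
Variable R : realType.
Local Notation C := R[i].
Implicit Types (f g : C -> C) (z w e : C) (a b c d x y t s m : R).

Lemma cdiff_inv_shift w z : z != w -> cdiff (fun v => (v - w)^-1) z (- 1 / (z - w) ^+ 2).
Proof.
move=> zw; apply: (@cdiffV _ (fun v => v - w)); first by rewrite subr_eq0.
by apply: (@cdiff_eq _ _ _ (1 - 0)); [apply: cdiffB; [exact: cdiff_id|exact: cdiff_cst]|rewrite subr0].
Qed.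

Lemma hol_inv_shift w z : z != w -> hol (fun v => (v - w)^-1) z.
Proof. by move=> /cdiff_inv_shift h; eexists; exact: h. Qed.

Lemma holM f g z : hol f z -> hol g z -> hol (fun v => f v * g v) z.
Proof. by move=> [d1 h1] [d2 h2]; eexists; exact: cdiffM h1 h2. Qed.

Lemma holB f g z : hol f z -> hol g z -> hol (fun v => f v - g v) z.
Proof. by move=> [d1 h1] [d2 h2]; eexists; exact: cdiffB h1 h2. Qed.

Lemma holD f g z : hol f z -> hol g z -> hol (fun v => f v + g v) z.
Proof. by move=> [d1 h1] [d2 h2]; eexists; exact: cdiffD h1 h2. Qed.

Lemma hol_cst w z : hol (fun=> w) z.
Proof. by eexists; exact: cdiff_cst. Qed.

Lemma hol_id z : hol id z.
Proof. by eexists; exact: cdiff_id. Qed.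

Lemma contCM f g z : contC f z -> contC g z -> contC (fun v => f v * g v) z.
Proof.
move=> hf hg eps e0.
pose M := normc (f z) + normc (g z) + 1.
have M0 : 0 < M by rewrite ltr_wpDl// addr_ge0 ?normc_ge0.
have [d1 d10 H1] := hf (Num.min 1 (eps / 2 / M)) ltac:(by rewrite lt_min ltr01 !divr_gt0).
have [d2 d20 H2] := hg (eps / 2 / M) ltac:(by rewrite !divr_gt0).
exists (Num.min d1 d2); first by rewrite lt_min d10.
move=> v; rewrite lt_min => /andP[/H1 + /H2 h2]; rewrite lt_min => /andP[h11 h12].
have -> : f v * g v - f z * g z = f v * (g v - g z) + (f v - f z) * g z by ring.
apply: (le_lt_trans (normc_triangle _ _)); rewrite !normcME.
have fv : normc (f v) <= M.
  have := normc_triangle (f v - f z) (f z); rewrite subrK => h.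
  rewrite (le_trans h)// /M; have := normc_ge0 (g z); lra.
have gz : normc (g z) <= M by rewrite /M; have := normc_ge0 (f z); lra.
rewrite (splitr eps) ltr_leD//.
  apply: (@le_lt_trans _ _ (M * normc (g v - g z))); first by rewrite ler_wpM2r ?normc_ge0.
  by rewrite mulrC -ltr_pdivlMr.
apply: (@le_trans _ _ (normc (f v - f z) * M)); first by rewrite ler_wpM2l ?normc_ge0.
by rewrite -ler_pdivlMr// ltW.
Qed.

(** The region between two nested rectangles is cut into four rectangles, and
    Goursat's theorem applies to each of them. *)
Lemma oint_annulus g a b c d a' b' c' d' :
  a <= a' -> a' <= b' -> b' <= b -> c <= c' -> c' <= d' -> d' <= d ->
  (forall x y, a <= x <= b -> c <= y <= d ->
     [\/ x <= a', b' <= x, y <= c' | d' <= y] -> hol g (x +i* y)) ->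
  oint g a b c d = oint g a' b' c' d'.
Proof.
move=> aa ab bb cc cd dd gh.
have gc x y : a <= x -> x <= b -> c <= y -> y <= d ->
    [\/ x <= a', b' <= x, y <= c' | d' <= y] -> hol g (x +i* y).
  by move=> h1 h2 h3 h4; apply: gh; rewrite ?h1 ?h3.
have cB1 : contB g a b c d.
  by move=> z [] t /andP[h1 h2]; apply/hol_contC/gc; try lra;
    [apply: Or43|apply: Or44|apply: Or41|apply: Or42].
have cB2 : contB g a' b c d.
  by move=> z [] t /andP[h1 h2]; apply/hol_contC/gc; try lra;
    [apply: Or43|apply: Or44|apply: Or41|apply: Or42].
have cB3 : contB g a' b' c d.
  by move=> z [] t /andP[h1 h2]; apply/hol_contC/gc; try lra;
    [apply: Or43|apply: Or44|apply: Or41|apply: Or42].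
have cB4 : contB g a' b' c' d.
  by move=> z [] t /andP[h1 h2]; apply/hol_contC/gc; try lra;
    [apply: Or43|apply: Or44|apply: Or41|apply: Or42].
have a'b : a' <= b by lra.
have c'd : c' <= d by lra.
rewrite (oint_split_x aa a'b cB1) (oint_split_x ab bb cB2).
rewrite (oint_split_y cc c'd cB3) (oint_split_y cd dd cB4).
rewrite (_ : oint g a a' c d = 0); last first.
  apply: goursat; try lra.
  by move=> x y /andP[h1 h2] /andP[h3 h4]; apply: gc; try lra; apply: Or41.
rewrite (_ : oint g b' b c d = 0); last first.
  apply: goursat; try lra.
  by move=> x y /andP[h1 h2] /andP[h3 h4]; apply: gc; try lra; apply: Or42.
rewrite (_ : oint g a' b' c c' = 0); last first.
  apply: goursat; try lra.
  by move=> x y /andP[h1 h2] /andP[h3 h4]; apply: gc; try lra; apply: Or43.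
rewrite (_ : oint g a' b' d' d = 0); last first.
  apply: goursat; try lra.
  by move=> x y /andP[h1 h2] /andP[h3 h4]; apply: gc; try lra; apply: Or44.
by rewrite !add0r !addr0.
Qed.

(** The contour may be replaced by arbitrarily small squares around [w], where
    the integrand stays bounded. *)
Lemma oint_punctured g a b c d w r (M : R) :
  a < re w < b -> c < im w < d -> 0 < r ->
  (forall x y, a <= x <= b -> c <= y <= d -> x +i* y != w -> hol g (x +i* y)) ->
  (forall z, z != w -> normc (z - w) < r -> normc (g z) <= M) ->
  oint g a b c d = 0.
Proof.
case: w => p q /= /andP[ap pb] /andP[cq qd] r0 gh gM.
have M0 : 0 <= M.
  apply: le_trans (normc_ge0 _) (gM ((p + r / 2) +i* q) _ _).
    by rewrite eq_complex /= eqxx andbT gt_eqF// ltrDl divr_gt0.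
  rewrite normc_hor addrAC subrr add0r gtr0_norm ?divr_gt0//.
  by rewrite ltr_pdivrMr// ltr_pMr// ltr1n.
pose s0 := Num.min (Num.min (p - a) (b - p)) (Num.min (Num.min (q - c) (d - q)) (r / 3)).
have s00 : 0 < s0 by rewrite !lt_min !subr_gt0 ap pb cq qd divr_gt0.
suff H s : 0 < s <= s0 -> normc (oint g a b c d) <= 16 * M * s.
  apply: eq0_normc; apply/eqP; rewrite eq_le normc_ge0 andbT.
  apply/ler_addgt0Pr => e e0; rewrite add0r.
  have K0 : 0 < 16 * M + 1 by rewrite ltr_wpDl// mulr_ge0.
  pose s := Num.min s0 (e / (16 * M + 1)).
  have sp : 0 < s by rewrite lt_min s00 divr_gt0.
  apply: le_trans (H s _) _; first by rewrite sp ge_min lexx.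
  have : s <= e / (16 * M + 1) by rewrite ge_min lexx orbT.
  rewrite ler_pdivlMr// => h; apply: le_trans h; lra.
move=> /andP[sp]; rewrite !le_min => /andP[/andP[h1 h2] /andP[/andP[h3 h4] h5]].
rewrite (@oint_annulus g a b c d (p - s) (p + s) (q - s) (q + s)); try lra; last first.
  move=> x y hx hy hn; apply: gh => //; apply/negP => /eqP[ex ey].
  by case: hn; lra.
have K z : rect_bd (p - s) (p + s) (q - s) (q + s) z -> z != p +i* q /\ normc (z - (p +i* q)) < r.
  have K1 x y : `|x - p| <= s -> `|y - q| <= s -> normc ((x +i* y) - (p +i* q)) < r.
    move=> k1 k2; apply: (le_lt_trans (normc_le1 _)) => /=; lra.
  by case=> t ht; (split; [rewrite eq_complex /=; apply/negP => /andP[/eqP ? /eqP ?]; lra|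
    apply: K1; rewrite ler_norml; apply/andP; split; lra]).
have -> : 16 * M * s = 4 * M * ((p + s) - (p - s) + ((q + s) - (q - s))) by ring.
apply: oint_bound; try lra.
  move=> z hz; have [zw _] := K z hz.
  by apply: hol_contC; case: hz zw => t ht zw; apply: gh => //; apply/andP; split; lra.
by move=> z /K[zw hz]; exact: gM.
Qed.

Lemma rect_bd_neq a b c d w z : a < re w < b -> c < im w < d -> rect_bd a b c d z -> z != w.
Proof.
case: w => p q /= /andP[? ?] /andP[? ?] [] t ht; rewrite eq_complex /=;
  by apply/negP => /andP[/eqP ? /eqP ?]; lra.
Qed.

(** The difference quotient of [f] at [w] is bounded near [w], so its integral
    vanishes.  The kernel integral on the right is [2 i pi], but only a lower
    bound on it will be used. *)
Lemma cauchy_formula f a b c d w : a < re w < b -> c < im w < d ->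
  holR f a b c d ->
  oint (fun z => f z * (z - w)^-1) a b c d =
  f w * oint (fun z => (z - w)^-1) a b c d.
Proof.
move=> hw1 hw2 hf.
have fw : hol f w by case: w hw1 hw2 => p q /= /andP[? ?] /andP[? ?]; apply: hf; apply/andP; split; lra.
have cI : contB (fun z => (z - w)^-1) a b c d.
  by move=> z hz; apply/hol_contC/hol_inv_shift/(rect_bd_neq hw1 hw2 hz).
have ab : a <= b by lra.
have cd : c <= d by lra.
have fB : contB f a b c d := holR_contB ab cd hf.
rewrite -ointZ//; apply/eqP; rewrite -subr_eq0; apply/eqP.
have -> : oint (fun z => f z * (z - w)^-1) a b c d - oint (fun z => f w * (z - w)^-1) a b c d =
   oint (fun z => (f z - f w) * (z - w)^-1) a b c d.
  rewrite -[- oint _ _ _ _ _]mulN1r -ointZ; last by move=> z hz; apply: contCM; [exact: contC_cst|exact: cI].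
  rewrite -ointD; last 2 first.
  - by move=> z hz; apply: contCM; [exact: fB|exact: cI].
  - by move=> z hz; apply: contCM; [exact: contC_cst|apply: contCM; [exact: contC_cst|exact: cI]].
  by apply: oint_ext => z _; ring.
have [e he] := fw; have [del d0 H] := cdiff_lip he.
apply: (@oint_punctured _ a b c d w del (normc e + 1)) => //.
  move=> x y hx hy hz; apply: holM; last exact: hol_inv_shift.
  by apply: holB; [exact: hf|exact: hol_cst].
move=> z zw /H h; rewrite normc_div ler_pdivrMr//.
by rewrite normc_gt0 subr_eq0.
Qed.

End cauchy.

Section kernel.
Variable R : realType.
Local Notation C := R[i].
Implicit Types (f g : C -> C) (z w e : C) (a b c d x y t s m : R).

Lemma re_inv x y : re ((x +i* y)^-1 : C) = x / (x ^+ 2 + y ^+ 2).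
Proof. by []. Qed.

Lemma im_inv x y : im ((x +i* y)^-1 : C) = - y / (x ^+ 2 + y ^+ 2).
Proof. by rewrite /= mulNr. Qed.

Lemma rint_ge a b (k : R -> R) (m : R) : a <= b -> rcont a b k ->
  (forall t, a <= t <= b -> m <= k t) -> m * (b - a) <= rint a b k.
Proof. by move=> ab kc km; rewrite -rint_cst//; apply: le_rint => //; exact: rcont_cst. Qed.

(** Every side contributes positively to the imaginary part. *)
Lemma im_kernel_ge a b c d w m K : 0 < m -> 
  m <= re w - a -> m <= b - re w -> m <= im w - c -> m <= d - im w ->
  (forall z, rect_bd a b c d z -> normc (z - w) ^+ 2 <= K) ->
  m / K * (2 * ((b - a) + (d - c))) <= im (oint (fun z => (z - w)^-1) a b c d).
Proof.
case: w => p q /= m0 h1 h2 h3 h4 hK.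
have hw1 : a < re (p +i* q) < b by rewrite /=; apply/andP; split; lra.
have hw2 : c < im (p +i* q) < d by rewrite /=; apply/andP; split; lra.
have ab : a <= b by lra.
have cd : c <= d by lra.
have cI : contB (fun z => (z - (p +i* q))^-1) a b c d.
  by move=> z hz; apply/hol_contC/hol_inv_shift/(rect_bd_neq hw1 hw2 hz).
have [[_ c1] [_ c2] [c3 _] [c4 _]] := contB_edges cI.
have sub x y : (x +i* y) - (p +i* q) = (x - p) +i* (y - q) by [].
have K' x y : rect_bd a b c d (x +i* y) -> 
   (x - p) ^+ 2 + (y - q) ^+ 2 <= K by move=> /hK; rewrite sub normc_sqr.
have key u n : m <= u -> u ^+ 2 <= n -> n <= K -> m / K <= u / n.
  move=> mu un nK.
  have n0 : 0 < n by apply: lt_le_trans un; rewrite exprn_gt0//; lra.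
  apply: ler_pM => //; [lra|by rewrite invr_ge0; lra|].
  by rewrite lef_pV2// posrE; lra.
rewrite /oint.
have e1 : m / K * (b - a) <= rint a b (fun t => im (((t +i* c) - (p +i* q))^-1)).
  apply: rint_ge => // t ht; rewrite sub im_inv opprB; apply: key => //.
  - by rewrite -sqrrN opprB lerDr sqr_ge0.
  - by apply: K'; constructor.
have e2 : m / K * (b - a) <= - rint a b (fun t => im (((t +i* d) - (p +i* q))^-1)).
  rewrite -[- rint _ _ _]mulN1r -rintZ//; apply: rint_ge => //; first exact/rcontM/c2/rcont_cst.
  move=> t ht; rewrite sub im_inv mulN1r -mulNr opprK; apply: key => //.
  - by rewrite lerDr sqr_ge0.
  - by apply: K'; constructor.
have e3 : m / K * (d - c) <= rint c d (fun t => re (((b +i* t) - (p +i* q))^-1)).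
  apply: rint_ge => // t ht; rewrite sub re_inv; apply: key => //.
  - by rewrite lerDl sqr_ge0.
  - by apply: K'; constructor.
have e4 : m / K * (d - c) <= - rint c d (fun t => re (((a +i* t) - (p +i* q))^-1)).
  rewrite -[- rint _ _ _]mulN1r -rintZ//; apply: rint_ge => //; first exact/rcontM/c4/rcont_cst.
  move=> t ht; rewrite sub re_inv mulN1r -mulNr opprB; apply: key => //.
  - by rewrite -sqrrN opprB lerDl sqr_ge0.
  - by apply: K'; constructor.
rewrite mul0r add0r mul1r; move: e1 e2 e3 e4 => /=.
set u1 := rint _ _ _; set u2 := rint _ _ _; set u3 := rint _ _ _; set u4 := rint _ _ _.
lra.
Qed.

End kernel.

(** * Derivatives of holomorphic functions *)

Section regularity.
Variable R : realType.
Local Notation C := R[i].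
Implicit Types (f g u : C -> C) (z w e h : C) (a b c d x y t s m : R).

Lemma rcont_bounded a b (k : R -> R) : a <= b -> rcont a b k ->
  exists M : R, forall t, a <= t <= b -> k t <= M.
Proof.
move=> ab kc; have [m _ hm] := @EVT_max R k a b ab kc.
by exists (k m) => t ht; apply: hm; rewrite in_itv.
Qed.

Lemma contB_bounded f a b c d : a <= b -> c <= d -> contB f a b c d ->
  exists M : R, forall z, rect_bd a b c d z -> normc (f z) <= M.
Proof.
move=> ab cd /contB_edges[f1 f2 f3 f4].
have [M1 H1] := rcont_bounded ab (rcont_normc f1).
have [M2 H2] := rcont_bounded ab (rcont_normc f2).
have [M3 H3] := rcont_bounded cd (rcont_normc f3).
have [M4 H4] := rcont_bounded cd (rcont_normc f4).
exists (Num.max (Num.max M1 M2) (Num.max M3 M4)) => z [] t ht; rewrite !le_max.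
- by rewrite H1.
- by rewrite H2 ?orbT.
- by rewrite H4 ?orbT.
- by rewrite H3 ?orbT.
Qed.

Lemma contCX f z n : contC f z -> contC (fun v => f v ^+ n) z.
Proof.
move=> fz; elim: n => [|n IH]; first exact: contC_cst.
rewrite (_ : (fun v => _) = fun v => f v * f v ^+ n); first exact: contCM.
by apply/funext => v; rewrite exprS.
Qed.

(** The quadratic remainder of the kernel is uniform on the contour, hence so is
    that of the integral. *)
Lemma cdiff_oint u (k k' : C -> C -> C) a b c d w (r B : R) :
  a <= b -> c <= d -> contB u a b c d -> 0 < r ->
  (forall h, normc h < r -> contB (k^~ (w + h)) a b c d) ->
  contB (k'^~ w) a b c d ->
  (forall z h, rect_bd a b c d z -> normc h < r ->
     normc (k z (w + h) - k z w - h * k' z w) <= B * normc h ^+ 2) ->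
  cdiff (fun v => oint (fun z => u z * k z v) a b c d) w
    (oint (fun z => u z * k' z w) a b c d).
Proof.
move=> ab cd uc r0 kc k'c H eps e0.
have [U HU] := contB_bounded ab cd uc.
pose U1 := `|U|; pose B1 := `|B|.
pose L := 4 * (U1 * B1) * ((b - a) + (d - c)) + 1.
have L0 : 0 < L.
  rewrite ltr_wpDl// mulr_ge0//; last lra.
  by rewrite !mulr_ge0// normr_ge0.
exists (Num.min r (eps / L)); first by rewrite lt_min r0 divr_gt0.
move=> v; rewrite lt_min => /andP[vr vL].
pose h := v - w; have -> : v = w + h by rewrite /h addrC subrK.
have -> : w + h - w = h by rewrite addrC addKr.
have hr : normc h < r by [].
have kc0 : contB (k^~ w) a b c d by have := kc 0; rewrite addr0 normc0 => /(_ r0).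
have cM f g : contB f a b c d -> contB g a b c d -> contB (fun z => f z * g z) a b c d.
  by move=> hf hg z hz; apply: contCM; [exact: hf|exact: hg].
have cc e : contB (fun=> e) a b c d by move=> z _; exact: contC_cst.
have cA f g : contB f a b c d -> contB g a b c d -> contB (fun z => f z + g z) a b c d.
  move=> hf hg z hz eps' e'0.
  have [d1 d10 H1] := hf z hz (eps' / 2) ltac:(by rewrite divr_gt0).
  have [d2 d20 H2] := hg z hz (eps' / 2) ltac:(by rewrite divr_gt0).
  exists (Num.min d1 d2); first by rewrite lt_min d10.
  move=> v'; rewrite lt_min => /andP[/H1 h1 /H2 h2].
  have -> : f v' + g v' - (f z + g z) = (f v' - f z) + (g v' - g z) by ring.
  by rewrite (splitr eps') (le_lt_trans (normc_triangle _ _))// ltrD.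
have K1 := kc _ hr.
have -> : oint (fun z => u z * k z (w + h)) a b c d -
    oint (fun z => u z * k z w) a b c d - oint (fun z => u z * k' z w) a b c d * h =
   oint (fun z => u z * (k z (w + h) + (-1) * k z w + (- h) * k' z w)) a b c d.
  have E1 : contB (fun z => u z * k z w) a b c d by exact: cM.
  have E2 : contB (fun z => u z * k' z w) a b c d by exact: cM.
  have E3 : contB (fun z => u z * k z (w + h)) a b c d by exact: cM.
  have E4 : contB (fun z => -1 * (u z * k z w)) a b c d by exact: cM.
  have E5 : contB (fun z => - h * (u z * k' z w)) a b c d by exact: cM.
  have E6 := cA _ _ E3 E4.
  rewrite [_ * h]mulrC -mulNr -[- oint _ _ _ _ _]mulN1r.
  rewrite -(ointZ (-1) E1) -(ointZ (- h) E2).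
  rewrite -(ointD E3 E4) -(ointD E6 E5).
  by apply: oint_ext => z _; ring.
apply: (@le_trans _ _ (4 * (U1 * (B1 * normc h ^+ 2)) * ((b - a) + (d - c)))).
  apply: oint_bound => //.
    by apply/(cM _ _ uc)/cA; [apply/(cA _ _ K1)/cM|apply/cM].
  move=> z hz; rewrite normcME; apply: ler_pM; rewrite ?normc_ge0//.
    by apply: (le_trans (HU z hz)); exact: ler_norm.
  have := H z h hz hr; rewrite mulN1r mulNr => /le_trans; apply.
  by rewrite ler_wpM2r ?sqr_ge0 ?ler_norm.
have -> : 4 * (U1 * (B1 * normc h ^+ 2)) * (b - a + (d - c)) = (L - 1) * normc h * normc h.
  by rewrite /L; ring.
rewrite ler_wpM2r ?normc_ge0//.
move: vL; rewrite ltr_pdivlMr// -/h => vL.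
have := normc_ge0 h; nra.
Qed.

Section transform.
Variables (u : C -> C) (a b c d m V : R) (w : C).
Hypotheses (ab : a <= b) (cd : c <= d) (uc : contB u a b c d) (m0 : 0 < m).
Hypothesis far : forall z, rect_bd a b c d z -> m <= normc (z - w) <= V.

Let far' z h : rect_bd a b c d z -> normc h < m / 2 ->
  m / 2 <= normc (z - (w + h)) /\ z - (w + h) != 0.
Proof.
move=> /far/andP[h1 h2] hh.
have e : m / 2 <= normc (z - (w + h)).
  have := ler_normcB (z - w) h.
  by rewrite opprD addrA; lra.
by split => //; rewrite -normc_gt0; apply: lt_le_trans e; rewrite divr_gt0.
Qed.

Let far0 z : rect_bd a b c d z -> m <= normc (z - w) /\ z - w != 0.
Proof.
by move=> /far/andP[h1 _]; split => //; rewrite -normc_gt0; apply: lt_le_trans h1.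
Qed.

Let kcont h : normc h < m / 2 -> contB (fun z => (z - (w + h))^-1) a b c d.
Proof.
move=> hh z /far'/(_ hh)[_]; rewrite subr_eq0 => hz.
exact/hol_contC/hol_inv_shift.
Qed.

Let kcont0 : contB (fun z => (z - w)^-1) a b c d.
Proof.
by have := @kcont 0; rewrite addr0 normc0; apply; rewrite divr_gt0.
Qed.

Lemma cdiff_transform1 :
  cdiff (fun v => oint (fun z => u z * (z - v)^-1) a b c d) w
    (oint (fun z => u z * (z - w)^-1 ^+ 2) a b c d).
Proof.
apply: (@cdiff_oint u (fun z v => (z - v)^-1) (fun z v => (z - v)^-1 ^+ 2) a b c d w
  (m / 2) (2 / m ^+ 3)) => //.
- by rewrite divr_gt0.
- by move=> z hz; apply: contCX; exact: kcont0.
move=> z h hz hh; have [n1 z1] := far' hz hh; have [n2 z2] := far0 hz.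
have -> : (z - (w + h))^-1 - (z - w)^-1 - h * (z - w)^-1 ^+ 2 =
  h ^+ 2 * ((z - (w + h))^-1 * (z - w)^-1 ^+ 2).
  by field; rewrite z2 z1.
rewrite (normcME (h ^+ 2)) (normcX h) mulrC ler_wpM2r ?exprn_ge0 ?normc_ge0//.
rewrite normcME normcX !normcVE.
have p1 : (normc (z - (w + h)))^-1 <= 2 / m.
  by rewrite -[2 / m]invf_div lef_pV2// posrE ?divr_gt0//; apply: lt_le_trans n1; rewrite divr_gt0.
have p2 : (normc (z - w))^-1 <= m^-1.
  by rewrite lef_pV2// posrE//; apply: lt_le_trans n2.
have -> : 2 / m ^+ 3 = 2 / m * m^-1 ^+ 2 by field; rewrite gt_eqF.
apply: ler_pM => //; rewrite ?exprn_ge0 ?invr_ge0 ?normc_ge0//.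
by rewrite lerXn2r ?nnegrE ?invr_ge0 ?normc_ge0// ltW.
Qed.

Lemma cdiff_transform2 :
  cdiff (fun v => oint (fun z => u z * (z - v)^-1 ^+ 2) a b c d) w
    (oint (fun z => u z * (2 * (z - w)^-1 ^+ 3)) a b c d).
Proof.
apply: (@cdiff_oint u (fun z v => (z - v)^-1 ^+ 2) (fun z v => 2 * (z - v)^-1 ^+ 3) a b c d w
  (m / 2) ((3 * V + m) * ((2 / m) ^+ 2 * m^-1 ^+ 3))) => //.
- by rewrite divr_gt0.
- by move=> h hh z hz; apply: contCX; exact: kcont.
- move=> z hz; apply: contCM; first exact: contC_cst.
  by apply: contCX; exact: kcont0.
move=> z h hz hh; have [n1 z1] := far' hz hh; have [n2 z2] := far0 hz.
have -> : (z - (w + h))^-1 ^+ 2 - (z - w)^-1 ^+ 2 - h * (2 * (z - w)^-1 ^+ 3) =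
  h ^+ 2 * ((3 * (z - w) - 2 * h) * ((z - (w + h))^-1 ^+ 2 * (z - w)^-1 ^+ 3)).
  by field; rewrite z2 z1.
rewrite (normcME (h ^+ 2)) (normcX h) mulrC ler_wpM2r ?exprn_ge0 ?normc_ge0//.
rewrite normcME normcME 2!normcX !normcVE.
have p1 : (normc (z - (w + h)))^-1 <= 2 / m.
  by rewrite -[2 / m]invf_div lef_pV2// posrE ?divr_gt0//; apply: lt_le_trans n1; rewrite divr_gt0.
have p2 : (normc (z - w))^-1 <= m^-1.
  by rewrite lef_pV2// posrE//; apply: lt_le_trans n2.
apply: ler_pM; rewrite ?normc_ge0 ?mulr_ge0 ?exprn_ge0 ?invr_ge0 ?normc_ge0//.
  apply: (le_trans (normc_triangleB _ _)); rewrite !normcME !normc_nat.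
  by have /andP[_ ?] := far hz; lra.
by apply: ler_pM; rewrite ?exprn_ge0 ?invr_ge0 ?normc_ge0//;
  rewrite lerXn2r ?nnegrE ?invr_ge0 ?divr_ge0 ?normc_ge0// ltW.
Qed.

End transform.

Lemma square_bd_far x y s : 0 < s -> forall z w, normc (w - (x +i* y)) < s / 2 ->
  rect_bd (x - s) (x + s) (y - s) (y + s) z -> s / 2 <= normc (z - w) <= 3 * s.
Proof.
move=> s0 z [p q] hw hz.
have hp : `|p - x| < s / 2 by apply: le_lt_trans hw; exact: (normc_Re ((p +i* q) - (x +i* y))).
have hq : `|q - y| < s / 2 by apply: le_lt_trans hw; exact: (normc_Im ((p +i* q) - (x +i* y))).
move: hp hq; rewrite !ltr_norml => /andP[p1 p2] /andP[q1 q2].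
have up (v : R * R) : `|v.1 - p| <= 3 * s / 2 -> `|v.2 - q| <= 3 * s / 2 ->
    normc ((v.1 +i* v.2) - (p +i* q)) <= 3 * s.
  by move=> h1 h2; apply: (le_trans (normc_le1 _)) => /=; lra.
case: hz => t /andP[t1 t2]; apply/andP; split.
- apply: le_trans (normc_Im _) => /=; rewrite ler_normr; apply/orP; right; lra.
- by apply: (up (t, y - s)) => /=; rewrite ler_norml; apply/andP; split; lra.
- apply: le_trans (normc_Im _) => /=; rewrite ler_normr; apply/orP; left; lra.
- by apply: (up (t, y + s)) => /=; rewrite ler_norml; apply/andP; split; lra.
- apply: le_trans (normc_Re _) => /=; rewrite ler_normr; apply/orP; right; lra.
- by apply: (up (x - s, t)) => /=; rewrite ler_norml; apply/andP; split; lra.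
- apply: le_trans (normc_Re _) => /=; rewrite ler_normr; apply/orP; left; lra.
- by apply: (up (x + s, t)) => /=; rewrite ler_norml; apply/andP; split; lra.
Qed.

(** Near [w] the function is a quotient of two Cauchy transforms over a square,
    those of [f] and of [1], and both may be differentiated twice.  Dividing by
    the transform of [1] avoids computing its constant value. *)
Lemma hol_cderiv f w (r : R) : 0 < r ->
  (forall z, normc (z - w) < r -> hol f z) -> hol (cderiv 1 f) w.
Proof.
case: w => x y r0 fh.
pose s := r / 3; have s0 : 0 < s by rewrite divr_gt0.
pose O g := oint g (x - s) (x + s) (y - s) (y + s).
have fR : holR f (x - s) (x + s) (y - s) (y + s).
  move=> x' y' /andP[h1 h2] /andP[h3 h4]; apply: fh.
  apply: (le_lt_trans (normc_le1 _)) => /=.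
  have : `|x' - x| <= s by rewrite ler_norml; apply/andP; split; lra.
  have : `|y' - y| <= s by rewrite ler_norml; apply/andP; split; lra.
  rewrite /s; lra.
have ab : x - s <= x + s by lra.
have cd : y - s <= y + s by lra.
have fB := holR_contB ab cd fR.
have oB : contB (fun=> (1 : C)) (x - s) (x + s) (y - s) (y + s).
  by move=> z _; exact: contC_cst.
have s20 : 0 < s / 2 by rewrite divr_gt0.
have far v : normc (v - (x +i* y)) < s / 2 -> forall z, rect_bd (x - s) (x + s) (y - s) (y + s) z ->
  s / 2 <= normc (z - v) <= 3 * s by move=> hv z hz; exact: (square_bd_far s0 hv hz).
pose N v := O (fun z => f z * (z - v)^-1).
pose N1 v := O (fun z => f z * (z - v)^-1 ^+ 2).
pose N2 v := O (fun z => f z * (2 * (z - v)^-1 ^+ 3)).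
pose K v := O (fun z => 1 * (z - v)^-1).
pose K1 v := O (fun z => 1 * (z - v)^-1 ^+ 2).
pose K2 v := O (fun z => 1 * (2 * (z - v)^-1 ^+ 3)).
have dN v : normc (v - (x +i* y)) < s / 2 -> cdiff N v (N1 v).
  by move=> /far hv; exact: (cdiff_transform1 ab cd fB s20 hv).
have dN1 v : normc (v - (x +i* y)) < s / 2 -> cdiff N1 v (N2 v).
  by move=> /far hv; exact: (cdiff_transform2 ab cd fB s20 hv).
have dK v : normc (v - (x +i* y)) < s / 2 -> cdiff K v (K1 v).
  by move=> /far hv; exact: (cdiff_transform1 ab cd oB s20 hv).
have dK1 v : normc (v - (x +i* y)) < s / 2 -> cdiff K1 v (K2 v).
  by move=> /far hv; exact: (cdiff_transform2 ab cd oB s20 hv).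
have inn v : normc (v - (x +i* y)) < s / 2 ->
  [/\ s / 2 <= re v - (x - s), s / 2 <= (x + s) - re v,
     s / 2 <= im v - (y - s) & s / 2 <= (y + s) - im v].
  case: v => p q hv.
  have hp : `|p - x| < s / 2 by apply: le_lt_trans hv; exact: (normc_Re ((p +i* q) - (x +i* y))).
  have hq : `|q - y| < s / 2 by apply: le_lt_trans hv; exact: (normc_Im ((p +i* q) - (x +i* y))).
  by move: hp hq; rewrite !ltr_norml => /andP[p1 p2] /andP[q1 q2]; split => /=; lra.
have K0 v : normc (v - (x +i* y)) < s / 2 -> K v != 0.
  move=> hv; have [i1 i2 i3 i4] := inn v hv.
  have := @im_kernel_ge R _ _ _ _ v (s / 2) ((3 * s) ^+ 2) s20 i1 i2 i3 i4.
  have hb z : rect_bd (x - s) (x + s) (y - s) (y + s) z -> normc (z - v) ^+ 2 <= (3 * s) ^+ 2.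
    move=> /(far v hv)/andP[_ hz].
    by rewrite lerXn2r ?nnegrE ?normc_ge0// mulr_ge0// ltW.
  move=> /(_ hb) H; apply/eqP => Kv.
  have : (0 : R) < im (K v).
    rewrite /K /O (@oint_ext _ _ (fun z => (z - v)^-1)); last by move=> z _; rewrite mul1r.
    apply: lt_le_trans H; apply: mulr_gt0; first by rewrite divr_gt0// exprn_gt0// mulr_gt0.
    lra.
  by rewrite Kv ltxx.
have fE v : normc (v - (x +i* y)) < s / 2 -> f v = N v * (K v)^-1.
  move=> hv; have [i1 i2 i3 i4] := inn v hv.
  have := @cauchy_formula R f (x - s) (x + s) (y - s) (y + s) v.
  rewrite -/(O _) -/(N v) => ->//; try by apply/andP; split; lra.
  have -> : oint (fun z => (z - v)^-1) (x - s) (x + s) (y - s) (y + s) = K v.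
    by apply: oint_ext => z _; rewrite mul1r.
  by rewrite mulfK// K0.
have f'E v : normc (v - (x +i* y)) < s / 2 ->
    N v * (- K1 v / K v ^+ 2) + N1 v * (K v)^-1 = cderiv 1 f v.
  move=> hv; symmetry; apply: cdiff_derive1.
  pose rho := s / 2 - normc (v - (x +i* y)).
  have rho0 : 0 < rho by rewrite subr_gt0.
  apply: (@cdiff_local _ (fun v => N v * (K v)^-1) f v _ rho) => //.
    move=> w hw; symmetry; apply: fE.
    have -> : w - (x +i* y) = (w - v) + (v - (x +i* y)) by ring.
    by apply: (le_lt_trans (normc_triangle _ _)); move: hw; rewrite /rho; lra.
  by apply: cdiffM; [exact: dN|apply: cdiffV; [exact: K0|exact: dK]].
have h0 : normc ((x +i* y) - (x +i* y)) < s / 2 by rewrite subrr normc0.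
suff [e he] : hol (fun v => N v * (- K1 v * (K v ^+ 2)^-1) + N1 v * (K v)^-1) (x +i* y).
  by exists e; apply: (cdiff_local s20 f'E he).
have [hN hN1 hK hK1] : [/\ hol N (x +i* y), hol N1 (x +i* y), hol K (x +i* y) & hol K1 (x +i* y)].
  by split; eexists; [exact: dN|exact: dN1|exact: dK|exact: dK1].
have holV g z : g z != 0 -> hol g z -> hol (fun v => (g v)^-1) z.
  by move=> gz [e he]; eexists; exact: cdiffV gz he.
apply: holD; apply: holM => //; last by apply: holV => //; exact: K0.
apply: holM.
  by have [e he] := hK1; eexists; exact: cdiffN he.
by apply: holV; [rewrite expf_neq0// K0|apply: holM].
Qed.

Lemma discP (f : C -> C) : analytic_disc f <-> forall z, normc z < 1 -> hol f z.
Proof.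
split=> h z hz; first by exists (cderiv 1 f z); apply: derivable_cdiff; exact: h.
by have [e] := h z hz; exact: cdiff_derivable.
Qed.

Lemma analytic_cderiv f : analytic_disc f -> analytic_disc (cderiv 1 f).
Proof.
move=> /discP fh; apply/discP => z hz.
apply: (@hol_cderiv f z (1 - normc z)); first by rewrite subr_gt0.
move=> v hv; apply: fh.
by have := normc_triangle (v - z) z; rewrite subrK; lra.
Qed.

Lemma analytic_cdiff f n z : analytic_disc f -> normc z < 1 ->
  cdiff (cderiv n f) z (cderiv n.+1 f z).
Proof.
move=> fa hz; apply: derivable_cdiff.
suff : analytic_disc (cderiv n f) by apply.
by elim: n => [//|n IH]; rewrite cderivS; exact: analytic_cderiv.
Qed.

End regularity.

(** * Area estimates *)

Section planar.
Variable R : realType.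
Local Notation C := R[i].
Local Notation mu := (@lebesgue_measure R).
Implicit Types (p q : R * R) (z w : C) (a b c d r x y : R).

Definition open2 (U : set (R * R)) := forall p, U p -> exists2 r : R, 0 < r &
  forall q, `|q.1 - p.1| < r -> `|q.2 - p.2| < r -> U q.

(** An open set is the union of the squares with rational centres and radii
    [1 / n] that it contains. *)
Lemma open2_measurable (U : set (R * R)) : open2 U -> measurable U.
Proof.
move=> Uo.
pose B (k : rat * rat * nat) : set (R * R) :=
  `](ratr k.1.1 : R) - k.2.+1%:R^-1, ratr k.1.1 + k.2.+1%:R^-1[ `*`
  `](ratr k.1.2 : R) - k.2.+1%:R^-1, ratr k.1.2 + k.2.+1%:R^-1[.
pose F k := if `[< B k `<=` U >] then B k else set0.
have -> : U = \bigcup_k F k.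
  apply/seteqP; split=> [p Up|p [k _]]; last by rewrite /F; case: asboolP => // h /h.
  have [r r0 Hr] := Uo p Up.
  have [n hn] : exists n : nat, n.+1%:R^-1 < r / 2.
    have r20 : 0 < r / 2 by rewrite divr_gt0.
    exists (Num.truncn (r / 2)^-1); rewrite invf_plt ?posrE//.
    exact: truncnS_gt.
  have n0 : 0 < n.+1%:R^-1 :> R by rewrite invr_gt0.
  have [e eE] : exists e : R, e = n.+1%:R^-1 by exists n.+1%:R^-1.
  rewrite -eE in hn n0.
  have [q1 h1] := @rat_in_itvoo R (p.1 - e) (p.1 + e) ltac:(lra).
  have [q2 h2] := @rat_in_itvoo R (p.2 - e) (p.2 + e) ltac:(lra).
  move: h1 h2; rewrite !in_itv /= => /andP[h11 h12] /andP[h21 h22].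
  exists (q1, q2, n) => //; rewrite /F; case: asboolP => [_|[]].
    by split; rewrite /= -eE in_itv /=; apply/andP; split; lra.
  move=> q [/=]; rewrite -eE !in_itv /= => /andP[k1 k2] /andP[k3 k4].
  by apply: Hr; rewrite ltr_norml; apply/andP; split; lra.
apply: countable_bigcupT_measurable => // k; rewrite /F; case: asboolP => // _.
by apply: measurableX; exact: measurable_itv.
Qed.

Definition cart p : C := p.1 +i* p.2.

Definition discp : set (R * R) := [set p | disc (cart p)].

Definition contR (H : C -> R) z := forall eps : R, 0 < eps ->
  exists2 del : R, 0 < del & forall w, normc (w - z) < del -> `|H w - H z| < eps.

Lemma cart_near (del : R) p q : `|q.1 - p.1| < del / 2 -> `|q.2 - p.2| < del / 2 ->
  normc (cart q - cart p) < del.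
Proof. by move=> h1 h2; apply: (le_lt_trans (normc_le1 _)) => /=; lra. Qed.

Lemma contR_measurable (U : set (R * R)) (H : C -> R) : open2 U ->
  (forall p, U p -> contR H (cart p)) -> measurable_fun U (H \o cart).
Proof.
move=> Uo Hc mU; apply: (measurability _ (RGenOInfty.measurableE R)) => //.
move=> _ [_ [x ->] <-]; apply: open2_measurable => p [Up /=].
rewrite in_itv /= andbT => hp.
have [r r0 Hr] := Uo p Up.
have [del d0 Hd] := Hc p Up (H (cart p) - x) ltac:(by rewrite subr_gt0).
exists (Num.min r (del / 2)); first by rewrite lt_min r0 divr_gt0.
move=> q; rewrite !lt_min => /andP[q1 q2] /andP[q3 q4]; split; first exact: Hr.
rewrite /= in_itv /= andbT.
have := Hd _ (cart_near q2 q4); rewrite ltr_norml; lra.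
Qed.

Lemma discp_open : open2 discp.
Proof.
move=> p hp; exists ((1 - normc (cart p)) / 2); first by rewrite divr_gt0// subr_gt0.
move=> q h1 h2; change (is_true (normc (cart q) < 1)).
have := cart_near h1 h2; have := normc_triangle (cart q - cart p) (cart p).
rewrite subrK; lra.
Qed.

Lemma discp_measurable : measurable discp.
Proof. exact: open2_measurable discp_open. Qed.

Local Open Scope ereal_scope.

Lemma strip_le (G : R -> \bar R) (c1 c2 v : R) : (c1 <= c2)%R ->
  measurable_fun setT G -> (forall y, 0 <= G y) ->
  (forall y, (c1 <= y <= c2)%R -> v%:E <= G y) -> (v * (c2 - c1))%:E <= \int[mu]_y G y.
Proof.
move=> c12 mG G0 vG; have [v0|v0] := leP v 0%R.
  apply: (@le_trans _ _ 0); first by rewrite lee_fin mulr_le0_ge0// subr_ge0.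
  exact: integral_ge0.
have -> : (v * (c2 - c1))%:E = \int[mu]_(y in `[c1, c2]) (cst v%:E y).
  rewrite integral_cst//= lebesgue_measure_itv /= lte_fin.
  have [|h] := ltP c1 c2; first by rewrite -EFinB -EFinM.
  by rewrite (le_anti (introT andP (conj c12 h))) subrr mulr0 mule0.
rewrite integral_mkcond; apply: ge0_le_integral => //.
- by move=> y _; rewrite erestrict_ge0// => t _; rewrite lee_fin ltW.
- by apply/(measurable_restrictT _ _).1 => //; exact: measurable_cst.
move=> y _; rewrite patchE; case: ifPn => // hy.
by apply: vG; move: hy; rewrite inE /= in_itv.
Qed.

(** Tonelli's theorem; the position of a side of a contour will be averaged in
    this way. *)
Lemma avg_h (F : R * R -> R) (x1 x2 y1 y2 c1 c2 v : R) :
  (forall p, 0 <= F p)%R -> measurable_fun (`[x1, x2] `*` `[y1, y2]) F ->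
  (y1 <= c1)%R -> (c1 <= c2)%R -> (c2 <= y2)%R ->
  (forall c, c1 <= c <= c2 -> rcont x1 x2 (fun t => F (t, c)))%R ->
  (forall c, c1 <= c <= c2 -> v <= rint x1 x2 (fun t => F (t, c)))%R ->
  (v * (c2 - c1))%:E <=
    \int[(mu \x mu)%E]_(p in `[x1, x2] `*` `[y1, y2]) (F p)%:E.
Proof.
move=> F0 mF y1c c12 c2y Fc vF; set S := _ `*` _.
have mS : measurable S by exact: measurableX.
rewrite integral_mkcond fubini_tonelli2//; last 2 first.
- by apply/(measurable_restrictT _ _).1 => //; exact/measurable_EFinP.
- by move=> p; rewrite erestrict_ge0// => q _; rewrite lee_fin.
apply: strip_le => //.
- apply: measurable_fun_fubini_tonelli_G => //.
    by apply/(measurable_restrictT _ _).1 => //; exact/measurable_EFinP.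
  by move=> p; rewrite erestrict_ge0// => q _; rewrite lee_fin.
- by move=> y; apply: integral_ge0 => x _; rewrite erestrict_ge0// => q _; rewrite lee_fin.
move=> y hy'.
have yS : (y1 <= y <= y2)%R.
  by move: hy' => /andP[h1 h2]; rewrite (le_trans y1c h1) (le_trans h2 c2y).
rewrite /fubini_G.
have -> : \int[mu]_x (((fun p => (F p)%:E) \_ S) (x, y)) = \int[mu]_(x in `[x1, x2]) (F (x, y))%:E.
  rewrite [RHS]integral_mkcond; apply: eq_integral => x _; rewrite !patchE.
  congr (if _ then _ else _); apply/idP/idP; rewrite !inE /S /= !in_itv /=.
    by move=> [].
  by move=> ?; split.
have := vF y hy'; rewrite -lee_fin => /le_trans; apply.
rewrite /rint /Rintegral fineK//.
by apply: integrable_fin_num => //; exact: (rcont_itg (Fc y hy')).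
Qed.

Lemma avg_v (F : R * R -> R) (x1 x2 y1 y2 c1 c2 v : R) :
  (forall p, 0 <= F p)%R -> measurable_fun (`[x1, x2] `*` `[y1, y2]) F ->
  (x1 <= c1)%R -> (c1 <= c2)%R -> (c2 <= x2)%R ->
  (forall c, c1 <= c <= c2 -> rcont y1 y2 (fun t => F (c, t)))%R ->
  (forall c, c1 <= c <= c2 -> v <= rint y1 y2 (fun t => F (c, t)))%R ->
  (v * (c2 - c1))%:E <=
    \int[(mu \x mu)%E]_(p in `[x1, x2] `*` `[y1, y2]) (F p)%:E.
Proof.
move=> F0 mF y1c c12 c2y Fc vF; set S := _ `*` _.
have mS : measurable S by exact: measurableX.
rewrite integral_mkcond fubini_tonelli1//; last 2 first.
- by apply/(measurable_restrictT _ _).1 => //; exact/measurable_EFinP.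
- by move=> p; rewrite erestrict_ge0// => q _; rewrite lee_fin.
apply: strip_le => //.
- apply: measurable_fun_fubini_tonelli_F => //.
    by apply/(measurable_restrictT _ _).1 => //; exact/measurable_EFinP.
  by move=> p; rewrite erestrict_ge0// => q _; rewrite lee_fin.
- by move=> y; apply: integral_ge0 => x _; rewrite erestrict_ge0// => q _; rewrite lee_fin.
move=> y hy'.
have yS : (x1 <= y <= x2)%R.
  by move: hy' => /andP[h1 h2]; rewrite (le_trans y1c h1) (le_trans h2 c2y).
rewrite /fubini_F.
have -> : \int[mu]_x (((fun p => (F p)%:E) \_ S) (y, x)) = \int[mu]_(x in `[y1, y2]) (F (y, x))%:E.
  rewrite [RHS]integral_mkcond; apply: eq_integral => x _; rewrite !patchE.
  congr (if _ then _ else _); apply/idP/idP; rewrite !inE /S /= !in_itv /=.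
    by move=> [].
  by move=> ?; split.
have := vF y hy'; rewrite -lee_fin => /le_trans; apply.
rewrite /rint /Rintegral fineK//.
by apply: integrable_fin_num => //; exact: (rcont_itg (Fc y hy')).
Qed.

End planar.

Section submean.
Variable R : realType.
Local Notation C := R[i].
Local Notation mu := (@lebesgue_measure R).
Implicit Types (p q : R * R) (z w : C) (a b c d r x y : R) (f : C -> C) (H : C -> R).

Lemma contC_comp f (g : C -> C) z : contC g z -> contC f (g z) -> contC (f \o g) z.
Proof.
move=> hg hf e e0; have [d d0 hd] := hf e e0; have [d' d'0 hd'] := hg d d0.
by exists d' => // w /hd'/hd.
Qed.

Lemma contCV f z : f z != 0 -> contC f z -> contC (fun v => (f v)^-1) z.
Proof.
move=> fz fc; apply: (@contC_comp (fun v => v^-1)) => //; apply: hol_contC.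
by eexists; apply: (@cdiffV _ id); [|exact: cdiff_id].
Qed.

Lemma contRP H z : contR H z <-> contC (fun v => (H v)%:C) z.
Proof.
split=> h e e0; have [d d0 hd] := h e e0; exists d => // w /hd.
  by rewrite -cRB normcR.
by rewrite -cRB normcR.
Qed.

Lemma contR_normc f z : contC f z -> contR (fun v => normc (f v)) z.
Proof.
move=> h e e0; have [d d0 hd] := h e e0; exists d => // w /hd; apply: le_lt_trans.
rewrite ler_norml; have := ler_normcB (f w) (f z); have := ler_normcB (f z) (f w).
rewrite normcB; lra.
Qed.

Lemma cRM (s t : R) : ((s * t)%:C : C) = s%:C * t%:C.
Proof. by apply/eqP; rewrite eq_complex /= !mulr0 !mul0r subr0 addr0 !eqxx. Qed.

Lemma cRV (s : R) : ((s^-1)%:C : C) = s%:C^-1.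
Proof.
have [->|s0] := eqVneq s 0; first by rewrite invr0 invr0.
apply: (@mulfI _ s%:C); first by rewrite eq_complex /= negb_and s0.
rewrite -cRM !mulfV// eq_complex /= negb_and s0//.
Qed.

Lemma contRM H H' z : contR H z -> contR H' z -> contR (fun v => H v * H' v) z.
Proof.
move=> /contRP h /contRP h'; apply/contRP.
rewrite (_ : (fun _ => _) = fun v => (H v)%:C * (H' v)%:C); first exact: contCM.
by apply/funext => v; rewrite cRM.
Qed.

Lemma contRV H z : H z != 0 -> contR H z -> contR (fun v => (H v)^-1) z.
Proof.
move=> Hz /contRP h; apply/contRP.
rewrite (_ : (fun _ => _) = fun v => (H v)%:C^-1).
  by apply: contCV => //; rewrite eq_complex /= negb_and Hz.
by apply/funext => v; rewrite cRV.
Qed.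

Lemma contR_cst c z : contR (fun=> c) z.
Proof. by move=> e e0; exists 1 => // w _; rewrite subrr normr0. Qed.

Lemma contR_onem H z : contR H z -> contR (fun v => 1 - H v) z.
Proof.
move=> h e e0; have [d d0 hd] := h e e0; exists d => // w /hd.
by have -> : 1 - H w - (1 - H z) = - (H w - H z) by [ring]; rewrite normrN.
Qed.

(** In Cauchy's formula the kernel is at most [2 / r] on the contour.  The
    integrals over the sides are enlarged to full chords of the square of side
    [2 r], so that the positions [a], [b], [c], [d] of the sides become
    independent of each other. *)
Lemma rect_mean f x y r a b c d : 0 < r ->
  holR f (x - r) (x + r) (y - r) (y + r) ->
  x - r <= a <= x - r / 2 -> x + r / 2 <= b <= x + r ->
  y - r <= c <= y - r / 2 -> y + r / 2 <= d <= y + r ->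
  r / 4 * normc (f (x +i* y)) <=
     rint (x - r) (x + r) (fun t => normc (f (t +i* c))) +
     rint (x - r) (x + r) (fun t => normc (f (t +i* d))) +
     rint (y - r) (y + r) (fun t => normc (f (a +i* t))) +
     rint (y - r) (y + r) (fun t => normc (f (b +i* t))).
Proof.
move=> r0 fh /andP[a1 a2] /andP[b1 b2] /andP[c1 c2] /andP[d1 d2].
pose w := x +i* y.
have fh' : holR f a b c d by exact: holR_sub fh.
have ab : a <= b by lra.
have cd : c <= d by lra.
have hw1 : a < re w < b by rewrite /=; apply/andP; split; lra.
have hw2 : c < im w < d by rewrite /=; apply/andP; split; lra.
have cI : contB (fun z => (z - w)^-1) a b c d.
  by move=> z hz; apply/hol_contC/hol_inv_shift/(rect_bd_neq hw1 hw2 hz).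
have cf : contB f a b c d := holR_contB ab cd fh'.
have key : (forall z, rect_bd a b c d z -> normc (z - w) ^+ 2 <= 2 * r ^+ 2) ->
    r / 2 / (2 * r ^+ 2) * (2 * ((b - a) + (d - c))) <= im (oint (fun z => (z - w)^-1) a b c d).
  by apply: im_kernel_ge => /=; lra.
have far z : rect_bd a b c d z -> normc (z - w) ^+ 2 <= 2 * r ^+ 2.
  have K s t : `|s - x| <= r -> `|t - y| <= r -> normc ((s +i* t) - w) ^+ 2 <= 2 * r ^+ 2.
    move=> h1 h2; rewrite normc_sqr /= -[(s - x) ^+ 2]real_normK ?num_real//.
    rewrite -[(t - y) ^+ 2]real_normK ?num_real// mulr_natl mulr2n.
    by apply: lerD; rewrite lerXn2r ?nnegrE// ltW.
  by case=> t /andP[t1 t2]; apply: K; rewrite ler_norml; apply/andP; split; lra.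
have {}key := key far.
have near z : rect_bd a b c d z -> (normc (z - w))^-1 <= 2 / r.
  move=> hz; rewrite -[2 / r]invf_div lef_pV2 ?posrE ?divr_gt0//; last first.
    by rewrite normc_gt0 subr_eq0; exact: rect_bd_neq hz.
  case: hz => t /andP[t1 t2].
  - apply: le_trans (normc_Im _) => /=; rewrite ler_normr; apply/orP; right; lra.
  - apply: le_trans (normc_Im _) => /=; rewrite ler_normr; apply/orP; left; lra.
  - apply: le_trans (normc_Re _) => /=; rewrite ler_normr; apply/orP; right; lra.
  - apply: le_trans (normc_Re _) => /=; rewrite ler_normr; apply/orP; left; lra.
have kge : 1 <= normc (oint (fun z => (z - w)^-1) a b c d).
  apply: le_trans (normc_Im _); apply: le_trans (ler_norm _); apply: le_trans key.
  have -> : r / 2 / (2 * r ^+ 2) = (4 * r)^-1 by field; lra.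
  by rewrite mulrC ler_pdivlMr; lra.
have cN : contB (fun z => f z * (z - w)^-1) a b c d.
  by move=> z hz; apply: contCM; [exact: cf|exact: cI].
have [n1 n2 n3 n4] := contB_edges cN.
have fE := cauchy_formula hw1 hw2 fh'.
have fc s t : x - r <= s <= x + r -> y - r <= t <= y + r -> contC f (s +i* t).
  by move=> h1 h2; apply/hol_contC/fh.
have hor s : y - r <= s <= y + r -> rcont (x - r) (x + r) (fun t => normc (f (t +i* s))).
  by move=> hs; apply/rcont_normc/ccont_hor => t ht; exact: fc.
have ver s : x - r <= s <= x + r -> rcont (y - r) (y + r) (fun t => normc (f (s +i* t))).
  by move=> hs; apply/rcont_normc/ccont_ver => t ht; exact: fc.
have sub u1 u2 v1 v2 (k l : R -> R) : u1 <= v1 -> v1 <= v2 -> v2 <= u2 -> rcont u1 u2 l ->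
    rcont v1 v2 k -> (forall t, u1 <= t <= u2 -> 0 <= l t) ->
    (forall t, v1 <= t <= v2 -> k t <= (2 / r) * l t) -> rint v1 v2 k <= (2 / r) * rint u1 u2 l.
  move=> h1 h2 h3 lc kc l0 kl.
  have lc1 : rcont v1 u2 l by exact: rcont_sub lc.
  have lc2 : rcont v1 v2 l by exact: rcont_sub lc.
  rewrite (rint_split h1 (le_trans h2 h3) lc) (rint_split h2 h3 lc1).
  have p1 : 0 <= rint u1 v1 l.
    rewrite -[0](mul0r (v1 - u1)); apply: rint_ge => //.
      by apply: rcont_sub lc => //; exact: le_trans h3.
    by move=> t /andP[t1 t2]; apply: l0; rewrite t1; lra.
  have p2 : 0 <= rint v2 u2 l.
    rewrite -[0](mul0r (u2 - v2)); apply: rint_ge => //.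
      by apply: rcont_sub lc => //; exact: le_trans h2.
    by move=> t /andP[t1 t2]; apply: l0; rewrite t2; lra.
  apply: (@le_trans _ _ ((2 / r) * rint v1 v2 l)).
    by rewrite -rintZ//; apply: le_rint => //; apply: rcontM => //; exact: rcont_cst.
  by rewrite ler_pM2l ?divr_gt0//; lra.
have bnd z : rect_bd a b c d z -> normc (f z * (z - w)^-1) <= 2 / r * normc (f z).
  by move=> hz; rewrite normcME normcVE mulrC ler_wpM2r ?normc_ge0// near.
have xr : x - r <= a <= x + r /\ x - r <= b <= x + r by clear -r0 a1 a2 b1 b2; split; apply/andP; split; lra.
have yr : y - r <= c <= y + r /\ y - r <= d <= y + r by clear -r0 c1 c2 d1 d2; split; apply/andP; split; lra.
have e1 := @sub (x - r) (x + r) a b _ _ a1 ab b2 (hor c yr.1) (rcont_normc n1)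
  (fun t _ => normc_ge0 _) (fun t ht => bnd _ (@RectB _ a b c d t ht)).
have e2 := @sub (x - r) (x + r) a b _ _ a1 ab b2 (hor d yr.2) (rcont_normc n2)
  (fun t _ => normc_ge0 _) (fun t ht => bnd _ (@RectT _ a b c d t ht)).
have e3 := @sub (y - r) (y + r) c d _ _ c1 cd d2 (ver b xr.2) (rcont_normc n3)
  (fun t _ => normc_ge0 _) (fun t ht => bnd _ (@RectR _ a b c d t ht)).
have e4 := @sub (y - r) (y + r) c d _ _ c1 cd d2 (ver a xr.1) (rcont_normc n4)
  (fun t _ => normc_ge0 _) (fun t ht => bnd _ (@RectL _ a b c d t ht)).
have : normc (f w) <= normc (oint (fun z => f z * (z - w)^-1) a b c d).
  by rewrite fE normcME ler_peMr ?normc_ge0.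
rewrite /oint => H.
have {}H := le_trans H (normc_triangle _ _).
rewrite normcME normci mul1r in H.
have {}H := le_trans H (lerD (normc_triangleB _ _) (normc_triangleB _ _)).
have {}H := le_trans H (lerD (lerD (normc_cint n1) (normc_cint n2)) (lerD (normc_cint n3) (normc_cint n4))).
rewrite -/w.
move: e1 e2 e3 e4 H.
set u1 := rint a b _; set u2 := rint a b _; set u3 := rint c d _; set u4 := rint c d _.
set v1 := rint _ _ _; set v2 := rint _ _ _; set v3 := rint _ _ _; set v4 := rint _ _ _.
move=> e1 e2 e3 e4 H.
have : normc (f w) <= 4 / r * (v1 + v2 + v3 + v4).
  have E : 4 / r = 2 * (2 / r) by field; rewrite gt_eqF.
  rewrite E; lra.
move=> {}H; have : r / 4 * normc (f w) <= r / 4 * (4 / r * (v1 + v2 + v3 + v4)).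
  by rewrite ler_pM2l// divr_gt0.
have -> : r / 4 * (4 / r * (v1 + v2 + v3 + v4)) = v1 + v2 + v3 + v4 by field; rewrite gt_eqF.
lra.
Qed.

End submean.

Section submean_area.
Variable R : realType.
Local Notation C := R[i].
Local Notation mu := (@lebesgue_measure R).
Implicit Types (p q : R * R) (z w : C) (a b c d r x y : R) (f : C -> C) (H : C -> R).

(** Averaging the positions of the four sides of the contour turns Cauchy's
    formula into an area estimate. *)
Lemma submean f x y r : 0 < r -> holR f (x - r) (x + r) (y - r) (y + r) ->
  measurable_fun (`[x - r, x + r] `*` `[y - r, y + r]) (fun p => normc (f (cart p))) ->
  ((r ^+ 2 / 32 * normc (f (x +i* y)))%R%:E <=
   \int[(mu \x mu)%E]_(p in `[(x - r)%R, (x + r)%R] `*` `[(y - r)%R, (y + r)%R])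
     (normc (f (cart p)))%:E)%E.
Proof.
move=> r0 fh mf; set I := (\int[_]_(p in _) _)%E.
have I0 : (0 <= I)%E by apply: integral_ge0 => p _; rewrite lee_fin normc_ge0.
have Av (v c1 c2 : R) : c2 - c1 = r / 2 -> y - r <= c1 -> c2 <= y + r ->
    (forall c, c1 <= c <= c2 -> v <= rint (x - r) (x + r) (fun t => normc (f (t +i* c)))) ->
    ((v * (r / 2))%:E <= I)%E.
  move=> ce h1 h2 hv; rewrite -ce; apply: (@avg_h R (fun p => normc (f (cart p)))) => //; try lra.
    by move=> p; exact: normc_ge0.
  move=> c /andP[h3 h4]; apply/rcont_normc/ccont_hor => t ht.
  by apply/hol_contC/fh => //; apply/andP; split; lra.
have Av' (v c1 c2 : R) : c2 - c1 = r / 2 -> x - r <= c1 -> c2 <= x + r ->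
    (forall c, c1 <= c <= c2 -> v <= rint (y - r) (y + r) (fun t => normc (f (c +i* t)))) ->
    ((v * (r / 2))%:E <= I)%E.
  move=> ce h1 h2 hv; rewrite -ce; apply: (@avg_v R (fun p => normc (f (cart p)))) => //; try lra.
    by move=> p; exact: normc_ge0.
  move=> c /andP[h3 h4]; apply/rcont_normc/ccont_ver => t ht.
  by apply/hol_contC/fh => //; apply/andP; split; lra.
case E : I I0 Av Av' => [i| |] // I0 Av Av'; last by rewrite leey.
clear E I I0.
pose J := i / (r / 2).
have toJ v : ((v * (r / 2))%:E <= i%:E)%E -> v <= J.
  by rewrite lee_fin /J ler_pdivlMr// divr_gt0.
set L := normc _.
have M := rect_mean r0 fh; rewrite -/L in M.
rewrite lee_fin.
suff : r / 4 * L - J - J - J <= J.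
  have -> : J = 2 * i / r by rewrite /J; field; lra.
  move=> h; have h' : r / 4 * L <= 8 * i / r by lra.
  have : r * (r / 4 * L) <= r * (8 * i / r) by rewrite ler_pM2l.
  have -> : r * (8 * i / r) = 8 * i by field; lra.
  lra.
apply/toJ/(Av _ (y - r) (y - r / 2)); try lra.
move=> c hc.
suff : r / 4 * L - J - J - rint (x - r) (x + r) (fun t => normc (f (t +i* c))) <= J by lra.
apply/toJ/(Av _ (y + r / 2) (y + r)); try lra.
move=> d hd.
suff : r / 4 * L - J - rint (x - r) (x + r) (fun t => normc (f (t +i* c)))
   - rint (x - r) (x + r) (fun t => normc (f (t +i* d))) <= J by lra.
apply/toJ/(Av' _ (x - r) (x - r / 2)); try lra.
move=> a ha.
suff : r / 4 * L - rint (x - r) (x + r) (fun t => normc (f (t +i* c)))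
   - rint (x - r) (x + r) (fun t => normc (f (t +i* d)))
   - rint (y - r) (y + r) (fun t => normc (f (a +i* t))) <= J by lra.
apply/toJ/(Av' _ (x + r / 2) (x + r)); try lra.
move=> b hb.
have := M a b c d ha hb hc hd; lra.
Qed.

End submean_area.

(** * Carleson's condition on sample points *)

Section sampling.
Variable R : realType.
Local Notation C := R[i].
Local Notation mu := (@lebesgue_measure R).
Implicit Types (p q : R * R) (z w a : C) (f A : C -> C) (H : C -> R).

Lemma phi_identity a z :
  normc (1 - a^* * z) ^+ 2 - normc (a - z) ^+ 2 = (1 - normc a ^+ 2) * (1 - normc z ^+ 2).
Proof. by rewrite !normc_sqr; case: a => ? ?; case: z => ? ? /=; ring. Qed.

Lemma onem_sqr_gt0 z : disc z -> 0 < 1 - normc z ^+ 2.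
Proof. by rewrite /disc /= => h; rewrite subr_gt0 expr_lt1 ?normc_ge0. Qed.

Lemma den_ge a z : disc a -> disc z -> 1 - normc z <= normc (1 - a^* * z).
Proof.
rewrite /disc /= => ha hz; have := ler_normcB 1 (a^* * z).
rewrite normc1 normcME normcJE; have := normc_ge0 z; have := normc_ge0 a; nra.
Qed.

Lemma den_gt0 a z : disc a -> disc z -> 0 < normc (1 - a^* * z).
Proof. by move=> ha hz; apply: lt_le_trans (den_ge ha hz); rewrite subr_gt0. Qed.

Lemma onem_phi a z : disc a -> disc z -> 1 - normc (phi a z) ^+ 2 =
  (1 - normc a ^+ 2) * (1 - normc z ^+ 2) / normc (1 - a^* * z) ^+ 2.
Proof.
move=> ha hz; rewrite -phi_identity /phi normc_div expr_div_n.
by field; rewrite gt_eqF// den_gt0.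
Qed.

Lemma onem_phi_gt0 a z : disc a -> disc z -> 0 < 1 - normc (phi a z) ^+ 2.
Proof.
move=> ha hz; rewrite onem_phi// divr_gt0 ?exprn_gt0 ?den_gt0//.
by rewrite mulr_gt0// onem_sqr_gt0.
Qed.

(** On the disc of radius a quarter of the distance to the unit circle all
    the weights are constant up to a factor. *)
Lemma near_onem z w : disc z -> normc (w - z) < (1 - normc z) / 4 ->
  [/\ disc w, 3 / 8 * (1 - normc z ^+ 2) <= 1 - normc w ^+ 2 &
      1 - normc w ^+ 2 <= 5 / 2 * (1 - normc z ^+ 2)].
Proof.
rewrite /disc /= => hz hw.
have h1 := ler_normcB w z; have h2 := ler_normcB z w.
rewrite normcB in h2; have z0 := normc_ge0 z; have w0 := normc_ge0 w.
set u := normc z in hz hw h1 h2 z0 *; set v := normc w in h1 h2 w0 *.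
have v1 : v < 1 by lra.
split => //.
  have -> : 1 - v ^+ 2 = (1 - v) * (1 + v) by ring.
  have -> : 1 - u ^+ 2 = (1 - u) * (1 + u) by ring.
  have e1 : 3 / 4 * (1 - u) <= 1 - v by lra.
  have e2 : (1 + u) / 2 <= 1 + v by lra.
  have : 3 / 4 * (1 - u) * ((1 + u) / 2) <= (1 - v) * (1 + v) by apply: ler_pM => //; lra.
  lra.
have -> : 1 - v ^+ 2 = (1 - v) * (1 + v) by ring.
have -> : 1 - u ^+ 2 = (1 - u) * (1 + u) by ring.
have e1 : 1 - v <= 5 / 4 * (1 - u) by lra.
have e2 : 1 + v <= 2 * (1 + u) by lra.
have : (1 - v) * (1 + v) <= 5 / 4 * (1 - u) * (2 * (1 + u)) by apply: ler_pM => //; lra.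
lra.
Qed.

Lemma near_onem_phi a z w : disc a -> disc z -> normc (w - z) < (1 - normc z) / 4 ->
  1 - normc (phi a z) ^+ 2 <= 5 * (1 - normc (phi a w) ^+ 2).
Proof.
move=> ha hz hw; have [dw h1 _] := near_onem hz hw.
rewrite !onem_phi//; have ga := onem_sqr_gt0 ha; have gz := onem_sqr_gt0 hz.
have dz := den_gt0 ha hz; have dw0 := den_gt0 ha dw.
have de := den_ge ha hz.
have h2 : normc (1 - a^* * w) <= 5 / 4 * normc (1 - a^* * z).
  have -> : 1 - a^* * w = (1 - a^* * z) - a^* * (w - z) by ring.
  apply: (le_trans (normc_triangleB _ _)); rewrite normcME normcJE.
  have : normc a * normc (w - z) <= 1 * ((1 - normc z) / 4).
    by apply: ler_pM; rewrite ?normc_ge0// ltW.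
  lra.
set X := normc (1 - a^* * z) in dz h2 *; set Y := normc (1 - a^* * w) in dw0 h2 *.
rewrite ler_pdivrMr ?exprn_gt0// [X in _ <= X]mulrC !mulrA ler_pdivlMr ?exprn_gt0//.
have h3 : Y ^+ 2 <= 25 / 16 * X ^+ 2.
  have -> : 25 / 16 * X ^+ 2 = (5 / 4 * X) ^+ 2 by field.
  by rewrite lerXn2r// nnegrE; lra.
set P := 1 - normc a ^+ 2 in ga *; set u := 1 - normc z ^+ 2 in gz h1 *; set v := 1 - normc w ^+ 2 in h1 *.
have X2 : 0 <= X ^+ 2 by exact: sqr_ge0.
have : P * (u * Y ^+ 2) <= P * (5 * v * X ^+ 2).
  rewrite ler_pM2l//.
  apply: (@le_trans _ _ (u * (25 / 16 * X ^+ 2))); first by rewrite ler_pM2l.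
  have : 25 / 16 * u * X ^+ 2 <= 5 * v * X ^+ 2 by rewrite ler_wpM2r//; lra.
  lra.
lra.
Qed.

Definition admissible_exponent (k : int) := k \in [:: 1; 0; -1].

Lemma near_weight (k : int) z w : admissible_exponent k -> disc z -> normc (w - z) < (1 - normc z) / 4 ->
  (1 - normc z ^+ 2) ^ k <= 3 * (1 - normc w ^+ 2) ^ k.
Proof.
move=> hk hz hw; have [dw h1 h2] := near_onem hz hw.
have gz := onem_sqr_gt0 hz; have gw := onem_sqr_gt0 dw.
move: hk; rewrite /admissible_exponent !inE => /or3P[] /eqP ->.
- by rewrite !expr1z; lra.
- by rewrite !expr0z; lra.
- rewrite !exprN1 -[X in X <= _]invrK -[3 * _]invrK lef_pV2 ?posrE ?invr_gt0 ?mulr_gt0 ?invr_gt0//.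
  by rewrite invfM !invrK; lra.
Qed.

Definition density (k : int) A a z : R :=
  normc (A z) * (1 - normc z ^+ 2) ^ k * (1 - normc (phi a z) ^+ 2).

Lemma density_ge0 k A a z : disc a -> disc z -> 0 <= density k A a z.
Proof.
move=> ha hz; rewrite /density !mulr_ge0 ?normc_ge0//.
  by rewrite exprz_ge0// ltW// onem_sqr_gt0.
by rewrite ltW// onem_phi_gt0.
Qed.

Lemma density_cont k A a z : admissible_exponent k -> analytic_disc A -> disc a -> disc z ->
  contR (density k A a) z.
Proof.
move=> hk /discP hA ha hz.
have sq (g : C -> C) : contC g z -> contR (fun v => 1 - normc (g v) ^+ 2) z.
  move=> gc; apply: contR_onem.
  rewrite (_ : (fun _ => _) = fun v => normc (g v) * normc (g v)); last first.
    by apply/funext => v; rewrite expr2.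
  by apply: contRM; exact: contR_normc.
apply: contRM; first apply: contRM.
- by apply: contR_normc; apply/hol_contC/hA.
- have h := sq id (contC_id z).
  move: hk; rewrite /admissible_exponent !inE => /or3P[] /eqP ->.
  + exact: h.
  + exact: contR_cst.
  + by apply: contRV => //; rewrite gt_eqF// onem_sqr_gt0.
- apply: sq; apply: contCM.
    by apply/hol_contC/holB; [exact: hol_cst|exact: hol_id].
  apply: contCV; first by rewrite -normc_gt0 den_gt0.
  apply/hol_contC/holB; first exact: hol_cst.
  by apply: holM; [exact: hol_cst|exact: hol_id].
Qed.

Lemma admissible_exponentD2 k (t : R) : admissible_exponent k -> 0 < t -> t ^ (k + 2) = t ^ k * t ^+ 2.
Proof. by move=> hk t0; rewrite expfzDr ?gt_eqF. Qed.

Definition samplebox z : set (R * R) :=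
  let r := (1 - normc z) / 10 in
  `[re z - r, re z + r] `*` `[im z - r, im z + r].

Lemma samplebox_near z p : disc z -> samplebox z p ->
  normc (cart p - z) < (1 - normc z) / 4.
Proof.
case: z => x y; rewrite /disc /samplebox /= !in_itv /=; set r := Num.sqrt _ => r1.
move=> [/andP[h1 h2] /andP[h3 h4]].
have := normc_le1 (cart p - (x +i* y)) => /=.
have : `|p.1 - x| <= (1 - r) / 10 by rewrite ler_norml; apply/andP; split; lra.
have : `|p.2 - y| <= (1 - r) / 10 by rewrite ler_norml; apply/andP; split; lra.
lra.
Qed.

(** [32] comes from [submean], [400] from [1 - |z|^2 <= 20 r], and [15] from the
    variation of the two weights over the square. *)
Lemma sample_le k A a z : admissible_exponent k -> analytic_disc A -> disc a -> disc z ->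
  ((normc (A z) * (1 - normc z ^+ 2) ^ (k + 2) * (1 - normc (phi a z) ^+ 2))%:E <=
   (128 * 100 * 15)%R%:E *
   \int[(mu \x mu)%E]_(p in samplebox z) (density k A a (cart p))%:E)%E.
Proof.
move=> hk hA ha hz; set r := (1 - normc z) / 10.
have r0 : 0 < r by rewrite divr_gt0// subr_gt0.
have subD p : samplebox z p -> disc (cart p).
  by move=> hp; have [] := near_onem hz (samplebox_near hz hp).
have hA' := (discP A).1 hA.
have hR : holR A (re z - r) (re z + r) (im z - r) (im z + r).
  move=> x y hx hy; apply: hA'; apply: (subD (x, y)).
  by rewrite /samplebox /= !in_itv.
have mS : measurable (samplebox z) by apply: measurableX; exact: measurable_itv.
have mD H : (forall v, disc v -> contR H v) -> measurable_fun (samplebox z) (H \o @cart R).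
  move=> Hc; apply: measurable_funS (contR_measurable (@discp_open R) _) => //.
    exact: discp_measurable.
  by move=> p; exact: Hc.
have mA : measurable_fun (samplebox z) (fun p => normc (A (cart p))).
  by apply: (mD (fun v => normc (A v))) => v hv; apply/contR_normc/hol_contC/hA'.
have := @submean R A (re z) (im z) r r0 hR mA.
have -> : re z +i* im z = z by case: (z).
rewrite -/(samplebox z) => S1.
set wt := (1 - normc z ^+ 2) ^ k * (1 - normc (phi a z) ^+ 2).
have g0 := onem_sqr_gt0 hz.
have wt0 : 0 <= wt by rewrite mulr_ge0 ?exprz_ge0 ?ltW// onem_phi_gt0.
have S2 : (wt%:E * \int[(mu \x mu)%E]_(p in samplebox z) (normc (A (cart p)))%:E <=
    15%:R%:E * \int[(mu \x mu)%E]_(p in samplebox z) (density k A a (cart p))%:E)%E.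
  have mF : measurable_fun (samplebox z) (fun p => (density k A a (cart p))%:E).
    by apply/measurable_EFinP; apply: (mD (density k A a)) => v hv; exact: density_cont.
  have Z1 : (wt%:E * \int[(mu \x mu)%E]_(p in samplebox z) (normc (A (cart p)))%:E =
      \int[(mu \x mu)%E]_(p in samplebox z) (wt%:E * (normc (A (cart p)))%:E))%E.
    by rewrite ge0_integralZl//; [exact/measurable_EFinP|
      move=> p _; rewrite lee_fin normc_ge0].
  have Z2 : (15%:R%:E * \int[(mu \x mu)%E]_(p in samplebox z) (density k A a (cart p))%:E =
      \int[(mu \x mu)%E]_(p in samplebox z) (15%:R%:E * (density k A a (cart p))%:E))%E.
    by rewrite ge0_integralZl//; move=> p hp; rewrite lee_fin; apply: density_ge0 => //; exact: subD.
  rewrite Z1 Z2.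
  apply: ge0_le_integral => //.
  - by move=> p _; rewrite -EFinM lee_fin mulr_ge0 ?normc_ge0.
  - by apply: measurable_funeM; exact/measurable_EFinP.
  - by apply: measurable_funeM.
  move=> p hp; rewrite -!EFinM lee_fin /density.
  have hn := samplebox_near hz hp; have hd := subD p hp.
  have e1 := near_weight hk hz hn; have e2 := near_onem_phi ha hz hn.
  have e3 : wt <= 3 * (1 - normc (cart p) ^+ 2) ^ k * (5 * (1 - normc (phi a (cart p)) ^+ 2)).
    by apply: ler_pM => //; rewrite ?exprz_ge0 ?ltW// onem_phi_gt0.
  apply: (le_trans (ler_wpM2r (normc_ge0 (A (cart p))) e3)).
  rewrite le_eqVlt; apply/orP; left; apply/eqP; ring.
apply: (@le_trans _ _ (((128 * 100)%R * wt)%:E * \int[(mu \x mu)%E]_(p in samplebox z) (normc (A (cart p)))%:E)%E).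
  have w0 : (0 <= ((128 * 100)%R * wt)%:E)%E by rewrite lee_fin mulr_ge0.
  apply: le_trans (lee_wpmul2l w0 S1).
  rewrite -EFinM lee_fin admissible_exponentD2// /wt.
  have -> : (128 * 100)%R * ((1 - normc z ^+ 2) ^ k * (1 - normc (phi a z) ^+ 2)) *
      (r ^+ 2 / 32 * normc (A z)) =
      normc (A z) * ((1 - normc z ^+ 2) ^ k * (400 * r ^+ 2)) * (1 - normc (phi a z) ^+ 2) by field.
  rewrite ler_wpM2r ?(ltW (onem_phi_gt0 ha hz))// ler_wpM2l ?normc_ge0//.
  rewrite ler_wpM2l ?(exprz_ge0 _ (ltW g0))//.
  have -> : 400 * r ^+ 2 = (2 * (1 - normc z)) ^+ 2 by rewrite /r; field.
  have z0 := normc_ge0 z; have z1 : normc z < 1 by [].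
  by rewrite lerXn2r ?nnegrE; nra.
rewrite [((128 * 100)%R * wt)%:E]EFinM -muleA.
apply: (@le_trans _ _ ((128 * 100)%R%:E * (15%:R%:E * \int[(mu \x mu)%E]_(p in samplebox z) (density k A a (cart p))%:E))%E).
  by apply: lee_wpmul2l S2; rewrite lee_fin.
by rewrite muleA -EFinM.
Qed.

End sampling.

Section carleson.
Variable R : realType.
Local Notation C := R[i].
Local Notation mu := (@lebesgue_measure R).
Implicit Types (p q : R * R) (z w a : C) (f A : C -> C) (H : C -> R).

Lemma carleson_bound k A : weighted_carleson k A -> exists M : R, forall a, disc a ->
  (\int[(mu \x mu)%E]_(p in @discp R) (density k A a (cart p))%:E <= M%:E)%E.
Proof.
rewrite /weighted_carleson; set S := ereal_sup _ => Soo.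
have d0 : disc (0 : C) by change (is_true (normc (0 : C) < 1)); rewrite normc0.
have ub a : disc a -> (disc_integral (density k A a) <= S)%E.
  by move=> ha; apply: ereal_sup_ubound; exists a.
have S0 : (0 <= S)%E.
  apply: le_trans (ub 0 d0); apply: mule_ge0; first by rewrite lee_fin invr_ge0 pi_ge0.
  by apply: integral_ge0 => p hp; rewrite lee_fin; apply: density_ge0.
case E : S Soo S0 ub => [M| |] // _ S0 ub.
exists (pi * M) => a /ub.
rewrite /disc_integral => h.
have hp : (0 <= (pi : R)%:E)%E by rewrite lee_fin pi_ge0.
have := lee_wpmul2l hp h.
rewrite muleA -!EFinM divff ?gt_eqF ?pi_gt0// mul1e.
exact.
Qed.

(** By the submean property each summand is dominated by the integral over a
    small square around the point, and the squares overlap at most [N] times. *)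
Lemma carleson_sample k A : admissible_exponent k -> analytic_disc A -> weighted_carleson k A ->
  exists2 K : R, 0 <= K & forall a (s : seq C) (N : nat), disc a ->
    (forall z, z \in s -> disc z) ->
    (forall w, disc w -> (count (fun z => (normc (w - z) < (1 - normc z) / 4)%R) s <= N)%N) ->
    \sum_(z <- s) normc (A z) * (1 - normc z ^+ 2) ^ (k + 2) * (1 - normc (phi a z) ^+ 2)
      <= K * N%:R.
Proof.
move=> hk hA /carleson_bound[M HM].
exists ((128 * 100 * 15) * `|M|); first by rewrite mulr_ge0// mulr_ge0.
move=> a s N ha hs hov.
pose F p := (density k A a (cart p))%:E.
have F0 p : @discp R p -> (0 <= F p)%E by move=> hp; rewrite lee_fin; exact: density_ge0.
have mF : measurable_fun (@discp R) F.
  apply/measurable_EFinP; apply: (contR_measurable (@discp_open R)) => p hp.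
  exact: density_cont.
have mD := @discp_measurable R.
have mS z : measurable (samplebox z) by apply: measurableX; exact: measurable_itv.
have subD z : disc z -> samplebox z `<=` @discp R.
  by move=> hz p hp; have [] := near_onem hz (samplebox_near hz hp).
pose G z p := if z \in s then (F \_ (samplebox z)) p else 0%E.
have mG z : measurable_fun setT (G z).
  rewrite /G; case: (boolP (z \in s)) => zs; last exact: measurable_cst.
  apply/(measurable_restrictT _ _).1 => //.
  by apply: measurable_funS mF => //; apply: subD; exact: hs.
have G0 z p : (0 <= G z p)%E.
  rewrite /G; case: ifPn => // zs; rewrite patchE; case: ifPn => // hp.
  by apply: F0; rewrite inE in hp; exact: (subD z (hs z zs) p hp).
pose T := (\int[(mu \x mu)%E]_(p in @discp R) F p)%E.
have T0 : (0 <= T)%E by apply: integral_ge0.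
have L1 : (\sum_(z <- s) \int[(mu \x mu)%E]_p G z p <= N%:R%:E * T)%E.
  rewrite -ge0_integral_sum//.
  have TE : (N%:R%:E * T = \int[(mu \x mu)%E]_p (N%:R%:E * (F \_ (@discp R)) p))%E.
    rewrite /T integral_mkcond ge0_integralZl//.
      by apply/(measurable_restrictT _ _).1.
    by move=> p _; rewrite erestrict_ge0.
  rewrite TE.
  apply: ge0_le_integral => //.
  - by move=> p _; apply: sume_ge0.
  - exact: emeasurable_sum.
  - by apply: measurable_funeM; apply/(measurable_restrictT _ _).1.
  move=> p _; rewrite patchE; case: ifPn => hp; last first.
    rewrite mule0 big_seq big1// => z zs; rewrite /G zs patchE ifN//.
    by apply: contra hp; rewrite !inE; apply: subD; exact: hs.
  rewrite inE in hp.
  apply: (@le_trans _ _ (\sum_(z <- s) (if (normc (cart p - z) < (1 - normc z) / 4)%R then F p else 0))%E).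
    rewrite big_seq [leRHS]big_seq; apply: lee_sum => z zs; rewrite /G zs patchE.
    case: ifPn => hpz.
      rewrite inE in hpz.
      by rewrite ifT//; apply: samplebox_near => //; exact: hs.
    by case: ifP => // _; exact: F0.
  rewrite -big_mkcond /= /F -EFinM sumEFin lee_fin.
  rewrite big_const_seq iter_addr_0 -[leLHS]mulr_natl.
  by rewrite ler_wpM2r ?ler_nat ?hov//; apply: density_ge0.
have TM : (T <= (`|M|)%:E)%E.
  by apply: (le_trans (HM a ha)); rewrite lee_fin ler_norm.
rewrite -lee_fin -sumEFin.
apply: (@le_trans _ _ (\sum_(z <- s) ((128 * 100 * 15)%R%:E * \int[(mu \x mu)%E]_p G z p))%E).
  rewrite big_seq [leRHS]big_seq; apply: lee_sum => z zs.
  apply: (le_trans (sample_le hk hA ha (hs z zs))).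
  rewrite le_eqVlt; apply/orP; left; apply/eqP; congr (_ * _)%E.
  by rewrite integral_mkcond; apply: eq_integral => p _; rewrite /G zs.
rewrite -ge0_sume_distrr; last by move=> z _; apply: integral_ge0.
rewrite [in leRHS]EFinM [X in (_ <= X * _)%E]EFinM -muleA; apply: lee_wpmul2l; first by rewrite lee_fin.
apply: (le_trans L1); rewrite muleC; apply: lee_wpmul2r => //.
Qed.

End carleson.

(** * Disconjugacy along a segment *)

Section taylor.
Variable R : realType.
Local Notation C := R[i].
Implicit Types (z w D e : C) (s t u v c : R) (g : C -> C).

Definition seg z0 D t : C := z0 + t%:C * D.

Lemma seg_dist z0 D s t : normc (seg z0 D s - seg z0 D t) = normc D * `|s - t|.
Proof.
have -> : seg z0 D s - seg z0 D t = (s - t)%:C * D by rewrite /seg cRB; ring.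
by rewrite normcME normcR mulrC.
Qed.

Lemma real_diff (k : R -> R) t (l : R) :
  (forall eps : R, 0 < eps -> exists2 del : R, 0 < del &
    forall s, `|s - t| < del -> `|k s - k t - l * (s - t)| <= eps * `|s - t|) ->
  is_derive t 1 k l.
Proof.
move=> H.
have C1 : h^-1 *: ((k \o shift t) (h *: (1 : R)) - k t) @[h --> (0 : R)^'] --> l.
  apply/cvgrPdist_le => eps e0; have [del d0 Hd] := H _ e0.
  exists del => //= h /=; rewrite ?sub0r ?normrN => hd h0.
  have := Hd (h + t); rewrite addrK => /(_ hd).
  rewrite /GRing.scale /= mulr1 -ler_pdivrMr ?normr_gt0// -normf_div.
  apply: le_trans; rewrite distrC le_eqVlt; apply/orP; left; apply/eqP; congr `|_|.
  by field.
split; first by apply/cvg_ex; exists l.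
by apply/cvg_lim => //; exact: Rhausdorff.
Qed.

Lemma re_sub z w : re (z - w) = re z - re w.
Proof. by case: z; case: w. Qed.

Lemma im_sub z w : im (z - w) = im z - im w.
Proof. by case: z; case: w. Qed.

Lemma re_mulR z t : re (z * t%:C) = re z * t.
Proof. by case: z => a b /=; rewrite mulr0 subr0. Qed.

Lemma im_mulR z t : im (z * t%:C) = im z * t.
Proof. by case: z => a b /=; rewrite mulr0 add0r. Qed.

Lemma seg_diff g z0 D t e : cdiff g (seg z0 D t) e ->
  is_derive t 1 (fun s => re (g (seg z0 D s))) (re (D * e)) /\
  is_derive t 1 (fun s => im (g (seg z0 D s))) (im (D * e)).
Proof.
move=> ge.
have K0 : 0 < normc D + 1 by rewrite ltr_wpDl ?normc_ge0.
have H (eps : R) : 0 < eps -> exists2 del : R, 0 < del & forall s, `|s - t| < del ->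
    normc (g (seg z0 D s) - g (seg z0 D t) - (D * e) * (s - t)%:C) <= eps * `|s - t|.
  move=> e0; have [del d0 Hd] := ge (eps / (normc D + 1)) ltac:(by rewrite divr_gt0).
  exists (del / (normc D + 1)); first by rewrite divr_gt0.
  move=> s; rewrite ltr_pdivlMr// => hs.
  have hs' : normc (seg z0 D s - seg z0 D t) < del.
    rewrite seg_dist; apply: le_lt_trans hs; rewrite mulrC ler_wpM2l//; lra.
  have := Hd _ hs'; rewrite seg_dist.
  have -> : seg z0 D s - seg z0 D t = (s - t)%:C * D by rewrite /seg cRB; ring.
  have -> : D * e * (s - t)%:C = e * ((s - t)%:C * D) by ring.
  move=> /le_trans; apply.
  rewrite mulrA ler_wpM2r// mulrAC ler_pdivrMr// ler_wpM2l ?ltW//; lra.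
by split; apply: real_diff => eps /H[del d0 Hd]; exists del => // s /Hd; apply: le_trans;
  [apply: le_trans (normc_Re _); rewrite !re_sub re_mulR|
   apply: le_trans (normc_Im _); rewrite !im_sub im_mulR].
Qed.

Lemma real_mvt (k dk : R -> R) u v m : u <= v ->
  (forall t, u <= t <= v -> is_derive t 1 k (dk t)) ->
  (forall t, u <= t <= v -> `|dk t| <= m) -> `|k v - k u| <= m * (v - u).
Proof.
move=> uv kd km.
have kd' t : t \in `]u, v[ -> is_derive t 1 k (dk t).
  by rewrite in_itv /= => /andP[h1 h2]; apply: kd; rewrite !ltW.
have kc : {within `[u, v], continuous k}.
  apply: derivable_within_continuous => t; rewrite in_itv /= => /kd h.
  exact: (@ex_derive _ _ _ _ _ _ _ h).
have [t] := MVT_segment uv kd' kc.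
rewrite in_itv /= => tuv ->.
by rewrite normrM (ger0_norm (_ : 0 <= v - u)) ?subr_ge0// ler_wpM2r ?subr_ge0// km.
Qed.

Lemma seg_mvt g dg z0 D u v m : u <= v ->
  (forall t, u <= t <= v -> cdiff g (seg z0 D t) (dg t)) ->
  (forall t, u <= t <= v -> normc D * normc (dg t) <= m) ->
  normc (g (seg z0 D v) - g (seg z0 D u)) <= 2 * (m * (v - u)).
Proof.
move=> uv gd gm; apply: (le_trans (normc_le1 _)); rewrite re_sub im_sub mulr2n mulrDl mul1r.
apply: lerD.
  apply: (@real_mvt (fun s => re (g (seg z0 D s))) (fun t => re (D * dg t))) => //.
    by move=> t /gd /seg_diff[].
  by move=> t /gm; apply: le_trans; rewrite -normcME; exact: normc_Re.
apply: (@real_mvt (fun s => im (g (seg z0 D s))) (fun t => im (D * dg t))) => //.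
  by move=> t /gd /seg_diff[].
by move=> t /gm; apply: le_trans; rewrite -normcME; exact: normc_Im.
Qed.

Lemma normc_sqM z w : normc (z ^+ 2 * w) = normc z ^+ 2 * normc w.
Proof. by rewrite (normcME (z ^+ 2)) (normcX z). Qed.

Lemma normc_half z : normc (2^-1 * z) = 2^-1 * normc z.
Proof. by rewrite (normcME 2^-1) normcVE normc_nat. Qed.

(** The mean value inequality, summed over a partition on whose pieces the
    derivative has separate bounds. *)
Lemma seg_variation g dg z0 D (n : nat) (ts be : nat -> R) tau c :
  0 <= c -> ts 0%N = 0 -> (forall i, (i < n)%N -> ts i <= ts i.+1) -> ts n = 1 ->
  (forall i, (i < n)%N -> 0 <= be i) -> 0 <= tau <= 1 ->
  (forall t, 0 <= t <= 1 -> cdiff g (seg z0 D t) (dg t)) ->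
  (forall i t, (i < n)%N -> ts i <= t <= ts i.+1 -> t <= tau ->
     normc D * normc (dg t) <= be i * c) ->
  normc (g (seg z0 D tau) - g (seg z0 D 0)) <=
    2 * c * \sum_(i < n) be i * (ts i.+1 - ts i).
Proof.
move=> c0 ts0 tsi tsn be0 /andP[tau0 tau1] gd gb.
have ts_ge0 i : (i <= n)%N -> 0 <= ts i.
  elim: i => [_|i IH hi]; first by rewrite ts0.
  exact: le_trans (IH (ltnW hi)) (tsi _ hi).
have H j : (j <= n)%N -> normc (g (seg z0 D (Num.min (ts j) tau)) - g (seg z0 D 0)) <=
    2 * c * \sum_(i < j) be i * (ts i.+1 - ts i).
  elim: j => [_|j IH hj].
    by rewrite big_ord0 mulr0 ts0 min_l// subrr normc0.
  have IH' := IH (ltnW hj).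
  rewrite big_ord_recr /= mulrDr.
  have hjj := tsi j hj; have tj0 := ts_ge0 j (ltnW hj).
  set u := Num.min (ts j) tau in IH' *; set v := Num.min (ts j.+1) tau.
  have -> : g (seg z0 D v) - g (seg z0 D 0) = (g (seg z0 D u) - g (seg z0 D 0)) + (g (seg z0 D v) - g (seg z0 D u)) by ring.
  apply: (le_trans (normc_triangle _ _)); apply: lerD => //.
  have [tj|tj] := leP (ts j) tau; last first.
    have -> : u = v by rewrite /u /v !min_r// ltW// (lt_le_trans tj).
    by rewrite subrr normc0 !mulr_ge0 ?be0// subr_ge0.
  have uE : u = ts j by rewrite /u min_l.
  have uv : u <= v by rewrite uE /v le_min hjj tj.
  have vt : v <= tau by rewrite /v ge_min lexx orbT.
  have vj : v <= ts j.+1 by rewrite /v ge_min lexx.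
  have := @seg_mvt g dg z0 D u v (be j * c) uv.
  move=> /(_ _ _) /le_trans; apply.
  - by move=> t /andP[h1 h2]; apply: gd; rewrite (le_trans _ h1) ?uE// (le_trans h2)// (le_trans vt).
  - move=> t /andP[h1 h2]; apply: gb => //; last exact: le_trans vt.
    by rewrite -uE h1 (le_trans h2).
  have -> : 2 * c * (be j * (ts j.+1 - ts j)) = 2 * (be j * c * (ts j.+1 - ts j)) by ring.
  rewrite ler_pM2l// ler_wpM2l ?mulr_ge0 ?be0//; lra.
by have := H n (leqnn _); rewrite tsn min_r.
Qed.

(** Along the segment from a double zero [z0] of [G0] to another zero, the
    Taylor polynomials of [G0] and [G1], expanded at the moving point and
    evaluated at the far end, have derivatives involving only [G3].  If the
    differential inequality for [G3] had a small coefficient, the second order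
    polynomial would keep close to its initial value [G2 z0 * D ^+ 2 / 2], but
    it ends at [0]. *)
Lemma segment_disconjugacy (G0 G1 G2 G3 : C -> C) z0 D (n : nat) (ts be : nat -> R) :
  (forall t, 0 <= t <= 1 -> [/\ cdiff G0 (seg z0 D t) (G1 (seg z0 D t)),
     cdiff G1 (seg z0 D t) (G2 (seg z0 D t)) & cdiff G2 (seg z0 D t) (G3 (seg z0 D t))]) ->
  D != 0 -> G0 z0 = 0 -> G1 z0 = 0 -> G2 z0 != 0 -> G0 (z0 + D) = 0 ->
  ts 0%N = 0 -> (forall i, (i < n)%N -> ts i <= ts i.+1) -> ts n = 1 ->
  (forall i, (i < n)%N -> 0 <= be i) ->
  (forall i t, (i < n)%N -> ts i <= t <= ts i.+1 -> 0 <= t <= 1 ->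
     let z := seg z0 D t in let r := (1 - t) * normc D in
     r ^+ 2 * normc D * normc (G3 z) <=
     be i * (normc (G0 z) + r * normc (G1 z) + r ^+ 2 * normc (G2 z))) ->
  1 / 40 <= \sum_(i < n) be i * (ts i.+1 - ts i).
Proof.
move=> Gd D0 e0 e1 e2 eb ts0 tsi tsn be0 HG.
set S := \sum_(_ < _) _.
have S0 : 0 <= S by apply: sumr_ge0 => i _; rewrite mulr_ge0 ?be0// subr_ge0 tsi.
rewrite leNgt; apply/negP => Slt.
pose b := z0 + D.
have sb t : b - seg z0 D t = (1 - t)%:C * D by rewrite /b /seg cRB; ring.
have sbn t : t <= 1 -> normc (b - seg z0 D t) = (1 - t) * normc D.
  by move=> t1; rewrite sb normcME normcR ger0_norm// subr_ge0.
have s0 : seg z0 D 0 = z0 by rewrite /seg mul0r addr0.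
have s1 : seg z0 D 1 = b by rewrite /seg mul1r.
pose F t := normc (G0 (seg z0 D t)) + ((1 - t) * normc D) * normc (G1 (seg z0 D t))
   + ((1 - t) * normc D) ^+ 2 * normc (G2 (seg z0 D t)).
have nD : 0 < normc D by rewrite normc_gt0.
have path (G : C -> C) : (forall t, 0 <= t <= 1 -> hol G (seg z0 D t)) ->
    rcont 0 1 (fun t => normc (G (seg z0 D t))).
  move=> Gh; apply: rcont_normc; apply: (@ccont_path R 0 1 (seg z0 D) (normc D) G nD).
    by move=> s t; rewrite seg_dist.
  by move=> t ht; apply/hol_contC/Gh.
have rc : rcont 0 1 (fun t => (1 - t) * normc D).
  apply: rcontM; last exact: rcont_cst.
  apply: rcontD; first exact: rcont_cst.
  by apply: rcontN; apply: continuous_subspaceT => t; exact: cvg_id.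
have Fc : rcont 0 1 F.
  apply: rcontD; first apply: rcontD.
  - by apply: path => t /Gd[h _ _]; eexists; exact: h.
  - by apply: rcontM => //; apply: path => t /Gd[_ h _]; eexists; exact: h.
  - apply: rcontM; last by apply: path => t /Gd[_ _ h]; eexists; exact: h.
    apply: (@eq_rcont _ 0 1 (fun t => ((1 - t) * normc D) * ((1 - t) * normc D))).
      by move=> t _; rewrite expr2.
    exact: rcontM.
have [tm tm01 Fmax] := @EVT_max R F 0 1 ler01 Fc.
set M := F tm in Fmax.
have F0 t : 0 <= t <= 1 -> 0 <= F t.
  move=> /andP[t0 t1]; rewrite /F !addr_ge0 ?mulr_ge0 ?normc_ge0 ?sqr_ge0 ?subr_ge0//.
have tm1 : 0 <= tm <= 1 by move: tm01; rewrite in_itv.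
have M0 : 0 <= M by exact: F0.
have FM t : 0 <= t <= 1 -> F t <= M by move=> ht; apply: Fmax; rewrite in_itv.
(* The Taylor polynomials at [z], evaluated at the far end [b]. *)
pose T2 := G2.
pose T1 z := G1 z + (b - z) * G2 z.
pose T0 z := G0 z + (b - z) * G1 z + (b - z) * ((b - z) * (2^-1 * G2 z)).
have bd z : cdiff (fun w => b - w) z (-1).
  by apply: (cdiff_eq (cdiffB (cdiff_cst b z) (cdiff_id z))); rewrite sub0r.
have dT1 t : 0 <= t <= 1 -> cdiff T1 (seg z0 D t) ((b - seg z0 D t) * G3 (seg z0 D t)).
  move=> /Gd[h0 h1 h2]; apply: (cdiff_eq (cdiffD h1 (cdiffM (bd _) h2))); ring.
have dT0 t : 0 <= t <= 1 -> cdiff T0 (seg z0 D t) (2^-1 * ((b - seg z0 D t) ^+ 2 * G3 (seg z0 D t))).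
  move=> /Gd[h0 h1 h2].
  apply: (cdiff_eq (cdiffD (cdiffD h0 (cdiffM (bd _) h1))
     (cdiffM (bd _) (cdiffM (bd _) (cdiffZ 2^-1 h2))))).
  by field.
have G3b i t : (i < n)%N -> ts i <= t <= ts i.+1 -> 0 <= t <= 1 ->
    ((1 - t) * normc D) ^+ 2 * (normc D * normc (G3 (seg z0 D t))) <= be i * M.
  move=> hi ht h01; rewrite mulrA; apply: (le_trans (HG i t hi ht h01)).
  by rewrite ler_wpM2l ?be0// FM.
have tsp i : (i <= n)%N -> 0 <= ts i.
  elim: i => [_|i IH hi]; first by rewrite ts0.
  exact: le_trans (IH (ltnW hi)) (tsi _ hi).
have V0 tau : 0 <= tau <= 1 -> normc (T0 (seg z0 D tau) - T0 z0) <= M * S.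
  move=> /[dup] h /andP[h1 h2]; rewrite -{2}s0.
  have := @seg_variation T0 _ z0 D n ts be tau (M / 2) _ ts0 tsi tsn be0 h dT0.
  have -> : 2 * (M / 2) = M by field.
  apply; first by rewrite divr_ge0.
  move=> i t hi ht htau; have h01 : 0 <= t <= 1.
    by case/andP: ht => h3 _; rewrite (le_trans (tsp i (ltnW hi)) h3) (le_trans htau).
  case/andP: (h01) => t0 t1.
  rewrite normc_half normc_sqM sbn//.
  have := G3b i t hi ht h01; lra.
have V1 tau : 0 <= tau <= 1 ->
    (1 - tau) * normc D * normc (T1 (seg z0 D tau) - T1 z0) <= 2 * M * S.
  move=> /[dup] h /andP[h1 h2]; rewrite -{2}s0.
  have [->|tau1] := eqVneq tau 1; first by rewrite subrr !mul0r !mulr_ge0.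
  have r0 : 0 < (1 - tau) * normc D by rewrite mulr_gt0// subr_gt0 lt_neqAle tau1.
  have := @seg_variation T1 _ z0 D n ts be tau (M / ((1 - tau) * normc D)) _ ts0 tsi tsn be0 h dT1.
  rewrite -/S => V; rewrite mulrC -ler_pdivlMr//.
  have -> : 2 * M * S / ((1 - tau) * normc D) = 2 * (M / ((1 - tau) * normc D)) * S.
    by field; rewrite gt_eqF//= subr_eq0 eq_sym.
  apply: V; first by rewrite divr_ge0// ltW.
  move=> i t hi ht htau; have h01 : 0 <= t <= 1.
    by case/andP: ht => h3 _; rewrite (le_trans (tsp i (ltnW hi)) h3) (le_trans htau).
  case/andP: (h01) => t0 t1.
  rewrite normcME sbn// [be i * _]mulrA ler_pdivlMr//.
  apply: le_trans (G3b i t hi ht h01).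
  have rr : (1 - tau) * normc D <= (1 - t) * normc D by rewrite ler_pM2r//; lra.
  have x0 : 0 <= normc D * normc (G3 (seg z0 D t)) by rewrite mulr_ge0 ?normc_ge0.
  have y0 : 0 <= (1 - t) * normc D by rewrite mulr_ge0 ?normc_ge0// subr_ge0.
  set r := (1 - t) * normc D in rr y0 *; set X := normc D * normc _ in x0 *.
  have -> : normc D * (r * normc (G3 (seg z0 D t))) = r * X by rewrite /X; ring.
  have -> : r ^+ 2 * X = r * X * r by ring.
  by rewrite ler_wpM2l// mulr_ge0.
have V2 tau : 0 <= tau <= 1 ->
    ((1 - tau) * normc D) ^+ 2 * normc (T2 (seg z0 D tau) - T2 z0) <= 2 * M * S.
  move=> /[dup] h /andP[h1 h2]; rewrite -{2}s0.
  have [->|tau1] := eqVneq tau 1; first by rewrite subrr mul0r expr0n mul0r !mulr_ge0.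
  have r0 : 0 < (1 - tau) * normc D by rewrite mulr_gt0// subr_gt0 lt_neqAle tau1.
  have r20 : 0 < ((1 - tau) * normc D) ^+ 2 by rewrite exprn_gt0.
  have dT2 t : 0 <= t <= 1 -> cdiff T2 (seg z0 D t) (G3 (seg z0 D t)) by move=> /Gd[].
  have := @seg_variation T2 _ z0 D n ts be tau (M / ((1 - tau) * normc D) ^+ 2) _ ts0 tsi tsn be0 h dT2.
  rewrite -/S => V; rewrite mulrC -ler_pdivlMr//.
  have -> : 2 * M * S / ((1 - tau) * normc D) ^+ 2 = 2 * (M / ((1 - tau) * normc D) ^+ 2) * S.
    by field; rewrite gt_eqF//= subr_eq0 eq_sym.
  apply: V; first by rewrite divr_ge0// ltW.
  move=> i t hi ht htau; have h01 : 0 <= t <= 1.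
    by case/andP: ht => h3 _; rewrite (le_trans (tsp i (ltnW hi)) h3) (le_trans htau).
  case/andP: (h01) => t0 t1.
  rewrite mulrA ler_pdivlMr//.
  apply: le_trans (G3b i t hi ht h01).
  have rr : (1 - tau) * normc D <= (1 - t) * normc D by rewrite ler_pM2r//; lra.
  have x0 : 0 <= normc D * normc (G3 (seg z0 D t)) by rewrite mulr_ge0 ?normc_ge0.
  rewrite mulrC ler_wpM2r// lerXn2r// nnegrE ?(ltW r0)//.
  exact: le_trans (ltW r0) rr.
have T2z : T2 z0 = G2 z0 by [].
have T1z : T1 z0 = D * G2 z0 by rewrite /T1 e1 add0r /b addrC addKr.
have T0z : T0 z0 = 2^-1 * (D ^+ 2 * G2 z0).
  by rewrite /T0 e0 e1 mulr0 !add0r /b addrC addKr; ring.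
set g := normc D ^+ 2 * normc (G2 z0).
have g0 : 0 < g by rewrite mulr_gt0 ?exprn_gt0// normc_gt0.
(* [F] is recovered from the Taylor polynomials, whose variation is at most a
   multiple of [M * S]; as [S] is small, this bounds the maximum [M] of [F]. *)
have Mle : M <= 5 * g + 10 * (M * S).
  rewrite /M /F; move: tm1 => /[dup] h /andP[h1 h2].
  set z := seg z0 D tm; set r := (1 - tm) * normc D.
  have r0 : 0 <= r by rewrite mulr_ge0 ?normc_ge0// subr_ge0.
  have rD : r <= normc D by rewrite ler_piMl ?normc_ge0//; lra.
  have bz : normc (b - z) = r by rewrite sbn.
  have t2 : r ^+ 2 * normc (T2 z) <= g + 2 * M * S.
    have := V2 tm h; rewrite -/z -/r => v.
    have := normc_triangle (T2 z - T2 z0) (T2 z0); rewrite subrK => /(ler_wpM2l (sqr_ge0 r)).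
    rewrite mulrDr => /le_trans; apply; rewrite addrC; apply: lerD => //.
    rewrite T2z /g ler_wpM2r ?normc_ge0// lerXn2r ?nnegrE ?normc_ge0//.
  have t1 : r * normc (T1 z) <= g + 2 * M * S.
    have := V1 tm h; rewrite -/z -/r => v.
    have := normc_triangle (T1 z - T1 z0) (T1 z0); rewrite subrK => /(ler_wpM2l r0).
    rewrite mulrDr => /le_trans; apply; rewrite addrC; apply: lerD => //.
    rewrite T1z normcME /g expr2 -mulrA ler_wpM2r// mulr_ge0 ?normc_ge0//.
  have t0 : normc (T0 z) <= g / 2 + M * S.
    have := V0 tm h; rewrite -/z => v.
    have := normc_triangle (T0 z - T0 z0) (T0 z0); rewrite subrK => /le_trans; apply.
    rewrite addrC; apply: lerD => //.
    by rewrite T0z normc_half normc_sqM /g mulrC.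
  have q1 : normc (G1 z) <= normc (T1 z) + r * normc (T2 z).
    have -> : G1 z = T1 z - (b - z) * T2 z by rewrite /T1 /T2; ring.
    by apply: (le_trans (normc_triangleB _ _)); rewrite normcME bz.
  have q0 : normc (G0 z) <= normc (T0 z) + (r * normc (T1 z) + r ^+ 2 * normc (T2 z) / 2).
    have -> : G0 z = T0 z - ((b - z) * T1 z - (b - z) ^+ 2 * (2^-1 * T2 z)).
      by rewrite /T0 /T1 /T2; field.
    apply: (le_trans (normc_triangleB _ _)); apply: lerD => //.
    apply: (le_trans (normc_triangleB _ _)).
    rewrite normcME bz; apply: lerD => //.
    by rewrite normc_sqM bz normc_half; lra.
  have q1' : r * normc (G1 z) <= r * normc (T1 z) + r ^+ 2 * normc (T2 z).
    by have := ler_wpM2l r0 q1; rewrite mulrDr [r * (r * _)]mulrA -expr2.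
  move: q0 q1' t0 t1 t2; rewrite /T2.
  set X := normc (G0 z); set Y := r * normc (G1 z); set Z := r ^+ 2 * normc (G2 z).
  set U := r * normc (T1 z); set W := normc (T0 z); set P := M * S.
  have -> : 2 * M * S = 2 * P by rewrite /P; ring.
  lra.
have := V0 1 ltac:(by rewrite ler01 lexx).
rewrite s1 T0z; have -> : T0 b = 0 by rewrite /T0 eb subrr !mul0r !addr0.
rewrite sub0r normcNE normc_half normc_sqM -/g => fin.
have MS : M * S <= M * (1 / 40) by rewrite ler_wpM2l// ltW.
suff : g < g by rewrite ltxx.
lra.
Qed.

End taylor.

(** * Moebius invariance *)

Section moebius.
Variable R : realType.
Local Notation C := R[i].
Implicit Types (z w D : C) (t : R).

(** The conformally invariant size of the coefficients. *)
Definition Lam (A0 A1 A2 : C -> C) w : R :=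
  let u := 1 - normc w ^+ 2 in
  normc (A0 w) * u ^+ 3 + normc (A1 w) * u ^+ 2 + normc (A2 w) * u.

Lemma Lam_ge0 (A0 A1 A2 : C -> C) w : disc w -> 0 <= Lam A0 A1 A2 w.
Proof.
by move=> /onem_sqr_gt0 h; rewrite !addr_ge0 ?mulr_ge0 ?normc_ge0 ?exprn_ge0 ?ltW.
Qed.

(** Pointwise form of the pulled back equation: if [y0], ..., [y3] are the values
    of the solution and of its derivatives, then the [g]'s are those of the
    pulled back function, and the factors [u] restore the invariant weights. *)
Lemma pullback_le (y0 y1 y2 y3 c0 c1 c2 qz ga det : C) (u r DD kap : R) :
  1 <= kap -> 0 < u -> 0 <= r -> 0 <= DD -> qz != 0 -> det != 0 ->
  y3 + c2 * y2 + c1 * y1 + c0 * y0 = 0 ->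
  r * normc ga <= kap * normc qz ->
  r * normc det <= kap * (normc qz ^+ 2 * u) ->
  forall g0 g1 g2 g3, g0 = qz ^+ 2 * y0 ->
  g1 = 2 * ga * (qz * y0) + det * y1 ->
  g2 = 2 * ga ^+ 2 * y0 + 2 * ga * det * (y1 * qz^-1) + det ^+ 2 * (y2 * (qz^-1 * qz^-1)) ->
  g3 = det ^+ 3 * (y3 * qz^-1 ^+ 4) ->
  r ^+ 2 * DD * normc g3 <=
  5 * kap ^+ 2 * (DD * normc det / (normc qz ^+ 2 * u) *
    (normc c0 * u ^+ 3 + normc c1 * u ^+ 2 + normc c2 * u)) *
  (normc g0 + r * normc g1 + r ^+ 2 * normc g2).
Proof.
move=> k1 u0 r0 DD0 qz0 det0 ode hp hv g0 g1 g2 g3 g0E g1E g2E g3E.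
have -> : normc g3 = normc det ^+ 3 / normc qz ^+ 4 * normc y3.
  rewrite g3E (normcME (det ^+ 3)) (normcX det) (normcME y3) (normcX qz^-1) normcVE exprVn.
  by rewrite -mulrA [normc y3 * _]mulrC.
set Q := normc qz in hp hv *; set E := normc det in hv *.
have Q0 : 0 < Q by rewrite normc_gt0.
have E0 : 0 < E by rewrite normc_gt0.
pose p := normc ga / Q; pose v := E / Q ^+ 2.
have p0 : 0 <= p by rewrite divr_ge0 ?normc_ge0// ltW.
have v0 : 0 < v by rewrite divr_gt0// exprn_gt0.
have hp' : r * p <= kap by rewrite /p mulrA ler_pdivrMr.
have hv' : r * v <= kap * u.
  rewrite /v mulrA ler_pdivrMr ?exprn_gt0//; apply: (le_trans hv).
  rewrite le_eqVlt; apply/orP; left; apply/eqP; ring.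
have rp0 : 0 <= r * p by rewrite mulr_ge0.
have rv0 : 0 <= r * v by rewrite mulr_ge0// ltW.
set F0 := normc g0; set F1 := normc g1; set F2 := normc g2.
have [F00 F10 F20] : [/\ 0 <= F0, 0 <= F1 & 0 <= F2] by split; exact: normc_ge0.
set a0 := normc c0; set a1 := normc c1; set a2 := normc c2.
have [a00 a10 a20] : [/\ 0 <= a0, 0 <= a1 & 0 <= a2] by split; exact: normc_ge0.
pose x0 := normc y0; pose x1 := normc y1; pose x2 := normc y2.
have e0 : x0 = F0 / Q ^+ 2.
  by rewrite /F0 g0E normc_sqM -/x0 -/Q; field; lra.
have e1 : E * x1 <= F1 + 2 * p * F0.
  have -> : E * x1 = normc (g1 - 2 * (ga / qz) * g0).
    by rewrite /E /x1 -normcME; congr normc; rewrite g1E g0E; field.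
  apply: (le_trans (normc_triangleB _ _)).
  by rewrite (normcME (2 * (ga / qz))) (normcME 2) normc_nat normc_div.
have e2 : E ^+ 2 * x2 <= Q ^+ 2 * (F2 + 2 * p * F1 + 2 * p ^+ 2 * F0).
  have -> : E ^+ 2 * x2 = normc (qz ^+ 2 * (g2 - 2 * (ga / qz) * g1 + 2 * (ga / qz) ^+ 2 * g0)).
    by rewrite /E /x2 -normc_sqM; congr normc; rewrite g2E g1E g0E; field.
  rewrite normc_sqM ler_wpM2l ?exprn_ge0// ?(ltW Q0)//.
  apply: (le_trans (normc_triangle _ _)); apply: lerD.
    apply: (le_trans (normc_triangleB _ _)).
    by rewrite (normcME (2 * (ga / qz))) (normcME 2) normc_nat normc_div.
  by rewrite (normcME (2 * _)) (normcME 2) normc_nat (normcX (ga / qz)) normc_div.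
have e3 : normc y3 <= a2 * x2 + a1 * x1 + a0 * x0.
  have -> : y3 = - (c2 * y2 + c1 * y1 + c0 * y0).
    by apply/eqP; rewrite -subr_eq0 opprK !addrA ode.
  rewrite normcNE (le_trans (normc_triangle _ _))//; apply: lerD; last by rewrite normcME.
  by rewrite (le_trans (normc_triangle _ _))// !normcME.
move: (normc y3) e3 => X3 e3.
clearbody x0 x1 x2 F0 F1 F2 a0 a1 a2 E Q.
set F := F0 + r * F1 + r ^+ 2 * F2.
pose P := r * p; pose V := r * v; pose Y := r * F1; pose Z := r ^+ 2 * F2.
have [P0 V0 Y0 Z0] : [/\ 0 <= P, 0 <= V, 0 <= Y & 0 <= Z].
  by split; [exact: rp0|exact: rv0|exact: mulr_ge0|apply: mulr_ge0 => //; exact: sqr_ge0].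
have k0 : 0 <= kap by lra.
have kk : 1 <= kap ^+ 2 by rewrite -[1](expr1n _ 2) lerXn2r ?nnegrE.
have kk' : kap <= kap ^+ 2 by rewrite expr2 ler_peMr.
have KY : P * Y <= kap ^+ 2 * Y by rewrite ler_wpM2r// (le_trans hp').
have KZ : Z <= kap ^+ 2 * Z by rewrite ler_peMl.
have KP : P ^+ 2 * F0 <= kap ^+ 2 * F0 by rewrite ler_wpM2r// lerXn2r ?nnegrE.
have [KF KY0 KZ0] : [/\ 0 <= kap ^+ 2 * F0, 0 <= kap ^+ 2 * Y & 0 <= kap ^+ 2 * Z].
  by split; rewrite mulr_ge0 ?sqr_ge0.
have b2 : Z + 2 * (P * Y) + 2 * (P ^+ 2 * F0) <= 5 * kap ^+ 2 * F.
  by rewrite /F -/Y -/Z; lra.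
have VY : V * Y <= u * (kap ^+ 2 * Y).
  by rewrite mulrA ler_wpM2r// (le_trans hv')// [u * _]mulrC ler_wpM2r// ltW.
have VP : V * (P * F0) <= u * (kap ^+ 2 * F0).
  apply: (@le_trans _ _ (kap * u * kap * F0)).
    by rewrite mulrA ler_wpM2r//; apply: ler_pM.
  rewrite le_eqVlt; apply/orP; left; apply/eqP; ring.
have uz : 0 <= u * (kap ^+ 2 * Z) by rewrite mulr_ge0// ltW.
have uy : 0 <= u * (kap ^+ 2 * Y) by rewrite mulr_ge0// ltW.
have uf : 0 <= u * (kap ^+ 2 * F0) by rewrite mulr_ge0// ltW.
have b1 : V * (Y + 2 * (P * F0)) <= u * (5 * kap ^+ 2 * F).
  have -> : V * (Y + 2 * (P * F0)) = V * Y + 2 * (V * (P * F0)) by ring.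
  have -> : u * (5 * kap ^+ 2 * F) = 5 * (u * (kap ^+ 2 * F0)) + 5 * (u * (kap ^+ 2 * Y))
     + 5 * (u * (kap ^+ 2 * Z)) by rewrite /F -/Y -/Z; ring.
  lra.
have b0 : V ^+ 2 * F0 <= u ^+ 2 * (5 * kap ^+ 2 * F).
  have h : V ^+ 2 * F0 <= u ^+ 2 * (kap ^+ 2 * F0).
    by rewrite mulrA ler_wpM2r// -exprMn mulrC lerXn2r ?nnegrE// mulr_ge0// ltW.
  apply: (le_trans h); rewrite ler_wpM2l ?sqr_ge0// /F -/Y -/Z; lra.
set W := 5 * kap ^+ 2 * F in b0 b1 b2.
have -> : 5 * kap ^+ 2 * (DD * E / (Q ^+ 2 * u) * (a0 * u ^+ 3 + a1 * u ^+ 2 + a2 * u)) * F =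
   DD * (v * (a2 * W + a1 * (u * W) + a0 * (u ^+ 2 * W))).
  rewrite /W /v; field; lra.
have -> : r ^+ 2 * DD * (E ^+ 3 / Q ^+ 4 * X3) =
   DD * (v * (r ^+ 2 * (E * v) * X3)).
  by rewrite /v; field; lra.
rewrite ler_wpM2l// ler_pM2l//.
have ev : 0 <= r ^+ 2 * (E * v) by rewrite mulr_ge0 ?sqr_ge0// mulr_ge0// ltW.
apply: (le_trans (ler_wpM2l ev e3)).
have -> : r ^+ 2 * (E * v) * (a2 * x2 + a1 * x1 + a0 * x0) =
   a2 * (r ^+ 2 * (E ^+ 2 * x2 / Q ^+ 2)) + a1 * (V * (r * (E * x1))) + a0 * (V ^+ 2 * F0).
  by rewrite e0 /V /v; field; lra.
apply: lerD; last by rewrite ler_wpM2l.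
apply: lerD; rewrite ler_wpM2l//.
  apply: le_trans b2.
  have -> : Z + 2 * (P * Y) + 2 * (P ^+ 2 * F0) = r ^+ 2 * (F2 + 2 * p * F1 + 2 * p ^+ 2 * F0).
    by rewrite /Z /P /Y; ring.
  by rewrite ler_wpM2l ?sqr_ge0// ler_pdivrMr ?exprn_gt0// [_ * Q ^+ 2]mulrC.
apply: le_trans b1; rewrite ler_wpM2l//.
have -> : Y + 2 * (P * F0) = r * (F1 + 2 * p * F0) by rewrite /Y /P; ring.
by rewrite ler_wpM2l.
Qed.

Definition solves (A0 A1 A2 f : C -> C) := forall z, disc z ->
  cderiv 3 f z + A2 z * cderiv 2 f z + A1 z * cderiv 1 f z + A0 z * f z = 0.

Section pullback.
Variables (A0 A1 A2 f : C -> C) (al be ga de : C).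
Hypothesis fa : analytic_disc f.
Hypothesis ode : solves A0 A1 A2 f.

Let q z : C := ga * z + de.
Let psi z : C := (al * z + be) / q z.
Let det : C := al * de - be * ga.

(** Bol's substitution: with the square of the denominator as a factor, the third
    derivative of the pulled back function contains no lower derivatives of
    [f]. *)
Let G0 z := q z ^+ 2 * f (psi z).
Let G1 z := 2 * ga * (q z * f (psi z)) + det * cderiv 1 f (psi z).
Let G2 z := 2 * ga ^+ 2 * f (psi z) + 2 * ga * det * (cderiv 1 f (psi z) * (q z)^-1)
  + det ^+ 2 * (cderiv 2 f (psi z) * ((q z)^-1 * (q z)^-1)).
Let G3 z := det ^+ 3 * (cderiv 3 f (psi z) * (q z)^-1 ^+ 4).

Let dq z : cdiff q z ga.
Proof.
apply: (cdiff_eq (cdiffD (cdiffZ ga (cdiff_id z)) (cdiff_cst de z))).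
by rewrite mulr1 addr0.
Qed.

Let dqV z : q z != 0 -> cdiff (fun v => (q v)^-1) z (- ga / q z ^+ 2).
Proof. by move=> h; exact: cdiffV h (dq z). Qed.

Let dpsi z : q z != 0 -> cdiff psi z (det / q z ^+ 2).
Proof.
move=> h; have d1 : cdiff (fun v => al * v + be) z al.
  apply: (cdiff_eq (cdiffD (cdiffZ al (cdiff_id z)) (cdiff_cst be z))).
  by rewrite mulr1 addr0.
apply: (cdiff_eq (cdiffM d1 (dqV h))); rewrite /det.
have -> : de = q z - ga * z by rewrite /q; ring.
by field.
Qed.

Let df n z : q z != 0 -> disc (psi z) ->
  cdiff (fun v => cderiv n f (psi v)) z (cderiv n.+1 f (psi z) * (det / q z ^+ 2)).
Proof. by move=> h hd; apply: cdiff_comp (dpsi h) _; exact: analytic_cdiff. Qed.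

Let df0 z : q z != 0 -> disc (psi z) ->
  cdiff (fun v => f (psi v)) z (cderiv 1 f (psi z) * (det / q z ^+ 2)).
Proof. by move=> h hd; exact: (df 0 h hd). Qed.

Let dG0 z : q z != 0 -> disc (psi z) -> cdiff G0 z (G1 z).
Proof.
move=> h hd; have f0 := df0 h hd.
rewrite (_ : G0 = fun v => (q v * q v) * f (psi v)); last by apply/funext => v; rewrite /G0 expr2.
apply: (cdiff_eq (cdiffM (cdiffM (dq z) (dq z)) f0)); rewrite /G1.
move: (f (psi z)) (cderiv 1 f (psi z)) => x0 x1.
move: (q z) det h => Q E h; by field.
Qed.

Let dG1 z : q z != 0 -> disc (psi z) -> cdiff G1 z (G2 z).
Proof.
move=> h hd.
apply: (cdiff_eq (cdiffD (cdiffZ (2 * ga) (cdiffM (dq z) (df0 h hd))) (cdiffZ det (df 1 h hd)))).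
rewrite /G2; move: (f (psi z)) (cderiv 1 f (psi z)) (cderiv 2 f (psi z)) => x0 x1 x2.
move: (q z) det h => Q E h; by field.
Qed.

Let dG2 z : q z != 0 -> disc (psi z) -> cdiff G2 z (G3 z).
Proof.
move=> h hd.
apply: (cdiff_eq (cdiffD (cdiffD (cdiffZ (2 * ga ^+ 2) (df0 h hd))
  (cdiffZ (2 * ga * det) (cdiffM (df 1 h hd) (dqV h))))
  (cdiffZ (det ^+ 2) (cdiffM (df 2 h hd) (cdiffM (dqV h) (dqV h)))))).
rewrite /G3; move: (f (psi z)) (cderiv 1 f (psi z)) (cderiv 2 f (psi z)) (cderiv 3 f (psi z)) => x0 x1 x2 x3.
move: (q z) det h => Q E h; by field.
Qed.

Let G3_le z D t (kap : R) : 1 <= kap -> 0 <= t <= 1 -> q z != 0 -> disc (psi z) -> det != 0 ->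
  let r := (1 - t) * normc D in
  r * normc ga <= kap * normc (q z) ->
  r * normc det <= kap * (normc (q z) ^+ 2 * (1 - normc (psi z) ^+ 2)) ->
  r ^+ 2 * normc D * normc (G3 z) <=
  5 * kap ^+ 2 * (normc D * normc det / (normc (q z) ^+ 2 * (1 - normc (psi z) ^+ 2)) *
    Lam A0 A1 A2 (psi z)) *
  (normc (G0 z) + r * normc (G1 z) + r ^+ 2 * normc (G2 z)).
Proof.
move=> k1 /andP[t0 t1] qz dz det0 r hp hv.
have r0 : 0 <= r by rewrite mulr_ge0 ?normc_ge0// subr_ge0.
exact: (pullback_le k1 (onem_sqr_gt0 dz) r0 (normc_ge0 D) qz det0 (ode dz) hp hv
  erefl erefl erefl erefl).
Qed.

(** The only properties of the pulled back function that matter below; its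
    explicit formulas are hidden here. *)
Let pullbackP : exists g0 g1 g2 g3 : C -> C,
  [/\ forall z, q z != 0 -> disc (psi z) ->
        [/\ cdiff g0 z (g1 z), cdiff g1 z (g2 z) & cdiff g2 z (g3 z)],
      forall z, f (psi z) = 0 -> g0 z = 0,
      forall z, f (psi z) = 0 -> cderiv 1 f (psi z) = 0 -> g1 z = 0,
      forall z, q z != 0 -> det != 0 -> f (psi z) = 0 -> cderiv 1 f (psi z) = 0 ->
        cderiv 2 f (psi z) != 0 -> g2 z != 0 &
      forall z D t (kap : R), 1 <= kap -> 0 <= t <= 1 -> q z != 0 -> disc (psi z) ->
        det != 0 ->
        (1 - t) * normc D * normc ga <= kap * normc (q z) ->
        (1 - t) * normc D * normc det <=
          kap * (normc (q z) ^+ 2 * (1 - normc (psi z) ^+ 2)) ->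
        ((1 - t) * normc D) ^+ 2 * normc D * normc (g3 z) <=
        5 * kap ^+ 2 * (normc D * normc det / (normc (q z) ^+ 2 * (1 - normc (psi z) ^+ 2)) *
          Lam A0 A1 A2 (psi z)) *
        (normc (g0 z) + ((1 - t) * normc D) * normc (g1 z)
          + ((1 - t) * normc D) ^+ 2 * normc (g2 z))].
Proof.
exists G0, G1, G2, G3; split.
- by move=> z h1 h2; exact: (And3 (dG0 h1 h2) (dG1 h1 h2) (dG2 h1 h2)).
- by move=> z h; rewrite /G0 h mulr0.
- by move=> z h h'; rewrite /G1 h h' !mulr0 addr0.
- move=> z hq hd f0 f1 f2; rewrite /G2 f0 f1 mul0r !mulr0 !add0r.
  apply: mulf_neq0; first by rewrite expf_neq0.
  by apply: mulf_neq0; [exact: f2|rewrite mulf_neq0 ?invr_neq0].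
- exact: G3_le.
Qed.

(** [segment_disconjugacy] for the pulled back function.  The sum bounds the
    length of the segment with respect to [Lam] times the hyperbolic metric;
    [kap] measures how far the chart is from being affine along the segment. *)
Lemma moebius_disconjugacy z0 D (n : nat) (ts b : nat -> R) (kap : R) :
  1 <= kap -> D != 0 -> det != 0 ->
  (forall t, 0 <= t <= 1 -> q (seg z0 D t) != 0 /\ disc (psi (seg z0 D t))) ->
  twofold_zeros f (psi z0) -> f (psi (z0 + D)) = 0 ->
  ts 0%N = 0 -> (forall i, (i < n)%N -> ts i <= ts i.+1) -> ts n = 1 ->
  (forall i, (i < n)%N -> 0 <= b i) ->
  (forall t, 0 <= t <= 1 -> let z := seg z0 D t in
     (1 - t) * normc D * normc ga <= kap * normc (q z) /\
     (1 - t) * normc D * normc det <= kap * (normc (q z) ^+ 2 * (1 - normc (psi z) ^+ 2))) ->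
  (forall i t, (i < n)%N -> ts i <= t <= ts i.+1 -> 0 <= t <= 1 ->
     let z := seg z0 D t in
     5 * kap ^+ 2 * (normc D * normc det / (normc (q z) ^+ 2 * (1 - normc (psi z) ^+ 2)) *
       Lam A0 A1 A2 (psi z)) <= b i) ->
  1 / 40 <= \sum_(i < n) b i * (ts i.+1 - ts i).
Proof.
move=> k1 D0 det0 hd [dz0 [f01 f2]] fb ts0 tsi tsn b0 hk hb.
have [qz0 _] : q z0 != 0 /\ disc (psi z0).
  by have := hd 0; rewrite /seg mul0r addr0; apply; rewrite lexx ler01.
have f0 : f (psi z0) = 0 by exact: (f01 0%N).
have f1 : cderiv 1 f (psi z0) = 0 by exact: (f01 1%N).
have [g0 [g1 [g2 [g3 [hG h0 h1 h2 h3]]]]] := pullbackP.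
have hG' t : 0 <= t <= 1 -> [/\ cdiff g0 (seg z0 D t) (g1 (seg z0 D t)),
     cdiff g1 (seg z0 D t) (g2 (seg z0 D t)) & cdiff g2 (seg z0 D t) (g3 (seg z0 D t))].
  by move=> ht; have [k2 k3] := hd t ht; exact: hG.
move/eqP: f2 => f2.
apply: (segment_disconjugacy hG' D0 (h0 _ f0) (h1 _ f0 f1) (h2 _ qz0 det0 f0 f1 f2)
  (h0 _ fb) ts0 tsi tsn b0).
move=> i t hi ht h01; have [k2 k3] := hd t h01; have [k4 k5] := hk t h01.
cbv zeta; apply: (le_trans (h3 _ _ _ _ k1 h01 k2 k3 det0 k4 k5)).
apply: ler_wpM2r; last exact: hb.
have r0 : 0 <= (1 - t) * normc D.
  by case/andP: h01 => _ t1; rewrite mulr_ge0 ?normc_ge0// subr_ge0.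
exact: (addr_ge0 (addr_ge0 (normc_ge0 _) (mulr_ge0 r0 (normc_ge0 _)))
    (mulr_ge0 (sqr_ge0 _) (normc_ge0 _))).
Qed.

End pullback.
End moebius.

(** * Separation of the double zeros *)

Section separation.
Variable R : realType.
Local Notation C := R[i].
Implicit Types (z w a b : C).

Lemma twofold_zero0 (f : C -> C) z : twofold_zeros f z -> disc z /\ f z = 0.
Proof. by move=> [hz [h _]]; split => //; exact: (h 0%N). Qed.

Lemma one_minus_conj_le a b : disc a -> normc (1 - a^* * b) <= (1 - normc a ^+ 2) + normc (a - b).
Proof.
move=> ha; have -> : 1 - a^* * b = (1 - a^* * a) + a^* * (a - b) by ring.
apply: (le_trans (normc_triangle _ _)); apply: lerD.
  have -> : 1 - a^* * a = (1 - normc a ^+ 2)%:C.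
    rewrite normc_sqr; case: a ha => x y _; apply/eqP; rewrite eq_complex /=.
    by apply/andP; split; apply/eqP; ring.
  by rewrite normcR ger0_norm// ltW// onem_sqr_gt0.
by rewrite normcME normcJE ler_piMl ?normc_ge0// ltW.
Qed.

(** A hyperbolically short segment has small length also with respect to a
    bounded density. *)
Lemma twofold_zeros_separated (A0 A1 A2 f : C -> C) (L : R) :
  analytic_disc f ->
  solves A0 A1 A2 f ->
  (forall w, disc w -> Lam A0 A1 A2 w <= L) ->
  exists2 del : R, 0 < del & forall a b, twofold_zeros f a -> twofold_zeros f b ->
    a != b -> del < pdist a b.
Proof.
move=> fa ode hL.
have d0 : disc (0 : C) by change (is_true (normc (0 : C) < 1)); rewrite normc0.
have L0 : 0 <= L by apply: le_trans (hL 0 d0); exact: Lam_ge0.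
pose del : R := Num.min (1 / 8) (1 / (64 * 50 * (L + 1))).
have KL : 0 < 64 * 50 * (L + 1) by lra.
have del0 : 0 < del by rewrite lt_min !divr_gt0.
have dL : del * (64 * 50 * (L + 1)) <= 1.
  by rewrite -ler_pdivlMr// ge_min lexx orbT.
have d8 : del <= 1 / 8 by rewrite ge_min lexx.
exists del => // a b ha hb ab; rewrite ltNge; apply/negP => hd.
have [da fa0] := twofold_zero0 ha; have [db fb0] := twofold_zero0 hb.
have den0 : 0 < normc (1 - a^* * b) by exact: den_gt0.
pose D := b - a; have D0 : D != 0 by rewrite subr_eq0 eq_sym.
have na1 : normc a < 1 by [].
have na0 := normc_ge0 a.
set d := 1 - normc a; have dd0 : 0 < d by rewrite subr_gt0.
have Dle : normc D <= 4 * del * d.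
  have h : normc D <= del * normc (1 - a^* * b).
    by move: hd; rewrite /pdist ler_pdivrMr// normcB.
  have := one_minus_conj_le b da; rewrite normcB -/D => h2.
  have : normc D <= del * (2 * d + normc D).
    apply: (le_trans h); rewrite ler_pM2l//; apply: (le_trans h2); rewrite lerD2r.
    rewrite /d; nra.
  rewrite mulrDr => h3.
  have h4 : del * normc D <= (1 / 8) * normc D by rewrite ler_wpM2r ?normc_ge0.
  have h5 : 0 <= del * d by rewrite mulr_ge0// ltW.
  lra.
have Dd : normc D <= d / 2.
  have : del * d <= (1 / 8) * d by rewrite ler_pM2r.
  lra.
have q1 z : (0 : C) * z + 1 = 1 by rewrite mul0r add0r.
have psiE z : (1 * z + 0) / (0 * z + 1) = z by rewrite q1 divr1 mul1r addr0.
have near t : 0 <= t <= 1 -> d / 2 <= 1 - normc (seg a D t).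
  move=> /andP[t0 t1]; have : normc (seg a D t) <= normc a + normc D.
    apply: (le_trans (normc_triangle _ _)); rewrite lerD2l normcME normcR ger0_norm//.
    by rewrite ler_piMl ?normc_ge0.
  rewrite /d in Dd *; lra.
have sd t : 0 <= t <= 1 -> disc (seg a D t).
  move=> /near h; change (is_true (normc (seg a D t) < 1)); lra.
have su t : 0 <= t <= 1 -> d / 2 <= 1 - normc (seg a D t) ^+ 2.
  move=> ht; have h1 := near t ht; have h2 := normc_ge0 (seg a D t).
  have h3 : normc (seg a D t) ^+ 2 <= normc (seg a D t) by rewrite expr2 ler_piMl//; lra.
  lra.
have det1 : (1 : C) * 1 - 0 * 0 = 1 by rewrite mulr1 mul0r subr0.
have := @moebius_disconjugacy R A0 A1 A2 f 1 0 0 1 fa ode a D 1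
  (fun i => if i is 0%N then 0 else 1) (fun=> 40 * del * L) 1 (lexx _) D0.
rewrite det1 normc1 normc0 psiE.
have eb : a + D = b by rewrite /D addrC subrK.
rewrite psiE eb => /(_ _ _ ha fb0 erefl _ erefl) H.
have : 1 / 40 <= \sum_(i < 1) 40 * del * L * ((fun i => if i is 0%N then 0 else 1 : R) i.+1 - (fun i => if i is 0%N then 0 else 1 : R) i).
  apply: H => //; try exact: oner_neq0.
  - by move=> t ht; rewrite psiE q1 oner_neq0; split => //; exact: sd.
  - by case.
  - by move=> *; rewrite !mulr_ge0// ltW.
  - move=> t ht; cbv zeta; rewrite psiE q1 normc1 mulr0 mul1r; split => //.
    rewrite ?expr1n ?mul1r ?mulr1; case/andP: (ht) => t0 t1.
    apply: le_trans (su t ht); apply: le_trans Dd.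
    by rewrite ler_piMl ?normc_ge0//; lra.
  - move=> i t _ _ ht; cbv zeta; rewrite psiE q1 normc1 ?expr1n ?mul1r ?expr1n ?mulr1.
    have u0 := su t ht; set u := 1 - normc (seg a D t) ^+ 2 in u0 *.
    have uu : 0 < u by apply: lt_le_trans u0; rewrite divr_gt0.
    have h1 : normc D / u <= 8 * del.
      rewrite ler_pdivrMr//; apply: (le_trans Dle).
      have : 8 * del * (d / 2) <= 8 * del * u by rewrite ler_pM2l// mulr_gt0.
      lra.
    have h2 := hL _ (sd t ht); have h3 : 0 <= Lam A0 A1 A2 (seg a D t) by apply: Lam_ge0; exact: sd.
    have : normc D / u * Lam A0 A1 A2 (seg a D t) <= 8 * del * L.
      by apply: ler_pM => //; rewrite divr_ge0 ?normc_ge0// ltW.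
    lra.
rewrite big_ord1 /= subr0 mulr1.
have : 0 <= del * L by rewrite mulr_ge0// ltW.
lra.
Qed.

Lemma weighted_bounded_le (k : nat) (A : C -> C) : weighted_bounded k A ->
  exists M : R, forall w, disc w -> normc (A w) * (1 - normc w ^+ 2) ^+ k <= M.
Proof.
rewrite /weighted_bounded; set S := ereal_sup _ => Soo.
have ub w : disc w -> ((normc (A w) * (1 - normc w ^+ 2) ^+ k)%:E <= S)%E.
  by move=> hw; apply: ereal_sup_ubound; exists w.
have d0 : disc (0 : C) by change (is_true (normc (0 : C) < 1)); rewrite normc0.
case E : S Soo ub => [M| |] // _ ub; first by exists M => w /ub; rewrite lee_fin.
by have := ub 0 d0.
Qed.

End separation.

(** * Half-plane charts *)

Section halfplane.
Variable R : realType.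
Local Notation C := R[i].
Implicit Types (z w a : C).

(** [hmap a e] is [z |-> phi a (e * (z - 'i) / (z + 'i))], from the upper
    half-plane onto the disc; so [a] is the image of ['i].  The sign [e = -1]
    amounts to composing with the inversion [z |-> - z^-1]. *)
Definition hnum a (e : C) z := (a - e) * z + 'i * (a + e).
Definition hden a (e : C) z := (1 - a^* * e) * z + 'i * (1 + a^* * e).
Definition hmap a (e : C) z := hnum a e z / hden a e z.

Definition is_sign (e : C) := e = 1 \/ e = -1.

Lemma hdet a e : is_sign e ->
  (a - e) * ('i * (1 + a^* * e)) - ('i * (a + e)) * (1 - a^* * e) =
  - 2 * 'i * e * (1 - normc a ^+ 2)%:C.
Proof.
move=> es; have -> : (1 - normc a ^+ 2)%:C = 1 - a * a^*.
  rewrite normc_sqr; case: a => x y; apply/eqP; rewrite eq_complex /=.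
  by apply/andP; split; apply/eqP; ring.
case: es => ->; ring.
Qed.

Lemma hdet_norm a e : is_sign e -> disc a ->
  normc ((a - e) * ('i * (1 + a^* * e)) - ('i * (a + e)) * (1 - a^* * e)) =
  2 * (1 - normc a ^+ 2).
Proof.
move=> es da; rewrite hdet// normcME normcR ger0_norm ?ltW ?onem_sqr_gt0//.
congr (_ * _); rewrite normcME [normc (- 2 * 'i)]normcME normci mulr1 normcNE normc_nat.
by case: es => ->; rewrite ?normcNE normc1 mulr1.
Qed.

Lemma hmap_identity a e z : is_sign e ->
  normc (hden a e z) ^+ 2 - normc (hnum a e z) ^+ 2 = 4 * im z * (1 - normc a ^+ 2).
Proof.
rewrite /hden /hnum !normc_sqr; case: a z => x y [p q] [] -> /=; ring.
Qed.

Lemma conj_sign_norm a e : is_sign e -> normc (a^* * e) = normc a.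
Proof. by move=> es; rewrite normcME normcJE; case: es => ->; rewrite ?normcNE normc1 mulr1. Qed.

(** The pole of [hmap a e] lies in the lower half-plane. *)
Lemma hden_ge a e z : is_sign e -> disc a -> 0 < im z ->
  im z * normc (1 - a^* * e) <= normc (hden a e z).
Proof.
move=> es da z0.
have s1 : normc (a^* * e) < 1 by rewrite conj_sign_norm.
rewrite /hden; move: (a^* * e) s1 => s s1.
have g0 : 0 < normc (1 - s).
  rewrite normc_gt0 subr_eq0; apply: contraTneq s1 => <-.
  by rewrite normc1 ltxx.
have key : im ((1 - s)^* * ((1 - s) * z + 'i * (1 + s))) =
    im z * normc (1 - s) ^+ 2 + (1 - normc s ^+ 2).
  by rewrite !normc_sqr; case: s z {g0 s1 z0} => x y [p q] /=; ring.
have h : im z * normc (1 - s) ^+ 2 <= normc (1 - s) * normc ((1 - s) * z + 'i * (1 + s)).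
  rewrite -[X in _ <= X * _]normcJE -normcME.
  apply: le_trans (normc_Im _); apply: le_trans (ler_norm _).
  rewrite key lerDl subr_ge0 expr_le1 ?normc_ge0// ltW//.
by move: h; rewrite expr2 mulrA [normc (1 - s) * _]mulrC ler_pM2r.
Qed.

Lemma hden_gt0 a e z : is_sign e -> disc a -> 0 < im z -> 0 < normc (hden a e z).
Proof.
move=> es da z0; apply: lt_le_trans (hden_ge es da z0); rewrite mulr_gt0//.
rewrite normc_gt0 subr_eq0; apply/eqP => E.
by have := conj_sign_norm a es; rewrite -E normc1 => h; move: da; rewrite /disc /= -h ltxx.
Qed.

Lemma hmap_onem a e z : is_sign e -> disc a -> 0 < im z ->
  normc (hden a e z) ^+ 2 * (1 - normc (hmap a e z) ^+ 2) = 4 * im z * (1 - normc a ^+ 2).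
Proof.
move=> es da z0; rewrite -(hmap_identity a z es) /hmap normc_div expr_div_n mulrBr mulr1.
by rewrite mulrCA mulfV ?mulr1// expf_neq0// gt_eqF// hden_gt0.
Qed.

Lemma hmap_disc a e z : is_sign e -> disc a -> 0 < im z -> disc (hmap a e z).
Proof.
move=> es da z0; have h := hmap_onem es da z0.
have : 0 < normc (hden a e z) ^+ 2 * (1 - normc (hmap a e z) ^+ 2).
  by rewrite h !mulr_gt0// onem_sqr_gt0.
rewrite pmulr_rgt0 ?exprn_gt0 ?hden_gt0// subr_gt0 => h2.
change (is_true (normc (hmap a e z) < 1)).
by rewrite -(@ltr_pXn2r _ 2) ?nnegrE ?normc_ge0// expr1n.
Qed.

Lemma im_seg z D t : im (seg z D t) = im z + t * im D.
Proof. by rewrite /seg; case: z D => ? ? [? ?] /=; ring. Qed.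

Lemma re_seg z D t : re (seg z D t) = re z + t * re D.
Proof. by rewrite /seg; case: z D => ? ? [? ?] /=; ring. Qed.

End halfplane.

(** * Double zeros in a column of dyadic layers *)

Section generations.
Variable R : realType.
Local Notation C := R[i].
Implicit Types (z w a e : C).

Definition hgt (n : nat) : R := 2^-1 ^+ n.

Lemma hgt_gt0 n : 0 < hgt n.
Proof. by rewrite exprn_gt0// invr_gt0. Qed.

Lemma hgtS n : hgt n.+1 = hgt n / 2.
Proof. by rewrite /hgt exprS mulrC. Qed.

Lemma hgt_le m n : (m <= n)%N -> hgt n <= hgt m.
Proof. by move=> mn; rewrite /hgt; apply: ler_wiXn2l => //; lra. Qed.

Definition clamp (u : R) : R := Num.max 0 (Num.min 1 u).

Lemma clamp_le u v : u <= v -> clamp u <= clamp v /\ clamp v - clamp u <= v - u.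
Proof.
have cP x : [\/ x <= 0 /\ clamp x = 0, 0 <= x <= 1 /\ clamp x = x | 1 <= x /\ clamp x = 1].
  rewrite /clamp; have [x1|x1] := leP 1 x.
    by constructor 3; rewrite max_r.
  have [x0|x0] := leP 0 x; first by constructor 2; rewrite ltW.
  by constructor 1; rewrite ltW.
move=> uv.
case: (cP u) => -[+ ->]; case: (cP v) => -[+ ->]; do ?(case/andP=> ? ?); move=> *;
  repeat match goal with H : is_true (_ && _) |- _ => case/andP: H => * end; split; lra.
Qed.

Lemma clamp_bounds u : 0 <= clamp u <= 1.
Proof. by rewrite /clamp le_max lexx ge_max ler01 ge_min lexx. Qed.

(** A double zero and a lower zero near the same vertical line: the segment that
    joins them crosses each dyadic layer between them within bounded hyperbolic
    length, so [moebius_disconjugacy] becomes a bound on the sum of the densities of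
    these layers. *)
Lemma dyadic_disconjugacy (A0 A1 A2 f : C -> C) a e (n1 n2 : nat) z1 z2 (x0 : R) (lam : nat -> R) :
  analytic_disc f ->
  solves A0 A1 A2 f ->
  disc a -> is_sign e -> (n1 < n2)%N ->
  hgt n1.+1 < im z1 <= hgt n1 -> hgt n2.+1 < im z2 <= hgt n2 ->
  `|re z1 - x0| <= 2 * im z1 -> `|re z2 - x0| <= 2 * im z2 ->
  twofold_zeros f (hmap a e z1) -> f (hmap a e z2) = 0 ->
  (forall n, 0 <= lam n) ->
  (forall n z, (n1 <= n <= n2)%N -> hgt n.+1 <= im z <= hgt n -> `|re z - x0| <= 2 * im z ->
     Lam A0 A1 A2 (hmap a e z) <= lam n) ->
  1 / (40 * (125 * 10)) <= \sum_(i < (n2 - n1).+1) lam (n1 + i)%N.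
Proof.
move=> fa ode da es n12 /andP[y1l y1u] /andP[y2l y2u] c1 c2 f1 f2 lam0 Hlam.
set y1 := im z1 in y1l y1u c1 *; set y2 := im z2 in y2l y2u c2 *.
have y20 : 0 < y2 by apply: lt_trans y2l; exact: hgt_gt0.
have y21 : y2 < y1.
  by apply: (le_lt_trans y2u); apply: (le_lt_trans _ y1l); exact: hgt_le.
pose D := z2 - z1; have imD : im D = y2 - y1 by exact: im_sub.
have reD : re D = re z2 - re z1 by exact: re_sub.
have D0 : D != 0.
  by apply/eqP => D0; move: imD; rewrite D0 /= => h; move: y21; rewrite -subr_lt0 -h ltxx.
have z2E : z1 + D = z2 by rewrite /D addrC subrK.
have Dn : normc D <= 5 * y1.
  apply: (le_trans (normc_le1 _)); rewrite reD imD.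
  move: c1 c2; rewrite !ler_norml => /andP[? ?] /andP[? ?].
  have : `|re z2 - re z1| <= 4 * y1 by rewrite ler_norml; apply/andP; split; lra.
  have : `|y2 - y1| <= y1 by rewrite ler_norml; apply/andP; split; lra.
  lra.
pose yy t : R := y1 - t * (y1 - y2).
have imt t : im (seg z1 D t) = yy t by rewrite im_seg imD /yy -/y1; ring.
have yyt t : 0 <= t <= 1 -> (1 - t) * y1 <= yy t /\ 0 < yy t.
  move=> /andP[t0 t1]; have h : 0 <= t * y2 by rewrite mulr_ge0// ltW.
  have -> : yy t = (1 - t) * y1 + t * y2 by rewrite /yy; ring.
  split; first lra.
  have [->|tn1] := eqVneq t 1; first by rewrite subrr mul0r add0r mul1r.
  rewrite ltr_wpDr// mulr_gt0//; first by rewrite subr_gt0 lt_neqAle tn1.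
  lra.
have cone t : 0 <= t <= 1 -> `|re (seg z1 D t) - x0| <= 2 * yy t.
  move=> /andP[t0 t1]; rewrite re_seg reD.
  have -> : re z1 + t * (re z2 - re z1) - x0 = (1 - t) * (re z1 - x0) + t * (re z2 - x0) by ring.
  apply: (le_trans (ler_normD _ _)); rewrite !normrM (ger0_norm t0) ger0_norm ?subr_ge0//.
  have h1 : (1 - t) * `|re z1 - x0| <= (1 - t) * (2 * y1) by rewrite ler_wpM2l// subr_ge0.
  have h2 : t * `|re z2 - x0| <= t * (2 * y2) by rewrite ler_wpM2l.
  rewrite /yy; lra.
(* The segment leaves layer [n1 + i] at the parameter [ts i.+1]. *)
pose m := (n2 - n1).+1.
pose ts i := clamp ((y1 - hgt (n1 + i)) / (y1 - y2)).
pose b i := 125 * (normc D * (hgt (n1 + i))^-1 * lam (n1 + i)%N).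
have dy : 0 < y1 - y2 by rewrite subr_gt0.
have ratio i : (y1 - hgt (n1 + i)) / (y1 - y2) <= (y1 - hgt (n1 + i.+1)) / (y1 - y2).
  rewrite ler_pM2r ?invr_gt0// lerD2l lerN2 hgt_le// addnS//.
have inm i : (i < m)%N -> (n1 <= n1 + i <= n2)%N by rewrite /m ltnS leq_addr -{2}(subnKC (ltnW n12)) leq_add2l.
have piece i t : (i < m)%N -> ts i <= t <= ts i.+1 -> 0 <= t <= 1 ->
    hgt (n1 + i).+1 <= yy t <= hgt (n1 + i).
  move=> /inm/andP[i1 i2] /andP[t1 t2] /andP[t3 t4].
  have r1 : (y1 - hgt (n1 + i)) / (y1 - y2) <= 1.
    by rewrite ler_pdivrMr// mul1r lerD2l lerN2 (le_trans y2u)// hgt_le.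
  have r2 : 0 < (y1 - hgt (n1 + i.+1)) / (y1 - y2).
    rewrite divr_gt0// subr_gt0; apply: le_lt_trans y1l.
    by apply: hgt_le; rewrite addnS ltnS leq_addr.
  apply/andP; split.
    have : t <= (y1 - hgt (n1 + i.+1)) / (y1 - y2).
      apply: (le_trans t2); rewrite /ts /clamp ge_max (ltW r2) ge_min lexx orbT//.
    by rewrite ler_pdivlMr// addnS /yy; lra.
  have : (y1 - hgt (n1 + i)) / (y1 - y2) <= t.
    by apply: le_trans t1; rewrite /ts /clamp le_max le_min lexx r1 orbT.
  by rewrite ler_pdivrMr// /yy; lra.
have qp z : (1 - a^* * e) * z + 'i * (1 + a^* * e) = hden a e z by [].
have pp z : ((a - e) * z + 'i * (a + e)) / hden a e z = hmap a e z by [].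
have det0 := hdet_norm es da; have ga0 := onem_sqr_gt0 da.
(* The factor [5]: by the cone condition [normc D <= 5 * y1], and the height at
   the parameter [t] is at least [(1 - t) * y1]. *)
have := @moebius_disconjugacy R A0 A1 A2 f (a - e) ('i * (a + e)) (1 - a^* * e)
  ('i * (1 + a^* * e)) fa ode z1 D m ts b 5.
set det := _ - _ in det0 * => MD.
have detn : det != 0 by rewrite -normc_gt0 det0 mulr_gt0.
have S1 : 1 / 40 <= \sum_(i < m) b i * (ts i.+1 - ts i).
  apply: MD => //.
  - by lra.
  - move=> t ht; have [_ h] := yyt t ht; rewrite qp pp -normc_gt0.
    by rewrite hden_gt0 ?imt//; split => //; apply: hmap_disc; rewrite ?imt.
  - by rewrite qp pp z2E.
  - rewrite /ts addn0 /clamp max_l// ge_min; apply/orP; right.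
    by rewrite ler_pdivrMr// mul0r subr_le0.
  - by move=> i _; rewrite /ts; have [] := clamp_le (ratio i).
  - rewrite /ts /m addnS subnKC ?(ltnW n12)// /clamp min_l ?max_r//.
    rewrite ler_pdivlMr// mul1r; lra.
  - by move=> i _; rewrite /b !mulr_ge0 ?normc_ge0 ?invr_ge0 ?(ltW (hgt_gt0 _)).
  - move=> t ht; have [h1 h2] := yyt t ht; cbv zeta; rewrite qp pp.
    have imz : 0 < im (seg z1 D t) by rewrite imt.
    have hd := hden_ge es da imz; rewrite hmap_onem// imt.
    have D1 : (1 - t) * normc D <= 5 * yy t.
      case/andP: ht => t0 t1; have : (1 - t) * normc D <= (1 - t) * (5 * y1) by rewrite ler_wpM2l// subr_ge0.
      lra.
    split.
      apply: (@le_trans _ _ (5 * yy t * normc (1 - a^* * e))).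
        by rewrite ler_wpM2r ?normc_ge0.
      by rewrite -mulrA ler_pM2l// -imt.
    rewrite det0.
    apply: (@le_trans _ _ (5 * yy t * (2 * (1 - normc a ^+ 2)))).
      by rewrite ler_wpM2r// mulr_ge0// ltW.
    have : 0 <= yy t * (1 - normc a ^+ 2) by rewrite mulr_ge0// ltW.
    lra.
  - move=> i t hi ht h01; cbv zeta; rewrite qp pp.
    have [h1 h2] := yyt t h01.
    have imz : 0 < im (seg z1 D t) by rewrite imt.
    rewrite hmap_onem// det0 imt.
    have hp := piece i t hi ht h01; have /andP[p1 p2] := hp.
    have Lle : Lam A0 A1 A2 (hmap a e (seg z1 D t)) <= lam (n1 + i)%N.
      by apply: Hlam; [exact: inm|rewrite imt|rewrite imt; exact: cone].
    have L0 : 0 <= Lam A0 A1 A2 (hmap a e (seg z1 D t)) by apply: Lam_ge0; exact: hmap_disc.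
    have -> : normc D * (2 * (1 - normc a ^+ 2)) / (4 * yy t * (1 - normc a ^+ 2)) =
        normc D * (2 * yy t)^-1 by field; rewrite !gt_eqF.
    have -> : 5 * 5 ^+ 2 = 125 :> R by ring.
    rewrite /b ler_pM2l//; apply: ler_pM => //.
      by rewrite mulr_ge0 ?normc_ge0// invr_ge0; lra.
    rewrite ler_wpM2l ?normc_ge0// lef_pV2 ?posrE ?hgt_gt0//; last lra.
    by move: p1; rewrite hgtS; clear -h2; lra.
have bnd i : (i < m)%N -> b i * (ts i.+1 - ts i) <= 125 * 10 * lam (n1 + i)%N.
  move=> /inm/andP[i1 i2].
  have [c3 c4] := clamp_le (ratio i).
  have [/andP[c5 c6] /andP[c7 c8]] := (clamp_bounds ((y1 - hgt (n1 + i)) / (y1 - y2)), clamp_bounds ((y1 - hgt (n1 + i.+1)) / (y1 - y2))).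
  rewrite -!/(ts _) in c3 c4 c5 c6 c7 c8.
  set d := ts i.+1 - ts i in c4 *; have d0 : 0 <= d by rewrite subr_ge0.
  have d1 : d <= 1 by rewrite /d lerBlDr (le_trans c8)// lerDl.
  set h := hgt (n1 + i); have h0 : 0 < h by exact: hgt_gt0.
  have d2 : d <= h / 2 / (y1 - y2).
    apply: (le_trans c4); rewrite -mulrBl ler_pM2r ?invr_gt0// addnS hgtS -/h; clear -h0; lra.
  suff : normc D * h^-1 * d <= 10.
    move=> H; have -> : b i * d = 125 * (normc D * h^-1 * d) * lam (n1 + i)%N by rewrite /b -/h; ring.
    by rewrite ler_wpM2r// ler_pM2l.
  have y10 : 0 < y1 by apply: lt_trans y21.
  apply: (@le_trans _ _ (5 * y1 * h^-1 * d)).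
    by rewrite ler_wpM2r// ler_wpM2r// invr_ge0 ltW.
  (* If the height drops by a quarter or more, the layer takes up a fraction
   [2 h / y1] of the segment at most; otherwise all heights are comparable. *)
have [big|small] := leP (y1 / 4) (y1 - y2).
    have d3 : d <= h / 2 / (y1 / 4).
      apply: (le_trans d2); rewrite ler_pM2l ?divr_gt0// lef_pV2 ?posrE ?divr_gt0//.
    apply: (@le_trans _ _ (5 * y1 * h^-1 * (h / 2 / (y1 / 4)))).
      by rewrite ler_pM2l// !mulr_gt0// invr_gt0.
    have -> : 5 * y1 * h^-1 * (h / 2 / (y1 / 4)) = 10 by field; rewrite !gt_eqF.
    exact: lexx.
  have hy : y2 <= h by apply: (le_trans y2u); exact: hgt_le.
  apply: (@le_trans _ _ (5 * y1 * h^-1 * 1)).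
    by rewrite ler_pM2l// !mulr_gt0// invr_gt0.
  by rewrite mulr1 ler_pdivrMr//; clear -small hy y10; lra.
have : 1 / 40 <= 125 * 10 * \sum_(i < m) lam (n1 + i)%N.
  by apply: (le_trans S1); rewrite mulr_sumr; apply: ler_sum => i _; exact: bnd.
rewrite -/m; move: (\sum_(i < m) _) => S H.
by rewrite ler_pdivrMr ?mulr_gt0//; clear -H; lra.
Qed.

End generations.

(** * Counting along columns *)

Section counting.
Variable R : realType.

Lemma count_span (P : pred nat) (m K : nat) :
  (forall i j, P i -> P j -> (j <= i + m)%N) -> (count P (iota 0 K) <= m.+1)%N.
Proof.
move=> Pm; have [hP|] := boolP (has P (iota 0 K)); last first.
  by rewrite has_count -leqNgt leqn0 => /eqP ->.
have ex : exists i, P i by case/hasP: hP => i _ Pi; exists i.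
pose i0 := ex_minn ex; have [Pi0 mi0] : P i0 /\ forall i, P i -> (i0 <= i)%N.
  by rewrite /i0; case: ex_minnP.
rewrite -size_filter; have -> : m.+1 = size (iota i0 m.+1) by rewrite size_iota.
apply: uniq_leq_size; first by rewrite filter_uniq// iota_uniq.
move=> i; rewrite mem_filter mem_iota => /andP[Pi _].
by rewrite mem_iota mi0//= addnS ltnS Pm.
Qed.

(** The stretches between consecutive occupied layers overlap in their end layers
    only, and each of them carries a charge of at least [c]. *)
Lemma layer_count (G : pred nat) (lam : nat -> R) (c : R) (M : nat) :
  0 <= c -> (forall n, 0 <= lam n) ->
  (forall n1 n2, (n1 < n2 <= M)%N -> G n1 -> G n2 ->
     c <= \sum_(n1 <= n < n2.+1) lam n) ->
  c * (count G (iota 0 M.+1))%:R <= c + 2 * \sum_(0 <= n < M.+1) lam n.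
Proof.
move=> c0 lam0 H.
have sum0 i j : 0 <= \sum_(i <= n < j) lam n by apply: sumr_ge0.
have key l : (l <= M)%N -> G l ->
    c * (count G (iota 0 l.+1))%:R <= c + 2 * \sum_(0 <= n < l) lam n + lam l.
  elim/ltn_ind: l => l IH lM Gl.
  rewrite -addn1 iotaD count_cat /= Gl ?add0n ?addn0 natrD mulrDr mulr1.
  have [hG|] := boolP (has G (iota 0 l)); last first.
    rewrite has_count -leqNgt leqn0 => /eqP ->.
    have := sum0 0%N l; have := lam0 l; rewrite mulr0; lra.
  have ex : exists i, G i && (i < l)%N.
    by case/hasP: hG => i; rewrite mem_iota => /andP[_ il] Gi; exists i; rewrite Gi.
  have bd i : G i && (i < l)%N -> (i <= l)%N by case/andP=> _ /ltnW.
  pose p := ex_maxn ex bd; have [/andP[Gp pl] mp] : (G p && (p < l)%N) /\ forall i, G i && (i < l)%N -> (i <= p)%N.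
    by rewrite /p; case: ex_maxnP.
  have -> : count G (iota 0 l) = count G (iota 0 p.+1).
    rewrite -(subnKC pl) iotaD count_cat (_ : count G (iota (0 + p.+1) _) = 0%N) ?addn0//.
    apply/eqP; rewrite -leqn0 leqNgt -has_count; apply/hasPn => i.
    rewrite mem_iota add0n subnKC// => /andP[pi il]; apply/negP => Gi.
    by have := mp i; rewrite Gi il => /(_ isT); rewrite leqNgt pi.
  have h1 := IH p pl (leq_trans (ltnW pl) lM) Gp.
  have h2 : c <= \sum_(p <= n < l.+1) lam n by apply: H => //; rewrite pl lM.
  have e1 : \sum_(p <= n < l.+1) lam n = \sum_(p <= n < l) lam n + lam l.
    by rewrite big_nat_recr// ltnW.
  have e2 : \sum_(0 <= n < l) lam n = \sum_(0 <= n < p) lam n + \sum_(p <= n < l) lam n.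
    by rewrite (@big_cat_nat _ _ _ p)// ltnW.
  have e3 : lam p <= \sum_(p <= n < l) lam n by rewrite big_ltn// lerDl.
  rewrite e2; rewrite e1 in h2; lra.
have [hG|] := boolP (has G (iota 0 M.+1)); last first.
  rewrite has_count -leqNgt leqn0 => /eqP ->.
  have := sum0 0%N M.+1; rewrite mulr0; lra.
have ex : exists i, G i && (i <= M)%N.
  by case/hasP: hG => i; rewrite mem_iota add0n ltnS => /andP[_ il] Gi; exists i; rewrite Gi.
have bd i : G i && (i <= M)%N -> (i <= M)%N by case/andP.
pose p := ex_maxn ex bd; have [/andP[Gp pM] mp] : (G p && (p <= M)%N) /\ forall i, G i && (i <= M)%N -> (i <= p)%N.
  by rewrite /p; case: ex_maxnP.
have -> : count G (iota 0 M.+1) = count G (iota 0 p.+1).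
  have pM' : (p.+1 <= M.+1)%N by [].
  rewrite -(subnKC pM') iotaD count_cat (_ : count G (iota (0 + p.+1) _) = 0%N) ?addn0//.
  apply/eqP; rewrite -leqn0 leqNgt -has_count; apply/hasPn => i.
  rewrite mem_iota add0n subnKC// ltnS => /andP[pi il]; apply/negP => Gi.
  by have := mp i; rewrite Gi il => /(_ isT); rewrite leqNgt pi.
have h1 := key p pM Gp.
have e2 : \sum_(0 <= n < M.+1) lam n = \sum_(0 <= n < p) lam n + (lam p + \sum_(p.+1 <= n < M.+1) lam n).
  rewrite (@big_cat_nat _ _ _ p)//=; last exact: leqW.
  by congr (_ + _); rewrite big_ltn// ltnS.
have := sum0 p.+1 M.+1; have := lam0 p; rewrite e2; lra.
Qed.

Section columns.
Variables (M N2 B : nat) (W : nat -> R) (T : eqType) (s : seq T) (gen col : T -> nat)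
  (lam : nat -> nat -> R) (c : R).
Hypotheses (W0 : forall j, 0 <= W j) (lam0 : forall n k, 0 <= lam n k) (c0 : 0 <= c).
Hypotheses (genM : forall z, z \in s -> (gen z <= M)%N).
(* The box of layer [n] above the leaf [j]. *)
Let anc n j := (j %/ 2 ^ (M - n))%N.
Hypothesis packed : forall n k, (count (fun z => (gen z == n) && (col z == k)) s <= B)%N.
Hypothesis charged : forall j z1 z2, (j < N2 * 2 ^ M)%N -> z1 \in s -> z2 \in s ->
  anc (gen z1) j = col z1 -> anc (gen z2) j = col z2 -> (gen z1 < gen z2)%N ->
  c <= \sum_(gen z1 <= n < (gen z2).+1) lam n (anc n j).

Definition boxweight n k := \sum_(0 <= j < N2 * 2 ^ M | (j %/ 2 ^ (M - n))%N == k) W j.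

Let column_count j : (j < N2 * 2 ^ M)%N ->
  c * (count (fun z => anc (gen z) j == col z) s)%:R <=
  B%:R * (c + 2 * \sum_(0 <= n < M.+1) lam n (anc n j)).
Proof.
move=> hj.
pose G n := has (fun z => (gen z == n) && (anc (gen z) j == col z)) s.
have h1 := @layer_count G (fun n => lam n (anc n j)) c M c0 (fun n => lam0 _ _).
have {}h1 : c * (count G (iota 0 M.+1))%:R <= c + 2 * \sum_(0 <= n < M.+1) lam n (anc n j).
  apply: h1 => n1 n2 /andP[n12 n2M] /hasP[z1 s1 /andP[/eqP g1 /eqP u1]] /hasP[z2 s2 /andP[/eqP g2 /eqP u2]].
  by have := charged hj s1 s2 u1 u2; rewrite g1 g2 => /(_ n12).
have h2 : (count (fun z => anc (gen z) j == col z) s <= B * count G (iota 0 M.+1))%N.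
  have Lu : uniq (iota 0 M.+1) by exact: iota_uniq.
  have Lg z : z \in s -> gen z \in iota 0 M.+1 by move=> /genM; rewrite mem_iota ltnS.
  move: (iota 0 M.+1) Lu Lg => L Lu Lg.
  apply: (@leq_trans (\sum_(n <- L) count (fun z => (gen z == n) && (col z == anc n j)) s)).
    rewrite -sum1_count; under [leqRHS]eq_bigr do rewrite -sum1_count big_mkcond.
    rewrite exchange_big /= big_mkcond /= big_seq [leqRHS]big_seq.
    apply: leq_sum => z zs; case: ifP => // /eqP u.
    by rewrite (bigD1_seq (gen z)) ?Lg//= eqxx u eqxx.
  rewrite -(sum1_count _ G) [X in (_ <= B * X)%N]big_mkcond big_distrr /=; apply: leq_sum => n _.
  case: (boolP (G n)) => [_|/hasPn nG]; first by rewrite muln1.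
  rewrite muln0 leqNgt -has_count; apply/hasPn => z zs.
  apply: contra (nG z zs) => /andP[/eqP g /eqP u].
  by rewrite g eqxx /= u.
apply: (@le_trans _ _ (c * (B * count G (iota 0 M.+1))%:R)).
  by rewrite ler_wpM2l// ler_nat.
by rewrite natrM mulrCA ler_wpM2l.
Qed.

(** Counting by leaves instead of boxes: the points and the charges in a box are
    counted once for every leaf below it, with the weight of the leaf. *)
Lemma column_sum : c * \sum_(z <- s) boxweight (gen z) (col z) <=
  B%:R * (c * \sum_(0 <= j < N2 * 2 ^ M) W j +
    2 * \sum_(0 <= n < M.+1) \sum_(0 <= k < N2 * 2 ^ n) lam n k * boxweight n k).
Proof.
have E1 : c * \sum_(z <- s) boxweight (gen z) (col z) =
    \sum_(0 <= j < N2 * 2 ^ M) W j * (c * (count (fun z => anc (gen z) j == col z) s)%:R).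
  rewrite mulr_sumr; under eq_bigr do rewrite /boxweight big_mkcond mulr_sumr.
  rewrite exchange_big /=; apply: eq_bigr => j _.
  rewrite -sum1_count natr_sum mulrCA !mulr_sumr [RHS]big_mkcond /=.
  by apply: eq_bigr => z _; rewrite /anc; case: ifP => _; rewrite ?mulr0 ?mulr1.
have E2 : \sum_(0 <= n < M.+1) \sum_(0 <= k < N2 * 2 ^ n) lam n k * boxweight n k =
    \sum_(0 <= j < N2 * 2 ^ M) W j * \sum_(0 <= n < M.+1) lam n (anc n j).
  under [RHS]eq_bigr do rewrite mulr_sumr.
  rewrite [RHS]exchange_big /= big_nat [RHS]big_nat; apply: eq_bigr => n /andP[_ nM].
  under eq_bigr do rewrite /boxweight big_mkcond mulr_sumr.
  rewrite exchange_big /= big_nat [RHS]big_nat; apply: eq_bigr => j /andP[_ jM].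
  have aj : (anc n j < N2 * 2 ^ n)%N.
    rewrite /anc ltn_divLR ?expn_gt0// -mulnA -expnD subnKC//.
  rewrite (bigD1_seq (anc n j)) ?iota_uniq ?mem_index_iota//=.
  rewrite eqxx big1 ?addr0 1?mulrC// => k /negbTE.
  by rewrite eq_sym /anc => ->; rewrite mulr0.
rewrite E1 E2 mulr_sumr mulr_sumr -big_split /= mulr_sumr big_nat [leRHS]big_nat.
apply: ler_sum => j /andP[_ jM].
have := ler_wpM2l (W0 j) (column_count jM).
move=> /le_trans; apply; rewrite le_eqVlt; apply/orP; left; apply/eqP; ring.
Qed.

End columns.
End counting.

(** * Hyperbolic distance and Poisson kernel in a chart *)

Section hyperbolic.
Variable R : realType.
Local Notation C := R[i].
Implicit Types (z w a b e : C).

Lemma pdist_phi a z : pdist a z = normc (phi a z).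
Proof. by rewrite /phi normc_div. Qed.

(** The polarization of [hmap_identity]. *)
Lemma hmap_cross a e z w : is_sign e ->
  (hden a e z)^* * hden a e w - (hnum a e z)^* * hnum a e w =
  - (2 * 'i) * (1 - normc a ^+ 2)%:C * (w - z^*).
Proof.
rewrite /hden /hnum normc_sqr; case: a z w => x y [p q] [r s] [] -> /=;
  apply/eqP; rewrite eq_complex /=; apply/andP; split; apply/eqP; ring.
Qed.

Lemma hmap_pdist a e z w : is_sign e -> disc a -> 0 < im z -> 0 < im w ->
  1 - pdist (hmap a e z) (hmap a e w) ^+ 2 = 4 * im z * im w / normc (w - z^*) ^+ 2.
Proof.
move=> es da z0 w0.
have dz := hmap_disc es da z0; have dw := hmap_disc es da w0.
rewrite pdist_phi onem_phi//.
have hz := hden_gt0 es da z0; have hw := hden_gt0 es da w0.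
have oz := hmap_onem es da z0; have ow := hmap_onem es da w0.
have ga := onem_sqr_gt0 da.
have E : normc (hden a e z) * normc (hden a e w) * normc (1 - (hmap a e z)^* * hmap a e w) =
    2 * (1 - normc a ^+ 2) * normc (w - z^*).
  have : normc ((hden a e z)^* * hden a e w - (hnum a e z)^* * hnum a e w) =
      2 * (1 - normc a ^+ 2) * normc (w - z^*).
    by rewrite hmap_cross// normcME [normc (_ * _%:C)]normcME normcNE normcME normci
      normc_nat mulr1 normcR ger0_norm// ltW.
  move=> <-; rewrite -[normc (hden a e z)]normcJE -!normcME; congr normc.
  have z1 : hden a e z != 0 by rewrite -normc_gt0.
  have w1 : hden a e w != 0 by rewrite -normc_gt0.
  have z2 : (hden a e z)^* != 0 by rewrite conjc_eq0.
  rewrite /hmap rmorphM /= fmorphV; move: z1 w1 z2; move: (hden a e z) (hden a e w) => p q.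
  by move=> p0 q0 pc0; field; rewrite pc0 q0.
have p0 : 0 < normc (1 - (hmap a e z)^* * hmap a e w) by exact: den_gt0.
move: p0 E oz ow; move: (normc (hden a e z)) (normc (hden a e w)) hz hw
  (1 - normc (hmap a e z) ^+ 2) (1 - normc (hmap a e w) ^+ 2)
  (normc (1 - _)) (normc (w - _)) (1 - normc a ^+ 2) ga.
move=> p q p0 q0 u v r d g g0 r0 E oz ow.
have d0 : 0 < d.
  have : 0 < 2 * g * d by rewrite -E !mulr_gt0.
  by rewrite pmulr_rgt0// mulr_gt0.
have -> : u = 4 * im z * g / p ^+ 2 by rewrite -oz; field; rewrite gt_eqF.
have -> : v = 4 * im w * g / q ^+ 2 by rewrite -ow; field; rewrite gt_eqF.
have -> : r = 2 * g * d / (p * q) by rewrite -E; field; rewrite !gt_eqF.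
by field; rewrite !gt_eqF.
Qed.

Lemma normc_conjB z w : normc (w - z^*) ^+ 2 = normc (w - z) ^+ 2 + 4 * im z * im w.
Proof. by rewrite !normc_sqr; case: z w => p q [r s] /=; ring. Qed.

Lemma hmap_pdist_sqr a e z w : is_sign e -> disc a -> 0 < im z -> 0 < im w ->
  pdist (hmap a e z) (hmap a e w) ^+ 2 * normc (w - z^*) ^+ 2 = normc (w - z) ^+ 2.
Proof.
move=> es da z0 w0; have := hmap_pdist es da z0 w0.
have c0 : 0 < normc (w - z^*) ^+ 2.
  by rewrite normc_conjB ltr_wpDl ?sqr_ge0// !mulr_gt0.
move=> /(congr1 (fun x => x * normc (w - z^*) ^+ 2)).
rewrite mulfVK ?gt_eqF// normc_conjB; move: (normc (w - z) ^+ 2) => d E.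
by move: E; rewrite mulrBl mul1r => E; lra.
Qed.

(** [a] is the image of ['i], so the weight [1 - |phi a|^2] becomes the Poisson
    kernel of the half-plane. *)
Lemma hmap_onem_phi a e z : is_sign e -> disc a -> 0 < im z ->
  1 - normc (phi a (hmap a e z)) ^+ 2 = 4 * im z / (re z ^+ 2 + (im z + 1) ^+ 2).
Proof.
move=> es da z0.
have i1 : im ('i : C) = 1 by [].
have i0 : 0 < im ('i : C) by rewrite i1.
have ha : hmap a e 'i = a.
  rewrite /hmap /hnum /hden.
  have -> : (a - e) * 'i + 'i * (a + e) = a * (2 * 'i) by ring.
  have -> : (1 - a^* * e) * 'i + 'i * (1 + a^* * e) = 2 * 'i by ring.
  by rewrite mulfK// -normc_gt0 normcME normci normc_nat mulr1.
have := hmap_pdist es da i0 z0; rewrite ha pdist_phi i1 => ->.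
congr (_ / _); first by rewrite mulr1.
by rewrite normc_sqr; case: z {z0} => p q /=; ring.
Qed.

(** The preimage is [- i (X + e Y) / (X - e Y)]; its height tells which of the
    two signs is suitable. *)
Lemma hmap_solve a e b : is_sign e -> disc a -> disc b ->
  let X := a - b in let Y := 1 - a^* * b in
  exists z, [/\ hmap a e z = b, 0 < im z &
    normc (X - e * Y) ^+ 2 * im z = normc Y ^+ 2 - normc X ^+ 2].
Proof.
move=> es da db X Y.
have id := phi_identity a b; rewrite -/X -/Y in id.
have pos : 0 < normc Y ^+ 2 - normc X ^+ 2 by rewrite id mulr_gt0// onem_sqr_gt0.
have D0 : X - e * Y != 0.
  apply/eqP => /eqP; rewrite subr_eq0 => /eqP E; move: pos.
  by rewrite E normcME; case: es => ->; rewrite ?normcNE normc1 mul1r subrr ltxx.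
have Dn : 0 < normc (X - e * Y) by rewrite normc_gt0.
pose z : C := - 'i * (X + e * Y) / (X - e * Y).
have zD : z * (X - e * Y) = - 'i * (X + e * Y) by rewrite /z mulfVK.
have imz : normc (X - e * Y) ^+ 2 * im z = normc Y ^+ 2 - normc X ^+ 2.
  have n2 : (normc (X - e * Y) ^+ 2)%:C = (X - e * Y)^* * (X - e * Y).
    by rewrite normc_sqr; case: (X - e * Y) => p q; apply/eqP; rewrite eq_complex /=;
      apply/andP; split; apply/eqP; ring.
  have -> : normc (X - e * Y) ^+ 2 * im z = im ((normc (X - e * Y) ^+ 2)%:C * z).
    by case: z {zD} => p q /=; ring.
  rewrite n2 -mulrA [_ * z]mulrC zD !normc_sqr.
  by case: es => ->; case: X Y {id pos D0 Dn z zD n2} => p q [r s] /=; ring.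
have iz : 0 < im z.
  by move: pos; rewrite -imz pmulr_rgt0// exprn_gt0.
exists z; split => //.
have h := hden_gt0 es da iz; rewrite /hmap.
suff -> : hnum a e z = b * hden a e z by rewrite mulfK// -normc_gt0.
have : z * (X - e * Y) - (- 'i * (X + e * Y)) = 0 by rewrite zD subrr.
rewrite /hnum /hden /X /Y => E; apply/eqP; rewrite -subr_eq0 -E; apply/eqP; ring.
Qed.

Lemma hmap_onto a e b : is_sign e -> disc a -> disc b ->
  exists z, 0 < im z /\ hmap a e z = b.
Proof. by move=> es da db; have [z [h1 h2 _]] := hmap_solve es da db; exists z. Qed.

Lemma sign_choice (X Y : C) :
  exists e, is_sign e /\ normc Y ^+ 2 - normc X ^+ 2 <= normc (X - e * Y) ^+ 2.
Proof.
have [h|h] := leP (re X * re Y + im X * im Y) 0.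
  exists 1; split; first by left.
  rewrite mul1r !normc_sqr re_sub im_sub !sqrrB.
  have := sqr_ge0 (re X); have := sqr_ge0 (im X); lra.
exists (-1); split; first by right.
rewrite mulN1r opprK !normc_sqr.
have -> : re (X + Y) = re X + re Y by case: X Y {h} => ? ? [].
have -> : im (X + Y) = im X + im Y by case: X Y {h} => ? ? [].
rewrite !sqrrD; have := sqr_ge0 (re X); have := sqr_ge0 (im X); lra.
Qed.

(** The two charts differ by an inversion, so in one of them the given point has
    height at most one. *)
Lemma hmap_onto_low a b : disc a -> disc b ->
  exists e z, [/\ is_sign e, 0 < im z <= 1 & hmap a e z = b].
Proof.
move=> da db; pose X := a - b; pose Y := 1 - a^* * b.
have [e [es He]] := sign_choice X Y.
have [z [h1 h2 h3]] := hmap_solve es da db; exists e, z; split => //; rewrite h2 /=.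
rewrite -/X -/Y in h3; rewrite -h3 in He.
have n0 : 0 < normc (X - e * Y) ^+ 2.
  rewrite lt_neqAle sqr_ge0 andbT eq_sym; apply/eqP => n0.
  move: h3; rewrite n0 mul0r => /esym/eqP; rewrite phi_identity.
  by rewrite gt_eqF// mulr_gt0// onem_sqr_gt0.
by move: He; rewrite -[leRHS]mulr1 ler_pM2l.
Qed.

Lemma atan_incr (x h : R) : 0 < h ->
  exists t, [/\ x < t, t < x + h & atan (x + h) - atan x = h / (1 + t ^+ 2)].
Proof.
move=> h0; have xh : x < x + h by rewrite ltrDl.
have datan (s : R) : s \in `]x, x + h[ -> is_derive s 1 atan (1 + s ^+ 2)^-1.
  by move=> _; exact: is_derive1_atan.
have catan : {within `[x, x + h], continuous (@atan R)}.
  by apply: derivable_within_continuous => z _; exact: ex_derive.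
have [t + ->] := MVT xh datan catan.
rewrite in_itv /= => /andP[t1 t2]; exists t; split => //.
by rewrite addrAC subrr add0r mulrC.
Qed.

(** On a box and on its enlargement the angle under which the side of the box is
    seen is comparable to the Poisson kernel. *)
Lemma angle_le_poisson (x0 x y h : R) : 0 < h <= 1 -> h / 2 <= y <= h ->
  x0 - 2 * h <= x <= x0 + 3 * h ->
  atan (x0 + h) - atan x0 <= 7 * (4 * y / (x ^+ 2 + (y + 1) ^+ 2)).
Proof.
move=> /andP[h0 h1] /andP[y1 y2] /andP[x1 x2]; have [t [t1 t2 ->]] := atan_incr x0 h0.
have d1 : 0 < 1 + t ^+ 2 by have := sqr_ge0 t; lra.
have d2 : 0 < x ^+ 2 + (y + 1) ^+ 2.
  by rewrite ltr_wpDl ?sqr_ge0// exprn_gt0; lra.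
rewrite mulrA ler_pdivrMr// mulrAC ler_pdivlMr//.
have e1 : (x - t) ^+ 2 <= 9.
  have : `|x - t| <= 3 by rewrite ler_norml; apply/andP; split; lra.
  rewrite -(@ler_pXn2r _ 2) ?nnegrE// real_normK ?num_real//; lra.
have e2 : (y + 1) ^+ 2 <= 4.
  have : 0 <= (1 - y) * (3 + y) by apply: mulr_ge0; lra.
  lra.
have e3 : x ^+ 2 <= 10 * (t ^+ 2 + 1).
  have := sqr_ge0 (3 * t - (x - t) / 3); lra.
have e4 : x ^+ 2 + (y + 1) ^+ 2 <= 14 * (1 + t ^+ 2) by have := sqr_ge0 t; lra.
have e5 : h * (x ^+ 2 + (y + 1) ^+ 2) <= h * (14 * (1 + t ^+ 2)) by rewrite ler_pM2l.
have e6 : h / 2 * (1 + t ^+ 2) <= y * (1 + t ^+ 2) by rewrite ler_pM2r.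
lra.
Qed.

Lemma poisson_le_angle (x0 x y h : R) : 0 < h <= 1 -> 0 < y <= h -> x0 <= x <= x0 + h ->
  4 * y / (x ^+ 2 + (y + 1) ^+ 2) <= 12 * (atan (x0 + h) - atan x0).
Proof.
move=> /andP[h0 h1] /andP[y1 y2] /andP[x1 x2]; have [t [t1 t2 ->]] := atan_incr x0 h0.
have d1 : 0 < 1 + t ^+ 2 by have := sqr_ge0 t; lra.
have e2 : 1 <= (y + 1) ^+ 2 by have := sqr_ge0 y; lra.
have d2 : 0 < x ^+ 2 + (y + 1) ^+ 2 by have := sqr_ge0 x; lra.
rewrite mulrA ler_pdivrMr// mulrAC ler_pdivlMr//.
have e1 : (x - t) ^+ 2 <= 1.
  have : `|x - t| <= 1 by rewrite ler_norml; apply/andP; split; lra.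
  rewrite -(@ler_pXn2r _ 2) ?nnegrE// real_normK ?num_real// expr1n//.
have e3 : t ^+ 2 <= 2 * x ^+ 2 + 2.
  have := sqr_ge0 (x - (t - x)); lra.
have e4 : 1 + t ^+ 2 <= 3 * (x ^+ 2 + (y + 1) ^+ 2) by have := sqr_ge0 x; lra.
have e5 : y * (1 + t ^+ 2) <= y * (3 * (x ^+ 2 + (y + 1) ^+ 2)) by rewrite ler_pM2l.
have e6 : y * (x ^+ 2 + (y + 1) ^+ 2) <= h * (x ^+ 2 + (y + 1) ^+ 2) by rewrite ler_pM2r.
lra.
Qed.

(** A supremum over a box need not be attained; half of it is enough to choose a
    sample point. *)
Lemma near_sup (T : Type) (P : set T) (g : T -> R) (L : R) :
  (exists x, P x) -> (forall x, P x -> 0 <= g x <= L) ->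
  exists2 x, P x & forall y, P y -> g y <= 2 * g x.
Proof.
move=> [x0 Px0] gL.
have [[y [Py gy]]|N] := pselect (exists y, P y /\ 0 < g y); last first.
  exists x0 => // y Py; have [h _] := andP (gL _ Py); have [h0 _] := andP (gL _ Px0).
  have : ~ 0 < g y by move=> h'; apply: N; exists y.
  by move/negP; rewrite -leNgt; lra.
pose S := [set g x | x in P].
have hS : has_sup S.
  split; first by exists (g y), y.
  by exists L => _ [x Px <-]; have /andP[] := gL _ Px.
have ub x : P x -> g x <= sup S by move=> Px; apply: ub_le_sup; [case: hS|exists x].
have s0 : 0 < sup S by apply: lt_le_trans gy (ub _ Py).
have [_ [x Px <-] hx] := @sup_adherent _ S (sup S / 2) ltac:(by rewrite divr_gt0) hS.
by exists x => // w /ub; lra.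
Qed.

Definition Lam_sampled (A0 A1 A2 : C -> C) (K : R) :=
  forall a (s : seq C) (N : nat), disc a -> (forall z, z \in s -> disc z) ->
    (forall w, disc w -> (count (fun z => (normc (w - z) < (1 - normc z) / 4)%R) s <= N)%N) ->
    \sum_(z <- s) Lam A0 A1 A2 z * (1 - normc (phi a z) ^+ 2) <= K * N%:R.

Lemma Lam_sample (A0 A1 A2 : C -> C) :
  analytic_disc A0 -> analytic_disc A1 -> analytic_disc A2 ->
  weighted_carleson 1 A0 -> weighted_carleson 0 A1 -> weighted_carleson (-1) A2 ->
  exists2 K : R, 0 <= K & Lam_sampled A0 A1 A2 K.
Proof.
move=> h0 h1 h2 c0 c1 c2.
have [K0 K00 H0] := @carleson_sample _ 1 A0 isT h0 c0.
have [K1 K10 H1] := @carleson_sample _ 0 A1 isT h1 c1.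
have [K2 K20 H2] := @carleson_sample _ (-1) A2 isT h2 c2.
exists (K0 + K1 + K2); first by rewrite !addr_ge0.
move=> a s N da hs hov.
apply: le_trans (_ : K0 * N%:R + K1 * N%:R + K2 * N%:R <= _); last by rewrite !mulrDl.
apply: le_trans (lerD (lerD (H0 a s N da hs hov) (H1 a s N da hs hov)) (H2 a s N da hs hov)).
by rewrite -!big_split /=; apply: ler_sum => z _; rewrite /Lam -!mulrDl lexx.
Qed.

(** The sample consisting of the single point [w], seen from [a = w]. *)
Lemma Lam_bounded (A0 A1 A2 : C -> C) :
  analytic_disc A0 -> analytic_disc A1 -> analytic_disc A2 ->
  weighted_carleson 1 A0 -> weighted_carleson 0 A1 -> weighted_carleson (-1) A2 ->
  exists L : R, forall w, disc w -> Lam A0 A1 A2 w <= L.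
Proof.
move=> h0 h1 h2 c0 c1 c2; have [K K0 H] := Lam_sample h0 h1 h2 c0 c1 c2.
exists K => w dw; have := H w [:: w] 1%N dw.
rewrite big_seq1 /phi subrr mul0r normc0 expr0n /= subr0 !mulr1; apply.
  by move=> z; rewrite inE => /eqP ->.
by move=> z _; rewrite addn0 leq_b1.
Qed.

End hyperbolic.

(** * Packing and overlap of boxes *)

Section boxes.
Variable R : realType.
Local Notation C := R[i].
Implicit Types (z w a b e : C).

Definition gridx (J : nat) (h : R) (k : nat) : R := k%:R * h - J%:R.

Lemma gridxS J h k : gridx J h k.+1 = gridx J h k + h.
Proof. by rewrite /gridx -natr1; ring. Qed.

Lemma layer_exists (y : R) : 0 < y <= 1 -> exists n, hgt R n.+1 < y <= hgt R n.
Proof.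
move=> /andP[y0 y1].
have h n : hgt R n * n.+1%:R <= 1.
  elim: n => [|n IH]; first by rewrite /hgt expr0 mulr1.
  rewrite hgtS -[n.+2]addn1 natrD; have := hgt_gt0 R n.
  have : 1 <= n.+1%:R :> R by rewrite ler1n.
  have g0 := hgt_gt0 R n => n1 _; have := ler_wpM2l (ltW g0) n1; lra.
have ex : exists n, hgt R n < y.
  exists (Num.truncn y^-1); have := truncnS_gt y^-1; rewrite invf_plt ?posrE//.
  apply: le_lt_trans; rewrite -[leRHS]mul1r -ler_pdivrMr ?invr_gt0// invrK; exact: h.
case: (ex_minnP ex) => -[|n] hn mn; first by move: hn; rewrite /hgt expr0 ltNge y1.
exists n; rewrite hn /= leNgt; apply/negP => /mn; by rewrite ltnn.
Qed.

(** A square grid of mesh [h / P] separates the points, as twice the mesh is at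
    most [del * h]. *)
Lemma packing (s : seq C) (del x h : R) (P : nat) : 0 < h -> 2 <= del * P%:R -> uniq s ->
  (forall z, z \in s -> x <= re z < x + h /\ h / 2 < im z <= h) ->
  (forall z w, z \in s -> w \in s -> z != w -> del * h < normc (w - z)) ->
  (size s <= P * P)%N.
Proof.
move=> h0 dP us box sep.
have P0 : (0 < P)%N by case: P dP => //; rewrite mulr0 => ?; exfalso; lra.
have PR : 0 < P%:R :> R by rewrite ltr0n.
pose m := h / P%:R; have m0 : 0 < m by rewrite divr_gt0.
have hm : h = m * P%:R by rewrite /m mulfVK ?gt_eqF.
pose key z := (Num.truncn ((re z - x) / m), Num.truncn ((im z - h / 2) / m)).
have inP t : 0 <= t < h -> (Num.truncn (t / m) < P)%N /\
    (Num.truncn (t / m))%:R * m <= t < (Num.truncn (t / m))%:R * m + m.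
  move=> /andP[t0 th]; have tm : 0 <= t / m by rewrite divr_ge0// ltW.
  have /andP[h1 h2] := truncn_itv tm; split.
    by rewrite -(ltr_nat R); apply: le_lt_trans h1 _; rewrite ltr_pdivrMr// mulrC -hm.
  rewrite -ler_pdivlMr// h1 /=; move: h2; rewrite ltr_pdivrMr// -natr1; lra.
have inj : {in s &, injective key}.
  move=> z w zs ws [k1 k2]; apply/eqP; apply/negPn/negP => zw.
  have [/andP[a1 a2] /andP[a3 a4]] := box z zs; have [/andP[b1 b2] /andP[b3 b4]] := box w ws.
  have [_ /andP[c1 c2]] := inP (re z - x) ltac:(by apply/andP; split; lra).
  have [_ /andP[d1 d2]] := inP (re w - x) ltac:(by apply/andP; split; lra).
  have [_ /andP[e1 e2]] := inP (im z - h / 2) ltac:(by apply/andP; split; lra).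
  have [_ /andP[f1 f2]] := inP (im w - h / 2) ltac:(by apply/andP; split; lra).
  rewrite -k1 in d1 d2; rewrite -k2 in f1 f2.
  have := sep z w zs ws zw; apply/negP; rewrite -leNgt.
  apply: (le_trans (normc_le1 _)); rewrite re_sub im_sub.
  have g1 : `|re w - re z| <= m by rewrite ler_norml; clear -c1 c2 d1 d2; apply/andP; split; lra.
  have g2 : `|im w - im z| <= m by rewrite ler_norml; clear -e1 e2 f1 f2; apply/andP; split; lra.
  apply: le_trans (lerD g1 g2) _.
  have : 2 * m <= del * P%:R * m by rewrite ler_pM2r.
  rewrite -mulrA [P%:R * m]mulrC -hm; lra.
rewrite -(size_map key).
have -> : (P * P = size [seq (i, j) | i <- iota 0 P, j <- iota 0 P])%N by rewrite size_allpairs !size_iota.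
apply: uniq_leq_size; first by rewrite map_inj_in_uniq.
move=> _ /mapP[z zs ->]; have [/andP[a1 a2] /andP[a3 a4]] := box z zs.
apply/allpairsP; exists (key z); rewrite /key /= !mem_iota /= !add0n.
have [-> _] := inP (re z - x) ltac:(by apply/andP; split; lra).
by have [-> _] := inP (im z - h / 2) ltac:(by apply/andP; split; lra).
Qed.

Lemma hmap_separation a e z w (del h : R) : is_sign e -> disc a -> 0 < h ->
  h / 2 < im z -> h / 2 < im w -> 0 < del ->
  del < pdist (hmap a e z) (hmap a e w) -> del * h < normc (w - z).
Proof.
move=> es da h0 hz hw del0 hd.
have z0 : 0 < im z by lra.
have w0 : 0 < im w by lra.
have := hmap_pdist_sqr es da z0 w0; move: (pdist _ _) hd => p hd.
have p0 : 0 < p by apply: lt_trans hd.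
rewrite -exprMn => /eqP; rewrite eqrXn2 ?mulr_ge0 ?normc_ge0 ?(ltW p0)// => /eqP <-.
have : h < normc (w - z^*).
  apply: lt_le_trans (normc_Im _); apply: lt_le_trans (ler_norm _).
  have -> : im (w - z^*) = im w + im z by case: w z {hz hw z0 w0} => ? ? [? ?] /=; ring.
  lra.
by move=> hh; apply: ltr_pM => //; rewrite ltW.
Qed.

(** Euclidean nearness relative to the boundary implies [pdist < 1 / 4], which is
    an inequality between the coordinates in the chart. *)
Lemma near_hmap a e z w : is_sign e -> disc a -> 0 < im z -> 0 < im w ->
  normc (hmap a e w - hmap a e z) < (1 - normc (hmap a e z)) / 4 ->
  16 * ((re w - re z) ^+ 2 + (im w - im z) ^+ 2) < (re w - re z) ^+ 2 + (im w + im z) ^+ 2.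
Proof.
move=> es da z0 w0 hn.
have dz := hmap_disc es da z0; have dw := hmap_disc es da w0.
have dd := den_ge dz dw; have d0 := den_gt0 dz dw.
have hp : pdist (hmap a e z) (hmap a e w) < 1 / 4.
  rewrite /pdist ltr_pdivrMr// normcB; apply: (lt_le_trans hn).
  have := den_ge dw dz; rewrite (_ : normc (1 - (hmap a e w)^* * hmap a e z) =
    normc (1 - (hmap a e z)^* * hmap a e w)); last first.
    rewrite -normcJE rmorphB rmorphM rmorph1 /= conjcK mulrC //.
  lra.
have p0 : 0 <= pdist (hmap a e z) (hmap a e w) by rewrite /pdist divr_ge0 ?normc_ge0.
have := hmap_pdist_sqr es da z0 w0.
have -> : normc (w - z) ^+ 2 = (re w - re z) ^+ 2 + (im w - im z) ^+ 2.
  by rewrite normc_sqr re_sub im_sub.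
have -> : normc (w - z^*) ^+ 2 = (re w - re z) ^+ 2 + (im w + im z) ^+ 2.
  by rewrite normc_sqr; case: w z {hn dz dw dd d0 hp p0 w0 z0} => ? ? [? ?] /=; ring.
move: (pdist _ _) hp p0 => p hp p0 <-.
have : p ^+ 2 < 1 / 16.
  have : p * p < 1 / 4 * (1 / 4) by apply: ltr_pM.
  by rewrite expr2; lra.
have D0 : 0 < (re w - re z) ^+ 2 + (im w + im z) ^+ 2.
  by rewrite ltr_wpDl ?sqr_ge0// exprn_gt0// addr_gt0.
move=> hp2; have := hp2; rewrite -(ltr_pM2r D0); lra.
Qed.

(** Hyperbolically close boxes lie in three consecutive layers and, in each layer,
    in eight consecutive columns. *)
Lemma overlap_count (J : nat) (q : nat -> nat -> C) (w : C) (M : nat) (K : nat -> nat) :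
  0 < im w ->
  (forall n k, hgt R n.+1 <= im (q n k) <= hgt R n /\
    gridx J (hgt R n) k - 2 * hgt R n <= re (q n k) <= gridx J (hgt R n) k + 3 * hgt R n) ->
  (count (fun z => (16 * ((re w - re z) ^+ 2 + (im w - im z) ^+ 2) <
       (re w - re z) ^+ 2 + (im w + im z) ^+ 2)%R)
     [seq q n k | n <- iota 0 M, k <- iota 0 (K n)] <= 24)%N.
Proof.
move=> w0 Hq; set near := fun z => _.
have hts n k : near (q n k) -> hgt R n < 10 / 3 * im w /\ 3 / 5 * im w < hgt R n.
  rewrite /near; have [/andP[h1 h2] _] := Hq n k; rewrite hgtS in h1 => h.
  have : (4 * (im w - im (q n k))) ^+ 2 < (im w + im (q n k)) ^+ 2.
    have := sqr_ge0 (re w - re (q n k)); lra.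
  have g0 := hgt_gt0 R n.
  have s0 : 0 <= im w + im (q n k) by lra.
  rewrite -(@real_normK _ (4 * _)) ?num_real// ltr_pXn2r ?nnegrE ?normr_ge0// ltr_norml.
  by move=> /andP[]; split; lra.
have cols n k : near (q n k) -> `|re w - re (q n k)| <= hgt R n.
  move=> hn; have [g1 g2] := hts _ _ hn; move: hn; rewrite /near.
  have [/andP[h1 h2] _] := Hq n k; rewrite hgtS in h1 => h.
  have g0 := hgt_gt0 R n.
  rewrite -(@ler_pXn2r _ 2) ?nnegrE ?normr_ge0 ?(ltW g0)// real_normK ?num_real//.
  have : (im w + im (q n k)) ^+ 2 <= (8 / 3 * hgt R n) ^+ 2.
    rewrite ler_pXn2r ?nnegrE//; [|lra|lra].
    lra.
  have := sqr_ge0 (im w - im (q n k)); have := sqr_ge0 (hgt R n); lra.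
pose G n := has (fun k => near (q n k)) (iota 0 (K n)).
apply: (@leq_trans (\sum_(n <- iota 0 M) count (fun k => near (q n k)) (iota 0 (K n)))%N).
  rewrite -sum1_count big_mkcond big_allpairs_dep /=; apply: leq_sum => n _.
  by rewrite -sum1_count [leqRHS]big_mkcond.
apply: (@leq_trans (\sum_(n <- iota 0 M | G n) 8)%N).
  rewrite [leqRHS]big_mkcond /=; apply: leq_sum => n _; rewrite /G has_count.
  case: posnP => [->//|_].
  apply: (@count_span _ 7) => i j /cols ni /cols nj.
  have [_ /andP[i1 i2]] := Hq n i; have [_ /andP[j1 j2]] := Hq n j.
  move: ni nj; rewrite !ler_norml => /andP[? ?] /andP[? ?].
  have : gridx J (hgt R n) j - gridx J (hgt R n) i <= 7 * hgt R n by lra.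
  rewrite /gridx => hh; have : (j%:R - i%:R) * hgt R n <= 7 * hgt R n by lra.
  by rewrite ler_pM2r ?hgt_gt0// lerBlDl -natrD ler_nat.
rewrite big_const_seq iter_addn_0 -[24%N]/(8 * 3)%N leq_mul2l /=.
apply: (@count_span _ 2) => i j /hasP[ki _ /hts[i1 i2]] /hasP[kj _ /hts[j1 j2]].
rewrite leqNgt; apply/negP => ij.
have := hgt_le R ij; rewrite addn2 !hgtS; lra.
Qed.

End boxes.

(** * Poisson sums over the double zeros *)

Section chart.
Variable R : realType.
Local Notation C := R[i].
Implicit Types (z w a b e : C).

Definition angle (J M j : nat) : R := atan (gridx J (hgt R M) j.+1) - atan (gridx J (hgt R M) j).

Lemma gridx_refine (J M n k : nat) : (n <= M)%N ->
  gridx J (hgt R M) (k * 2 ^ (M - n)) = gridx J (hgt R n) k.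
Proof.
move=> nM; rewrite /gridx natrM natrX; congr (_ - _); rewrite -mulrA; congr (_ * _).
rewrite -{2}(subnKC nM) /hgt exprD mulrCA -exprMn mulfV ?expr1n ?mulr1//.
Qed.

Lemma gridx_le (J : nat) (h : R) i j : 0 < h -> (i <= j)%N -> gridx J h i <= gridx J h j.
Proof. by move=> h0 ij; rewrite /gridx lerD2r ler_pM2r// ler_nat. Qed.

Lemma angle_ge0 J M j : 0 <= angle J M j.
Proof. by rewrite subr_ge0 le_atan// gridx_le// hgt_gt0. Qed.

Lemma divn_eqE d j k : (0 < d)%N -> (j %/ d == k)%N = (k * d <= j)%N && (j < k.+1 * d)%N.
Proof. by move=> d0; rewrite eqn_leq andbC leq_divRL//; congr (_ && _); rewrite -ltnS ltn_divLR. Qed.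

Lemma box_angle (J M n k : nat) : (n <= M)%N -> (k < 2 * J * 2 ^ n)%N ->
  boxweight M (2 * J) (angle J M) n k =
  atan (gridx J (hgt R n) k + hgt R n) - atan (gridx J (hgt R n) k).
Proof.
move=> nM kJ; rewrite /boxweight; set d := (2 ^ (M - n))%N.
have d0 : (0 < d)%N by rewrite expn_gt0.
have kd : (k.+1 * d <= 2 * J * 2 ^ M)%N.
  by rewrite -(subnKC nM) expnD mulnA leq_mul2r kJ orbT.
have kk : (k * d <= k.+1 * d)%N by rewrite leq_mul2r leqnSn orbT.
under eq_bigl do rewrite divn_eqE//.
rewrite -gridxS -!(gridx_refine J _ nM) -/d.
rewrite -(telescope_sumr (fun j => atan (gridx J (hgt R M) j)) kk).
rewrite (big_nat_widen _ _ _ _ _ kd) [RHS](big_nat_widenl _ 0%N)//.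
by apply: eq_bigl => j; rewrite /= andbC.
Qed.

Lemma angle_total J M N : \sum_(0 <= j < N) angle J M j <= pi.
Proof.
rewrite (telescope_sumr (fun j => atan (gridx J (hgt R M) j)))//.
have := @atan_gtNpi2 R (gridx J (hgt R M) 0); have := @atan_ltpi2 R (gridx J (hgt R M) N); lra.
Qed.

(** The weight of a double zero is comparable to the angle under which its
    box is seen from ['i].  Counting by columns bounds the sum of these angles by
    a constant plus the sum of [Lam] over one sample point for each box, weighted
    with the angle of the box, that is, with the weight of the sample point. *)
Lemma chart_sum (A0 A1 A2 f : C -> C) (del L K : R) :
  analytic_disc f ->
  solves A0 A1 A2 f ->
  0 < del ->
  (forall a b, twofold_zeros f a -> twofold_zeros f b -> a != b -> del < pdist a b) ->
  (forall w, disc w -> Lam A0 A1 A2 w <= L) ->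
  0 <= K -> Lam_sampled A0 A1 A2 K ->
  exists B : R, forall a e (zs : seq C), disc a -> is_sign e -> uniq zs ->
    (forall z, z \in zs -> 0 < im z <= 1 /\ twofold_zeros f (hmap a e z)) ->
    \sum_(z <- zs) (1 - normc (phi a (hmap a e z)) ^+ 2) <= B.
Proof.
move=> fa ode del0 sep LamL K0 sample.
pose c : R := 1 / (40 * (125 * 10)).
have c0 : 0 < c by rewrite divr_gt0// mulr_gt0// mulr_gt0.
pose P := (Num.truncn (2 / del)).+1.
have delP : 2 <= del * P%:R.
  by rewrite mulrC -ler_pdivrMr// ltW// truncnS_gt.
pose B := (P * P)%N.
exists (12 * (B%:R * (c * pi + 2 * (14 * (K * 24))) / c)).
move=> a e zs da es uzs Hzs.
have h0 n : 0 < hgt R n by exact: hgt_gt0.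
have h1 n : hgt R n <= 1 by have := hgt_le R (leq0n n); rewrite {2}/hgt expr0.
have /choice[gen Hgen] : forall z, exists n, z \in zs -> hgt R n.+1 < im z <= hgt R n.
  move=> z; have [/Hzs[/layer_exists[n hn] _]|] := boolP (z \in zs); first by exists n.
  by exists 0%N.
pose M := (\max_(z <- zs) gen z)%N.
have genM z : z \in zs -> (gen z <= M)%N by move=> zz; exact: leq_bigmax_seq.
pose J := (\max_(z <- zs) Num.truncn `|re z|).+1.
have reJ z : z \in zs -> `|re z| < J%:R.
  move=> zz; apply: (lt_le_trans (truncnS_gt _)); rewrite ler_nat ltnS.
  exact: (@leq_bigmax_seq _ zs xpredT (fun z => Num.truncn `|re z|) z).
pose X n k := gridx J (hgt R n) k.
(* The enlarged box contains the part in layer [n] of every cone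
   [`|re z - x| <= 2 * im z] whose vertex [x] lies below box [k]. *)
pose inbox n k z := hgt R n.+1 <= im z <= hgt R n /\
  X n k - 2 * hgt R n <= re z <= X n k + 3 * hgt R n.
have im0 n k z : inbox n k z -> 0 < im z by move=> [/andP[h _] _]; apply: lt_le_trans h.
have /choice[q Hq] : forall p : nat * nat, exists z, inbox p.1 p.2 z /\
    forall w, inbox p.1 p.2 w -> Lam A0 A1 A2 (hmap a e w) <= 2 * Lam A0 A1 A2 (hmap a e z).
  move=> [n k] /=.
  have [||z hz hz'] := @near_sup R C (inbox n k) (fun w => Lam A0 A1 A2 (hmap a e w)) L.
  - exists (X n k +i* hgt R n)%C; rewrite /inbox /= hgtS; have := h0 n; split; apply/andP; split; lra.
  - move=> w /im0 w0; have dw := hmap_disc es da w0; rewrite LamL// andbT; exact: Lam_ge0.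
  by exists z.
pose Q n k := q (n, k).
have QB n k : inbox n k (Q n k) by have [] := Hq (n, k).
have Q0 n k : 0 < im (Q n k) by apply: im0 (QB n k).
have Qd n k : disc (hmap a e (Q n k)) by exact: hmap_disc.
pose lam n k := 2 * Lam A0 A1 A2 (hmap a e (Q n k)).
have lam0 n k : 0 <= lam n k by rewrite mulr_ge0// Lam_ge0.
have lamP n k w : inbox n k w -> Lam A0 A1 A2 (hmap a e w) <= lam n k.
  by move=> hw; have [_ h] := Hq (n, k); exact: h.
pose col z := Num.truncn ((re z + J%:R) / hgt R (gen z)).
have colP z : z \in zs -> X (gen z) (col z) <= re z < X (gen z) (col z) + hgt R (gen z) /\
    (col z < 2 * J * 2 ^ gen z)%N.
  move=> zz; have := reJ z zz; rewrite ltr_norml => /andP[j1 j2].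
  have t0 : 0 <= (re z + J%:R) / hgt R (gen z).
    by rewrite divr_ge0 ?(ltW (h0 _))//; lra.
  have := truncn_itv t0; rewrite -/(col z) => /andP[t1 t2].
  rewrite ler_pdivlMr// in t1; split.
    rewrite ltr_pdivrMr// -natr1 in t2.
    by rewrite /X /gridx; apply/andP; split; lra.
  rewrite -(ltr_nat R) !natrM natrX -(ltr_pM2r (h0 (gen z))); apply: (le_lt_trans t1).
  rewrite -[ltRHS]mulrA /hgt -exprMn mulfV ?expr1n ?mulr1//; lra.
have packed n k : (count (fun z => (gen z == n) && (col z == k)) zs <= B)%N.
  rewrite -size_filter; apply: (@packing R _ del (X n k) (hgt R n)) => //.
  - by rewrite filter_uniq.
  - move=> z; rewrite mem_filter => /andP[/andP[/eqP <- /eqP <-] zz].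
    by have [] := colP z zz; split => //; rewrite -hgtS; exact: Hgen.
  move=> z w; rewrite !mem_filter => /andP[/andP[/eqP gz _] zz] /andP[/andP[/eqP gw _] ww] zw.
  have [/andP[z0 _] fz] := Hzs z zz; have [/andP[w0 _] fw] := Hzs w ww.
  have := Hgen z zz; have := Hgen w ww; rewrite gz gw hgtS => /andP[w1 w2] /andP[z1 z2].
  apply: (hmap_separation es da) => //; apply: sep => //.
  apply: contraNneq zw => E; have /eqP := hmap_pdist_sqr es da z0 w0.
  rewrite -E /pdist subrr normc0 mul0r expr0n /= mul0r eq_sym sqrf_eq0 => /eqP/eq0_normc/eqP.
  by rewrite subr_eq0 eq_sym.
have near_col z j : z \in zs -> (j %/ 2 ^ (M - gen z))%N = col z ->
    `|re z - X M j| <= 2 * im z.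
  move=> zz /eqP; rewrite divn_eqE ?expn_gt0// => /andP[k1 k2].
  have [/andP[c1 c2] _] := colP z zz; have /andP[g1 g2] := Hgen z zz.
  have := gridx_le J (h0 M) k1; have := gridx_le J (h0 M) (ltnW k2).
  rewrite !gridx_refine ?genM// gridxS; rewrite hgtS in g1; rewrite /X in c1 c2 *.
  by move=> ? ?; rewrite ler_norml; apply/andP; split; lra.
have charged j z1 z2 : (j < 2 * J * 2 ^ M)%N -> z1 \in zs -> z2 \in zs ->
    (j %/ 2 ^ (M - gen z1))%N = col z1 -> (j %/ 2 ^ (M - gen z2))%N = col z2 ->
    (gen z1 < gen z2)%N ->
    c <= \sum_(gen z1 <= n < (gen z2).+1) lam n (j %/ 2 ^ (M - n))%N.
  move=> jM zz1 zz2 k1 k2 g12.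
  have [_ f1] := Hzs z1 zz1; have [_ /twofold_zero0[_ f2]] := Hzs z2 zz2.
  have H := @dyadic_disconjugacy R A0 A1 A2 f a e (gen z1) (gen z2) z1 z2 (X M j)
    (fun n => lam n (j %/ 2 ^ (M - n))%N) fa ode da es g12 (Hgen z1 zz1) (Hgen z2 zz2)
    (near_col z1 j zz1 k1) (near_col z2 j zz2 k2) f1 f2 (fun n => lam0 _ _).
  rewrite -{1}[gen z1]add0n big_addn big_mkord subSn ?(ltnW g12)//.
  under eq_bigr do rewrite addnC.
  apply: H => n z /andP[n1 n2] hz hx; apply: lamP; split => //.
  have nM : (n <= M)%N by apply: leq_trans n2 (genM _ zz2).
  have d0 : (0 < 2 ^ (M - n))%N by rewrite expn_gt0.
  have := divn_eqE j (j %/ 2 ^ (M - n))%N d0; rewrite eqxx => /esym/andP[l1 l2].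
  have := gridx_le J (h0 M) l1; have := gridx_le J (h0 M) (ltnW l2).
  rewrite !gridx_refine// gridxS; move/andP: hz => [_ hz]; move: hx.
  by rewrite ler_norml /X => /andP[? ?] ? ?; apply/andP; split; lra.
have := column_sum (angle_ge0 J M) lam0 (ltW c0) genM packed charged.
have zero_le z : z \in zs -> 1 - normc (phi a (hmap a e z)) ^+ 2 <=
    12 * boxweight M (2 * J) (angle J M) (gen z) (col z).
  move=> zz; have [/andP[z0 _] _] := Hzs z zz; have [/andP[c1 c2] c3] := colP z zz.
  have /andP[g1 g2] := Hgen z zz.
  rewrite hmap_onem_phi// box_angle ?genM//; apply: poisson_le_angle.
  - by rewrite h0 h1.
  - by rewrite z0.
  - by apply/andP; split; [exact: c1|exact: ltW].
have box_le n k : (n <= M)%N -> (k < 2 * J * 2 ^ n)%N ->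
    lam n k * boxweight M (2 * J) (angle J M) n k <=
    14 * (Lam A0 A1 A2 (hmap a e (Q n k)) * (1 - normc (phi a (hmap a e (Q n k))) ^+ 2)).
  move=> nM kJ; rewrite hmap_onem_phi// box_angle//.
  have [b1 b2] := QB n k; rewrite hgtS in b1.
  have := @angle_le_poisson R (X n k) (re (Q n k)) (im (Q n k)) (hgt R n).
  rewrite h0 h1 => /(_ isT b1 b2); have := Lam_ge0 A0 A1 A2 (Qd n k).
  rewrite /lam -/(X n k); move: (Lam _ _ _ _) (atan _ - _) (_ / _) => l t p l0 tp.
  have := ler_wpM2l l0 tp; lra.
have box_sum : \sum_(0 <= n < M.+1) \sum_(0 <= k < 2 * J * 2 ^ n)
    lam n k * boxweight M (2 * J) (angle J M) n k <= 14 * (K * 24).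
  pose s := [seq hmap a e (Q n k) | n <- iota 0 M.+1, k <- iota 0 (2 * J * 2 ^ n)].
  have ds z : z \in s -> disc z by move=> /allpairsPdep[n [k [_ _ ->]]].
  have ov w : disc w -> (count (fun z => (normc (w - z) < (1 - normc z) / 4)%R) s <= 24)%N.
    move=> dw; have [w' [w0 <-]] := hmap_onto es da dw.
    have := @overlap_count R J Q w' M.+1 (fun n => 2 * J * 2 ^ n)%N w0 QB.
    apply: leq_trans; rewrite -!sum1_count [leqLHS]big_mkcond [leqRHS]big_mkcond.
    rewrite /s !big_allpairs_dep; apply: leq_sum => n _; apply: leq_sum => k _.
    by case: ifP => // /(near_hmap es da (Q0 n k) w0) ->.
  have := sample a s 24%N da ds ov.
  rewrite -(ler_pM2l (_ : 0 < 14))//; apply: le_trans.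
  rewrite /s big_allpairs_dep /index_iota !subn0 mulr_sumr.
  rewrite big_seq [leRHS]big_seq; apply: ler_sum => n; rewrite mem_iota /= add0n ltnS => nM.
  rewrite subn0 mulr_sumr big_seq [leRHS]big_seq; apply: ler_sum => k.
  by rewrite mem_iota /= add0n; exact: box_le.
have tot := angle_total J M (2 * J * 2 ^ M).
have main : \sum_(z <- zs) (1 - normc (phi a (hmap a e z)) ^+ 2) <=
    12 * \sum_(z <- zs) boxweight M (2 * J) (angle J M) (gen z) (col z).
  by rewrite mulr_sumr big_seq [leRHS]big_seq; apply: ler_sum => z; exact: zero_le.
move: main box_sum tot; set S := \sum_(z <- zs) boxweight _ _ _ _ _.
set S1 := \sum_(0 <= n < _) _; set S2 := \sum_(0 <= j < _) _; clearbody S S1 S2.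
move=> main box_sum tot H; apply: (le_trans main); rewrite ler_pM2l// ler_pdivlMr// mulrC.
apply: (le_trans H); rewrite ler_wpM2l//; apply: lerD; first by rewrite ler_pM2l.
by rewrite ler_pM2l.
Qed.

End chart.

(** * Uniform separation *)

Section conclusion.
Variable R : realType.
Local Notation C := R[i].
Implicit Types (z w a b e : C).

(** The zeros are divided between the two charts. *)
Lemma twofold_sum (A0 A1 A2 f : C -> C) (del L K : R) :
  analytic_disc f ->
  solves A0 A1 A2 f ->
  0 < del ->
  (forall a b, twofold_zeros f a -> twofold_zeros f b -> a != b -> del < pdist a b) ->
  (forall w, disc w -> Lam A0 A1 A2 w <= L) ->
  0 <= K -> Lam_sampled A0 A1 A2 K ->
  exists B : R, forall a (s : seq C), disc a -> uniq s ->
    (forall b, b \in s -> twofold_zeros f b) ->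
    \sum_(b <- s) (1 - normc (phi a b) ^+ 2) <= B.
Proof.
move=> fa ode del0 sep LamL K0 sample.
have [B HB] := chart_sum fa ode del0 sep LamL K0 sample.
exists (B + B) => a s da us Hs.
have /choice[p Hp] : forall b, exists p : C * C, disc b ->
    [/\ is_sign p.1, 0 < im p.2 <= 1 & hmap a p.1 p.2 = b].
  move=> b; have [db|nb] := pselect (disc b); last by exists (0, 0).
  by have [e [z h]] := hmap_onto_low da db; exists (e, z).
have ds b : b \in s -> disc b by move=> /Hs[].
have part (S : pred C) e : is_sign e -> (forall b, b \in s -> S b -> (p b).1 = e) ->
    \sum_(b <- s | S b) (1 - normc (phi a b) ^+ 2) <= B.
  move=> es He.
  have hb b : b \in [seq x <- s | S x] -> hmap a e (p b).2 = b /\ 0 < im (p b).2 <= 1.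
    by rewrite mem_filter => /andP[/He E bs]; have [_ h1 h2] := Hp b (ds b bs); rewrite -E.
  have := HB a e [seq (p b).2 | b <- [seq x <- s | S x]] da es.
  rewrite big_map map_inj_in_uniq ?filter_uniq//; last first.
    by move=> b b' /hb[h _] /hb[h' _] E; rewrite -h E h'.
  move=> /(_ isT) H; apply: le_trans (H _); last first.
    by move=> _ /mapP[b bs ->]; have [-> h] := hb b bs; split=> //; apply: Hs; move: bs; rewrite mem_filter => /andP[].
  by rewrite -(big_filter s S) le_eqVlt; apply/orP; left; apply/eqP; apply: eq_big_seq => b /hb[->].
rewrite (bigID (fun b => (p b).1 == 1)) /=; apply: lerD.
  by apply: (@part _ 1); [left|move=> b _ /eqP].
apply: (@part _ (-1)); [by right|move=> b bs].
by have [[->|//] _ _] := Hp b (ds b bs); rewrite eqxx.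
Qed.

(** Separated sets meet each compact part of the disc in finitely many points,
    which a grid tells apart. *)
Lemma separated_countable (Z : set C) (del : R) : 0 < del ->
  (forall a, Z a -> disc a) -> (forall a b, Z a -> Z b -> a != b -> del < pdist a b) ->
  countable Z.
Proof.
move=> del0 Zd sep.
pose N z := (Num.truncn (1 - normc z)^-1).+1.
pose P n : R := ((Num.truncn (2 / del)).+1 * n)%:R.
pose key z := (N z, (Num.floor (P (N z) * re z), Num.floor (P (N z) * im z))).
apply/countable_injP; exists (fun z => choice.pickle (key z)).
move=> z w /set_mem Zz /set_mem Zw /(pcan_inj choice.pickleK) E.
have n1 : N z = N w := congr1 fst E.
have k1 : Num.floor (P (N z) * re z) = Num.floor (P (N w) * re w) := congr1 (fun p => p.2.1) E.
have k2 : Num.floor (P (N z) * im z) = Num.floor (P (N w) * im w) := congr1 (fun p => p.2.2) E.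
clear E.
apply/eqP/negPn/negP => zw; have := sep z w Zz Zw zw; apply/negP; rewrite -leNgt.
have dz := Zd z Zz; have dw := Zd w Zw.
have z0 : 0 < 1 - normc z by rewrite subr_gt0.
have nz : 1 < (1 - normc z) * (N z)%:R.
  by rewrite mulrC -ltr_pdivrMr// mul1r; exact: truncnS_gt.
rewrite -n1 in k1 k2; move: (N z) nz k1 k2 => n nz k1 k2.
have n0 : 0 < n%:R :> R by rewrite -(pmulr_rgt0 _ z0); lra.
have P0 : 0 < P n by rewrite /P natrM mulr_gt0.
have Pd : 2 * n%:R <= del * P n.
  rewrite /P natrM mulrA ler_pM2r// mulrC -ler_pdivrMr// ltW// truncnS_gt//.
have cell (x y : R) : Num.floor (P n * x) = Num.floor (P n * y) -> `|x - y| <= (P n)^-1.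
  move=> E; have /andP[a1 a2] := floor_itv (P n * x); have /andP[b1 b2] := floor_itv (P n * y).
  rewrite E in a1 a2; rewrite intrD in a2 b2.
  rewrite -[X in _ <= X]mul1r ler_pdivlMr// -{1}(gtr0_norm P0) -normrM mulrBl ![_ * P n]mulrC.
  by rewrite ler_norml; apply/andP; split; lra.
have zwP : normc (z - w) <= 2 / P n.
  apply: (le_trans (normc_le1 _)); rewrite re_sub im_sub.
  have -> : 2 / P n = (P n)^-1 + (P n)^-1 by rewrite mulr_natl mulr2n.
  by apply: lerD; exact: cell.
rewrite /pdist ler_pdivrMr ?den_gt0//.
apply: (le_trans zwP); apply: (@le_trans _ _ (del * (1 - normc z))); last first.
  rewrite ler_pM2l//.
  have -> : normc (1 - z^* * w) = normc (1 - w^* * z).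
    by rewrite -normcJE rmorphB rmorphM rmorph1 /= conjcK mulrC.
  exact: den_ge.
rewrite ler_pdivrMr//.
have h1 : 2 * ((1 - normc z) * n%:R) <= (1 - normc z) * (del * P n).
  by rewrite mulrCA ler_pM2l.
lra.
Qed.

Lemma enumeration (Z : set C) : countable Z ->
  exists (I : set nat) (u : nat -> C), [/\ Z = u @` I, forall n, I n -> Z (u n) &
    forall n k, I n -> I k -> u n = u k -> n = k].
Proof.
move=> /countable_injP[g gi].
have /choice[u Hu] : forall n, exists z, (g @` Z) n -> Z z /\ g z = n.
  move=> n; have [[z Zz gz]|h] := pselect ((g @` Z) n); first by exists z.
  by exists 0 => /h.
exists (g @` Z), u; split.
- apply/seteqP; split=> [z Zz|_ [n gn <-]]; last by case: (Hu n gn).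
  have gz : (g @` Z) (g z) by exists z.
  exists (g z) => //; have [h1 h2] := Hu _ gz.
  by apply: gi; rewrite ?inE.
- by move=> n /Hu[].
by move=> n k /Hu[_ {2}<-] /Hu[_ {2}<-] ->.
Qed.

Lemma single_union (P : set nat -> (nat -> C) -> Prop) I u :
  P I u -> finite_union_of P (u @` I).
Proof.
move=> h; exists 1%N, (fun=> I), (fun=> u); split => //.
by apply/seteqP; split=> [z zI|z [_ _ //]]; exists ord0.
Qed.

Lemma pdist_sym a b : pdist a b = pdist b a.
Proof.
rewrite /pdist normcB; congr (_ / _).
by rewrite -normcJE rmorphB rmorphM rmorph1 /= conjcK mulrC.
Qed.

Lemma expR_le_ratio (x : R) : 0 < x -> expR (- ((1 - x) / x)) <= x.
Proof.
move=> x0; rewrite expRN -[leRHS]invrK lef_pV2 ?posrE ?expR_gt0 ?invr_gt0//.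
apply: le_trans (expR_ge1Dx _); rewrite mulrBl mul1r mulfV ?gt_eqF//; lra.
Qed.

(** A bound on the sums is a bound on the logarithms of the products, since each
    factor [p] satisfies [p >= p ^ 2 >= expR (- (1 - p ^ 2) / p ^ 2)]. *)
Lemma uniformly_separated (del B : R) (I : set nat) (u : nat -> C) : 0 < del ->
  (forall n, I n -> disc (u n)) -> (forall n k, I n -> I k -> u n = u k -> n = k) ->
  (forall n k, I n -> I k -> n != k -> del < pdist (u n) (u k)) ->
  (forall k (s : seq nat), I k -> uniq s -> (forall n, n \in s -> I n) ->
     \sum_(n <- s) (1 - pdist (u n) (u k) ^+ 2) <= B) ->
  uniformly_separated_seq I u.
Proof.
move=> del0 ud ui sep HB.
apply: (@lt_le_trans _ _ (expR (- (B / del ^+ 2)))%:E); first by rewrite lte_fin expR_gt0.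
apply: le_ereal_inf_tmp => _ [k Ik <-]; rewrite lee_fin.
have p01 n : I n -> 0 <= pdist (u n) (u k) <= 1.
  move=> In; rewrite {1}/pdist divr_ge0 ?normc_ge0//= pdist_phi.
  rewrite -(@expr_le1 _ 2) ?normc_ge0//.
  by have := onem_phi_gt0 (ud n In) (ud k Ik); lra.
have c N : expR (- (B / del ^+ 2)) <= \prod_(0 <= n < N | (n \in I) && (n != k)) pdist (u n) (u k).
  have step : \prod_(0 <= n < N | (n \in I) && (n != k))
      expR (- ((1 - pdist (u n) (u k) ^+ 2) / del ^+ 2)) <=
      \prod_(0 <= n < N | (n \in I) && (n != k)) pdist (u n) (u k).
    apply: ler_prod => n /andP[/set_mem In nk]; rewrite expR_ge0 /=.
    have d1 := sep n k In Ik nk; have /andP[p0 p1] := p01 n In.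
    move: (pdist _ _) d1 p0 p1 => p d1 p0 p1.
    have pp : 0 < p by apply: lt_trans d1.
    apply: (@le_trans _ _ (p ^+ 2)); last by rewrite expr2 ler_piMl.
    apply: le_trans (expR_le_ratio (exprn_gt0 2 pp)).
    rewrite ler_expR lerN2 ler_wpM2l ?subr_ge0 ?expr_le1// lef_pV2 ?posrE ?exprn_gt0//.
    by rewrite ler_pXn2r ?nnegrE// ltW.
  apply: (le_trans _ step); rewrite -expR_sum ler_expR sumrN lerN2 -mulr_suml.
  rewrite ler_pM2r ?invr_gt0 ?exprn_gt0// -big_filter; apply: HB => //.
    by rewrite filter_uniq// iota_uniq.
  by move=> n; rewrite mem_filter => /andP[/andP[/set_mem]].
apply: limr_ge; last by apply: nearW => N; exact: c.
apply: nonincreasing_is_cvgn; last first.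
  by exists 0 => _ [N _ <-]; apply: le_trans (c N); rewrite expR_ge0.
apply/nonincreasing_seqP => N; rewrite big_mkcond big_nat_recr//= -big_mkcond /=.
case: ifP => [/andP[/set_mem In _]|_]; last by rewrite mulr1.
have /andP[_ h] := p01 N In; rewrite ler_piMr//.
by apply: le_trans (c N); rewrite expR_ge0.
Qed.

End conclusion.

Theorem theorem1 (R : realType) (A0 A1 A2 f : R[i] -> R[i])
    (hA0 : analytic_disc A0) (hA1 : analytic_disc A1) (hA2 : analytic_disc A2)
    (hf : analytic_disc f) (fN0 : exists z : R[i], disc z /\ f z <> 0)
    (hode : forall z : R[i], disc z ->
      cderiv 3 f z + A2 z * cderiv 2 f z + A1 z * cderiv 1 f z + A0 z * f z = 0) :
  (weighted_bounded 3 A0 -> weighted_bounded 2 A1 -> weighted_bounded 1 A2 ->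
     finite_union_of (@separated_seq R) (twofold_zeros f)) /\
  (weighted_carleson 1 A0 -> weighted_carleson 0 A1 -> weighted_carleson (-1) A2 ->
     finite_union_of (@uniformly_separated_seq R) (twofold_zeros f)).
Proof.
have zd b : twofold_zeros f b -> disc b by case.
split=> [b0 b1 b2|c0 c1 c2].
  have [M0 H0] := weighted_bounded_le b0; have [M1 H1] := weighted_bounded_le b1.
  have [M2 H2] := weighted_bounded_le b2.
  have [|del del0 sep] := @twofold_zeros_separated R A0 A1 A2 f (M0 + M1 + M2) hf hode.
    by move=> w dw; rewrite /Lam !lerD ?H0 ?H1//; exact: H2.
  have [I [u [ZE uI ui]]] := enumeration (separated_countable del0 zd sep).
  rewrite ZE; apply: single_union; exists del; split => // n k In Ik nk.
  by apply: sep; [exact: uI|exact: uI|apply/eqP => /(ui n k In Ik)].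
have [L HL] := Lam_bounded hA0 hA1 hA2 c0 c1 c2.
have [K K0 HK] := Lam_sample hA0 hA1 hA2 c0 c1 c2.
have [del del0 sep] := twofold_zeros_separated hf hode HL.
have [B HB] := twofold_sum hf hode del0 sep HL K0 HK.
have [I [u [ZE uI ui]]] := enumeration (separated_countable del0 zd sep).
rewrite ZE; apply: single_union; apply: (@uniformly_separated R del B) => //.
- by move=> n In; apply: zd; exact: uI.
- by move=> n k In Ik /eqP nk; apply: sep; [exact: uI|exact: uI|apply/eqP => /(ui n k In Ik)].
move=> k s Ik us sI; have := HB (u k) [seq u n | n <- s] (zd _ (uI k Ik)).
rewrite map_inj_in_uniq//; last by move=> i j /sI Ii /sI Ij; exact: ui.
rewrite us big_map => /(_ isT) H; apply: le_trans (H _).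
  by apply: ler_sum => n _; rewrite pdist_sym pdist_phi.
by move=> _ /mapP[n ns ->]; apply: uI; exact: sI.
Qed.
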